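(* Let $n\geq 4$ be an integer, let $\Phi\in\mathbb{S}^{n-1}$ and let $d$ be the geodesic distance from $\Phi$ on $\mathbb{S}^{n-1}$. Let $\alpha_{n,p}:=\frac{n-p-1}{p}$, and let $S_p,\widetilde S_p,T_p,\widetilde T_p,F_p,G_p$ be the functionals on $W^{1,p}(\mathbb{S}^{n-1})$ defined in the context. All suprema below are over real-valued $u\in W^{1,p}(\mathbb{S}^{n-1})\setminus\{0\}$ for which the denominator of the displayed quotient is nonzero. (i) For $1<p<n-1$, $$\sup_{u}\frac{\alpha_{n,p}^{p}S_{p}(u)}{G_{p}(u)+(n-p)\alpha_{n,p}^{p-1}\widetilde{S}_{p}(u)}=1,\qquad \sup_{u}\frac{\alpha_{n,p}S_{p}(u)-(n-p)\widetilde{S}_{p}(u)}{G_{p}(u)}=\alpha_{n,p}^{1-p}.$$ (ii) For $1<p<n/2$, $$\sup_{u}\frac{\alpha_{n,p}^{p}S_{p}(u)-G_{p}(u)}{\widetilde{S}_{p}(u)}=(n-p)\,\alpha_{n,p}^{p-1}.$$ (iii) For $2\leq p<n-1$, $$\sup_{u}\frac{\alpha_{n,p}^{p}T_{p}(u)}{F_{p}(u)+(p-1)\alpha_{n,p}^{p-1}\widetilde{T}_{p}(u)}=1,\qquad \sup_{u}\frac{\alpha_{n,p}T_{p}(u)-(p-1)\widetilde{T}_{p}(u)}{F_{p}(u)}=\alpha_{n,p}^{1-p},$$ $$\sup_{u}\frac{\alpha_{n,p}^{p}T_{p}(u)-F_{p}(u)}{\widetilde{T}_{p}(u)}=(p-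1)\,\alpha_{n,p}^{p-1}.$$
   Context: $\mathbb{S}^{n-1}$ is the unit sphere in $\mathbb{R}^{n}$ with surface measure $\sigma_{n-1}$ and the Riemannian metric induced from $\mathbb{R}^n$. For a fixed point $\Phi\in\mathbb{S}^{n-1}$, the geodesic distance from $\Phi$ is $d(\Theta)=d(\Theta,\Phi):=\arccos(\Theta\cdot\Phi)\in[0,\pi]$, $\Theta\in\mathbb{S}^{n-1}$. $\nabla_{\mathbb{S}^{n-1}}$ is the (weak) surface gradient: for $f\in L^1(\mathbb{S}^{n-1})$ it is the tangential $L^1$ vector field $\Psi_f$, if it exists, with $\int_{\mathbb{S}^{n-1}}\Psi_f\cdot V\,d\sigma_{n-1}=-\int_{\mathbb{S}^{n-1}}f\,\nabla\cdot V\,d\sigma_{n-1}$ for all smooth tangent vector fields $V$. The Sobolev space is $W^{1,p}(\mathbb{S}^{n-1}):=\{f\in L^p(\mathbb{S}^{n-1}): |\Psi_f|\in L^p(\mathbb{S}^{n-1})\}$, equivalently the completion of $C^\infty(\mathbb{S}^{n-1})$ in the usual Sobolev norm; functions are real-valued. The functionals are $$S_{p}(u):=\int_{\mathbb{S}^{n-1}}\frac{|u|^{p}}{\sin^{p}d}\,d\sigma_{n-1},\qquad \widetilde S_{p}(u):=\int_{\mathbb{S}^{n-1}}\frac{|u|^{p}}{\sin^{p-2}d}\,d\sigma_{n-1},$$ $$T_{p}(u):=\int_{\mathbb{S}^{n-1}}\frac{|u|^{p}}{|\tan d|^{p}}\,d\sigma_{n-1},\qquad \widetilde T_{p}(u):=\int_{\mathbb{S}^{n-1}}\frac{|u|^{p}}{|\tan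 d|^{p-2}}\,d\sigma_{n-1},$$ $$F_{p}(u):=\int_{\mathbb{S}^{n-1}}|\nabla_{\mathbb{S}^{n-1}}u|^{p}\,d\sigma_{n-1},\qquad G_{p}(u):=\int_{\mathbb{S}^{n-1}}|\nabla_{\mathbb{S}^{n-1}}u|^{p}\,|\cos d|^{p}\,d\sigma_{n-1},$$ where $1/|\tan d|=|\cos d|/\sin d$. *)

(* Defs.v *)
From HB Require Import structures.
From mathcomp Require Import all_boot all_order all_algebra.
From mathcomp Require Import all_classical all_reals all_analysis.
From mathcomp Require Import measurable_realfun.

Set Implicit Arguments.
Unset Strict Implicit.
Unset Printing Implicit Defensive.

Import Order.TTheory GRing.Theory Num.Theory.
Import numFieldNormedType.Exports.

Local Open Scope classical_set_scope.
Local Open Scope ring_scope.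

(* The Borel sigma-algebra of R^n, generated by the coordinate functions as the
   library does for [n.-tuple T]. *)
Definition rV_display : measure_display.
Proof. exact: default_measure_display. Qed.

Section rV_measurable.
Context {R : realType} {n : nat}.

Let coors (i : 'I_n) (x : 'rV[R]_n) : R := x 0 i.

Let rV_set0 : g_sigma_preimage coors set0.
Proof. exact: sigma_algebra0. Qed.

Let rV_setC A : g_sigma_preimage coors A -> g_sigma_preimage coors (~` A).
Proof. exact: sigma_algebraC. Qed.

Let rV_bigcup (F : (set 'rV[R]_n)^nat) :
  (forall i, g_sigma_preimage coors (F i)) ->
  g_sigma_preimage coors (\bigcup_i (F i)).
Proof. exact: sigma_algebra_bigcup. Qed.

HB.instance Definition _ := @isMeasurable.Build rV_display
  'rV[R]_n (g_sigma_preimage coors) rV_set0 rV_setC rV_bigcup.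

Lemma measurable_coord (i : 'I_n) :
  measurable_fun [set: 'rV[R]_n] (fun x : 'rV[R]_n => x 0 i).
Proof.
move=> _ Y mY; rewrite setTI; apply: sub_sigma_algebra => /=.
rewrite -bigcup_seq/=; exists i => /=; first by rewrite mem_index_enum.
by exists Y => //; rewrite setTI.
Qed.

Lemma measurable_fun_coordP d (T : measurableType d) (f : T -> 'rV[R]_n) :
  (forall i, measurable_fun [set: T] (fun x => f x 0 i)) ->
  measurable_fun [set: T] f.
Proof.
move=> mf; suff H : g_sigma_preimage (fun i => coors i \o f) `<=` measurable.
  move=> _ A mA; apply: H.
  by rewrite g_sigma_preimage_comp; exists A.
apply: smallest_sub; first exact: sigma_algebra_measurable.
rewrite -bigcup_seq; apply: bigcup_sub => i _ A [B mB <-].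
exact: mf.
Qed.

End rV_measurable.

(* Lebesgue measure on R^n, by iterated products *)
Section lebesgue_rV.
Context {R : realType}.

Section step.
Context {n : nat}.
Variable m : {sigma_finite_measure set 'rV[R]_n -> \bar R}.

Definition rV_cons (z : measurableTypeR R * 'rV[R]_n) : 'rV[R]_n.+1 :=
  \row_i (if unlift ord0 i is Some j then z.2 0 j else z.1).

Let rV_uncons (x : 'rV[R]_n.+1) : measurableTypeR R * 'rV[R]_n :=
  (x 0 ord0, \row_j x 0 (lift ord0 j)).

Lemma measurable_rV_cons : measurable_fun setT rV_cons.
Proof.
apply: measurable_fun_coordP => i; rewrite (_ : (fun z => _) =
    fun z : measurableTypeR R * 'rV[R]_n =>
      if unlift ord0 i is Some j then z.2 0 j else z.1); last first.
  by apply/funext => z; rewrite mxE.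
case: (unlift ord0 i) => [j|]; last exact: measurable_fst.
by apply: (measurableT_comp (measurable_coord j)); exact: measurable_snd.
Qed.

Let measurable_rV_uncons : measurable_fun setT rV_uncons.
Proof.
apply/measurable_fun_pairP; split; first exact: measurable_coord.
apply: measurable_fun_coordP => i /=.
rewrite (_ : (fun x => _) = fun x : 'rV[R]_n.+1 => x 0 (lift ord0 i)).
  exact: measurable_coord.
by apply/funext => x; rewrite mxE.
Qed.

Let rV_consK z : rV_uncons (rV_cons z) = z.
Proof.
case: z => a v; rewrite /rV_uncons /rV_cons mxE unlift_none; congr pair.
by apply/rowP => j; rewrite !mxE liftK.
Qed.

Definition lebesgue_step : set 'rV[R]_n.+1 -> \bar R :=
  pushforward (lebesgue_measure \x m)%E rV_cons.

Let step0 : lebesgue_step set0 = 0%E.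
Proof. by rewrite /lebesgue_step /pushforward preimage_set0 measure0. Qed.

Let step_ge0 A : (0 <= lebesgue_step A)%E.
Proof. by rewrite /lebesgue_step /pushforward measure_ge0. Qed.

Let step_sigma_additive : semi_sigma_additive lebesgue_step.
Proof.
move=> F mF tF mUF; rewrite /lebesgue_step /pushforward preimage_bigcup.
apply: measure_semi_sigma_additive.
- by move=> k; rewrite -[X in measurable X]setTI; exact: measurable_rV_cons.
- apply/trivIsetP => /= i j _ _ ij; rewrite -preimage_setI.
  by move/trivIsetP : tF => /(_ _ _ _ _ ij) ->//; rewrite preimage_set0.
- rewrite -preimage_bigcup -[X in measurable X]setTI.
  exact: measurable_rV_cons.
Qed.

HB.instance Definition _ := isMeasure.Build _ _ _
  lebesgue_step step0 step_ge0 step_sigma_additive.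

Let product_sigma_finite : sigma_finite setT (lebesgue_measure \x m)%E.
Proof.
have /sigma_finiteP[F [TF ndF Foo]] := sigma_finiteT (@lebesgue_measure R).
have /sigma_finiteP[G [TG ndG Goo]] := sigma_finiteT m.
exists (fun k => F k `*` G k).
  rewrite -setXTT TF TG; apply/seteqP; split=> -[x y] /=; last first.
    by move=> [k _ [/= Fx Gy]]; split; exists k.
  move=> [[i _ Fix] [j _ Gjy]]; exists (maxn i j) => //; split.
  - by move: x Fix; exact/subsetPset/ndF/leq_maxl.
  - by move: y Gjy; exact/subsetPset/ndG/leq_maxr.
move=> k; have [? ?] := Foo k; have [? ?] := Goo k.
split; first exact: measurableX.
by rewrite product_measure1E// lte_mul_pinfty// ge0_fin_numE.
Qed.

Let step_sigma_finite : sigma_finite setT lebesgue_step.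
Proof.
have [F TF Foo] := product_sigma_finite.
exists (fun k => rV_uncons @^-1` F k).
  by rewrite -preimage_bigcup -TF preimage_setT.
move=> k; have [mFk Fkoo] := Foo k; split.
  by rewrite -[X in measurable X]setTI; exact: measurable_rV_uncons.
rewrite /lebesgue_step /pushforward -comp_preimage.
by rewrite (_ : _ \o _ = id) //; apply/funext => z /=; exact: rV_consK.
Qed.

HB.instance Definition _ := Measure_isSigmaFinite.Build _ _ _
  lebesgue_step step_sigma_finite.

End step.

Fixpoint lebesgue_rV (n : nat) : {sigma_finite_measure set 'rV[R]_n -> \bar R} :=
  if n is n'.+1 then lebesgue_step (lebesgue_rV n') else dirac (0 : 'rV[R]_0).

End lebesgue_rV.

Section sphere.
Context {R : realType} {n : nat}.
Implicit Types (x y v : 'rV[R]_n) (A : set 'rV[R]_n).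

(* The library norm on 'rV[R]_n is the sup norm, hence the explicit Euclidean
   structure. *)
Definition dotv x y : R := \sum_i x 0 i * y 0 i.

Definition enorm x : R := Num.sqrt (dotv x x).

Definition usphere : set 'rV[R]_n := [set x | enorm x = 1].

Definition direction x : 'rV[R]_n := (enorm x)^-1 *: x.

Definition punctured_ball : set 'rV[R]_n := [set x | 0 < enorm x <= 1].

Lemma measurable_enorm : measurable_fun setT enorm.
Proof.
apply: (measurableT_comp (f := @Num.sqrt R)).
  by apply: continuous_measurable_fun; exact: sqrt_continuous.
apply: measurable_sum => i.
by apply: measurable_funM; exact: measurable_coord.
Qed.

Lemma measurable_direction : measurable_fun setT direction.
Proof.
apply: measurable_fun_coordP => i.
rewrite (_ : (fun x => _) = fun x : 'rV[R]_n => enorm x `^ (-1) * x 0 i).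
  apply: measurable_funM; last exact: measurable_coord.
  apply: (measurableT_comp (f := fun r : R => r `^ (-1))).
    exact: measurable_powR.
  exact: measurable_enorm.
by apply/funext => x; rewrite mxE powR_inv1 // sqrtr_ge0.
Qed.

Lemma measurable_punctured_ball : measurable punctured_ball.
Proof.
rewrite (_ : punctured_ball = setT `&` enorm @^-1` `]0, 1]%classic).
  by apply: measurable_enorm => //; exact: measurable_itv.
by rewrite setTI; apply/seteqP; split => x /=; rewrite in_itv.
Qed.

(* The surface measure of the unit sphere, as a measure on R^n carried by the
   sphere: n times the volume of the cone over A in the unit ball. *)
Definition surface_measure A : \bar R :=
  (n%:R%:E * lebesgue_rV n (direction @^-1` A `&` punctured_ball))%E.

Let surface0 : surface_measure set0 = 0%E.
Proof. by rewrite /surface_measure preimage_set0 set0I measure0 mule0. Qed.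

Let surface_ge0 A : (0 <= surface_measure A)%E.
Proof. by rewrite /surface_measure mule_ge0. Qed.

Let surface_sigma_additive : semi_sigma_additive surface_measure.
Proof.
pose nu := mrestr (lebesgue_rV n) measurable_punctured_ball.
pose nu' := measure_function_pushforward__canonical__measure_function_Measure
  nu measurable_direction.
have n0 : 0 <= n%:R :> R by [].
exact: (@measure_semi_sigma_additive _ _ _ (mscale (NngNum n0) nu')).
Qed.

HB.instance Definition _ := isMeasure.Build _ _ _
  surface_measure surface0 surface_ge0 surface_sigma_additive.

End sphere.

Section sobolev.
Context {R : realType} {n : nat}.
Implicit Types (u f : 'rV[R]_n -> R) (Psi V : 'rV[R]_n -> 'rV[R]_n).

(* C^oo: every iterated directional derivative exists and is differentiable
   everywhere (hence is continuous). *)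
Definition smooth V : Prop := forall (s : seq 'rV[R]_n) (x : 'rV[R]_n),
  differentiable (foldr (fun v W y => 'D_v W y) V s) x.

(* The smooth tangent fields of the sphere are the restrictions to it of the
   smooth fields of R^n that are tangent along it. *)
Definition smooth_tangent V : Prop :=
  smooth V /\ forall x, usphere x -> dotv (V x) x = 0.

(* At a point x of the sphere, delta_mx 0 i - x 0 i *: x is the orthogonal
   projection of the i-th basis vector on the tangent space: this is the trace
   of the tangential derivative, and it only depends on V on the sphere. *)
Definition surface_div V (x : 'rV[R]_n) : R :=
  \sum_(i < n) ('D_(delta_mx 0 i - x 0 i *: x) V x) 0 i.

(* Classes in L^p of the sphere are represented by Borel functions on R^n, of
   which only the values on the sphere matter. *)
Definition is_surface_grad f Psi : Prop :=
  [/\ forall i, (fun x => Psi x 0 i) \in Lfun surface_measure 1%E,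
      {ae surface_measure, forall x, dotv (Psi x) x = 0} &
      forall V, smooth_tangent V ->
        (\int[surface_measure]_(x in usphere) (dotv (Psi x) (V x))%:E =
         - \int[surface_measure]_(x in usphere) (f x * surface_div V x)%:E)%E].

Definition surface_grad f : 'rV[R]_n -> 'rV[R]_n :=
  xget (fun=> 0) [set Psi | is_surface_grad f Psi].

(* The middle condition says that the weak gradient of u exists. *)
Definition sobolev (p : R) u : Prop :=
  [/\ u \in Lfun surface_measure p%:E,
      is_surface_grad u (surface_grad u) &
      (fun x => enorm (surface_grad u x)) \in Lfun surface_measure p%:E].

End sobolev.

Section functionals.
Context {R : realType} {n : nat}.
Variables (Phi : 'rV[R]_n) (p : R).
Implicit Type u : 'rV[R]_n -> R.

Definition geodist (x : 'rV[R]_n) : R := acos (dotv x Phi).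

Local Notation d := geodist.

Definition Sp u : \bar R := (\int[surface_measure]_(x in usphere)
  (`|u x| `^ p / sin (d x) `^ p)%:E)%E.

Definition Sp_tilde u : \bar R := (\int[surface_measure]_(x in usphere)
  (`|u x| `^ p / sin (d x) `^ (p - 2))%:E)%E.

Definition Tp u : \bar R := (\int[surface_measure]_(x in usphere)
  (`|u x| `^ p * (`|cos (d x)| / sin (d x)) `^ p)%:E)%E.

Definition Tp_tilde u : \bar R := (\int[surface_measure]_(x in usphere)
  (`|u x| `^ p * (`|cos (d x)| / sin (d x)) `^ (p - 2))%:E)%E.

Definition Fp u : \bar R := (\int[surface_measure]_(x in usphere)
  (enorm (surface_grad u x) `^ p)%:E)%E.

Definition Gp u : \bar R := (\int[surface_measure]_(x in usphere)
  (enorm (surface_grad u x) `^ p * `|cos (d x)| `^ p)%:E)%E.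

(* A quotient with a non-finite term (in particular an undefined difference
   +oo - +oo, which the library sets to -oo) counts as +oo, so that a finite
   supremum is never due to a convention on +oo. *)
Definition quot (a b : \bar R) : \bar R :=
  if (a \is a fin_num) && (b \is a fin_num) then (fine a / fine b)%:E
  else +oo%E.

Definition sup_quot (num den : ('rV[R]_n -> R) -> \bar R) : \bar R :=
  ereal_sup [set quot (num u) (den u) | u in
    [set u | [/\ sobolev p u, ~ {ae surface_measure, forall x, u x = 0} &
                 den u != 0%E]]].

End functionals.

Definition alpha {R : realType} (n : nat) (p : R) : R := (n%:R - p - 1) / p.

(* Main.v *)
(* Write c = cos d and s = sin d. Rotations of coordinate planes preserve the
   surface measure, so the definition of the weak gradient, tested on rotated
   polynomials times rotation fields, shows that a Sobolev function is absolutely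
   continuous along almost every rotation orbit. The chain rule on the orbits then
   allows |u|^p to be integrated by parts against the tangent fields
   |c|^a c (eps + s^2)^(-p/2) (Phi - c x). With a = 0 and a = p - 2, Young's
   inequality and eps -> 0 this gives, for alpha = (n - p - 1) / p,
     alpha S <= (n - p) S~ + alpha^(1 - p) G,  alpha T <= (p - 1) T~ + alpha^(1 - p) F,
   which are the upper bounds for all six quotients. They are sharp because of the
   profiles |c|^gam s^(-bet), regularized at the poles and the equator: for
   bet < alpha, in the limit G = bet^p S and (n - p) S~ = p (alpha - bet) S when
   gam = bet, and F = bet^p T and (p - 1) T~ = p (alpha - bet) T when gam = 0.
   Finally bet tends to alpha. *)
Require Import Defs.
From HB Require Import structures.
From mathcomp Require Import all_boot all_order all_algebra.
From mathcomp Require Import all_classical all_reals all_analysis.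
From mathcomp Require Import measurable_realfun ring lra.

Set Implicit Arguments.
Unset Strict Implicit.
Unset Printing Implicit Defensive.

Import Order.TTheory GRing.Theory Num.Theory.
Import numFieldNormedType.Exports.

Local Open Scope classical_set_scope.
Local Open Scope ring_scope.


(** * Rotation invariance of the surface measure *)

(** The weak gradient is tested only against smooth tangent fields, so the chain rule for |u|^p has
    to be earned without charts or mollification. For i != j the rotations of the plane (i, j) are
    the flow of X_ij = x_j e_i - x_i e_j, a divergence-free field, so on each orbit only
    one-dimensional calculus remains, and the boundary terms cancel on integration over the sphere.
    These fields span: a tangent field is Y = sum_ij x_j Y_i X_ij, so the orbit identities add up to
    integration by parts against Y. The weight al in Young's inequality is forced: the divergence of
    the weighted field contributes p al = n - 1 - p, Young takes back (p - 1) al, and al is left.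
    The regularized inequality is used twice. Its bound is uniform in eps, so S is finite for every
    Sobolev function; applied to u = 1 it shows that the poles are null and that sin^(-b) d is
    integrable for 1 < b < n - 1. The test profiles need nothing else, and no polar coordinates
    appear. The six suprema are three statements about one abstract triple, read as (S, S~, G) or
    (T, T~, F). *)

Section measure_preserving.
Context d1 d2 (T1 : measurableType d1) (T2 : measurableType d2) (R : realType).
Variables (m1 : {measure set T1 -> \bar R}) (m2 : {measure set T2 -> \bar R}).
Variables (phi : T1 -> T2) (mphi : measurable_fun setT phi).
Hypothesis phi_m : forall A, measurable A -> m1 (phi @^-1` A) = m2 A.

Let m1phi : {measure set T2 -> \bar R} :=
  measure_function_pushforward__canonical__measure_function_Measure m1 mphi.

Let m1phiE (f : T2 -> \bar R) :
  (\int[pushforward m1 phi]_x f x = \int[m2]_x f x)%E.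
Proof.
rewrite -[LHS]/(\int[m1phi]_x f x)%E.
by apply: eq_measure_integral => A mA _; exact: phi_m.
Qed.

Lemma ge0_integral_preserving (f : T2 -> \bar R) :
  measurable_fun setT f -> (forall x, 0 <= f x)%E ->
  (\int[m1]_x f (phi x) = \int[m2]_x f x)%E.
Proof. by move=> mf f0; rewrite -m1phiE ge0_integral_pushforward. Qed.

Lemma integrable_preserving (f : T2 -> \bar R) :
  m2.-integrable setT f -> m1.-integrable setT (f \o phi).
Proof.
move=> /integrableP[mf intf]; apply/integrableP; split.
  exact: measurableT_comp.
rewrite (@ge0_integral_preserving (fun x => `|f x|)%E)//.
exact: measurableT_comp.
Qed.

Lemma integral_preserving (f : T2 -> \bar R) :
  m2.-integrable setT f -> (\int[m1]_x f (phi x) = \int[m2]_x f x)%E.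
Proof.
move=> intf; rewrite -m1phiE integral_pushforward//.
- exact: measurable_int intf.
- exact: integrable_preserving.
Qed.

End measure_preserving.

(** * Lebesgue measure on R^n: translations, cubes, the unit ball *)

Section lebesgue_rV_theory.
Context {R : realType}.
Implicit Types (n : nat).

(** The pushforward by x -> x + a gives every half-open interval its length, which characterizes
    Lebesgue measure. *)
Lemma ge0_integral_lebesgue1D (f : R -> \bar R) (a : R) :
  measurable_fun setT f -> (forall x, 0 <= f x)%E ->
  (\int[@lebesgue_measure R]_x f (x + a)%R = \int[@lebesgue_measure R]_x f x)%E.
Proof.
move=> mf f0.
have ma : measurable_fun setT ((fun x => x + a) : measurableTypeR R -> measurableTypeR R).
  exact: measurable_funD.
apply: (ge0_integral_preserving ma) => // A mA.
pose nu : {measure set (measurableTypeR R) -> \bar R} :=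
  measure_function_pushforward__canonical__measure_function_Measure (@lebesgue_measure R) ma.
apply/esym/(lebesgue_measure_unique (mu := nu)) => //= _ [[b c]] _ <-.
rewrite /pushforward (_ : _ @^-1` _ = `](b - a), (c - a)]%classic).
  by rewrite !lebesgue_measure_itv/= !lte_fin ltrD2r -!EFinB opprB addrA subrK.
by apply/seteqP; split => x /=; rewrite !in_itv/= ltrBlDr lerBrDr.
Qed.

Lemma ge0_integral_lebesgue_rVS n (f : 'rV[R]_n.+1 -> \bar R) :
  measurable_fun setT f -> (forall x, 0 <= f x)%E ->
  (\int[lebesgue_rV n.+1]_x f x =
   \int[@lebesgue_measure R]_t \int[lebesgue_rV n]_v f (rV_cons (t, v)))%E.
Proof.
move=> mf f0.
rewrite -(ge0_integral_preserving (m1 := (lebesgue_measure \x lebesgue_rV n)%E)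
  (phi := @rV_cons R n) _ _ mf)//; last exact: measurable_rV_cons.
rewrite fubini_tonelli1//.
by apply: measurableT_comp => //; exact: measurable_rV_cons.
Qed.

Lemma measurable_addrV n (a : 'rV[R]_n) : measurable_fun setT (fun x : 'rV[R]_n => x + a).
Proof.
apply: measurable_fun_coordP => i.
rewrite (_ : (fun x => _) = fun x : 'rV[R]_n => x 0 i + a 0 i).
  by apply: measurable_funD => //; exact: measurable_coord.
by apply/funext => x; rewrite mxE.
Qed.

(** Induction on n through Tonelli: translating [rV_cons (t, v)] translates t and v separately, so
    the induction hypothesis handles v and the one-dimensional case handles t. *)
Lemma ge0_integral_lebesgue_rVD n (f : 'rV[R]_n -> \bar R) (a : 'rV[R]_n) :
  measurable_fun setT f -> (forall x, 0 <= f x)%E ->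
  (\int[lebesgue_rV n]_x f (x + a)%R = \int[lebesgue_rV n]_x f x)%E.
Proof.
elim: n f a => [|n IH] f a mf f0.
  by apply: eq_integral => x _; rewrite (thinmx0 a) addr0.
rewrite ge0_integral_lebesgue_rVS//; last first.
  by apply: measurableT_comp => //; exact: measurable_addrV.
have consD t v : rV_cons (t, v) + a =
    rV_cons (t + a 0 ord0, v + \row_j a 0 (lift ord0 j)).
  apply/rowP => i; rewrite !mxE; case: unliftP => [j|] -> /=; last by [].
  by rewrite !mxE.
under eq_integral => t _ do under eq_integral => v _ do rewrite consD.
have mcons t : measurable_fun setT (fun v : 'rV[R]_n => f (rV_cons (t, v))).
  apply: measurableT_comp => //; apply: measurableT_comp => //.
  exact: measurable_rV_cons.
under eq_integral => t _ do rewrite (IH (fun v => f (rV_cons (t + a 0 ord0, v))))//.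
rewrite (@ge0_integral_lebesgue1D (fun t => \int[lebesgue_rV n]_v f (rV_cons (t, v)))%E).
- by rewrite ge0_integral_lebesgue_rVS.
- apply: (@measurable_fun_fubini_tonelli_F _ _ _ _ _ (lebesgue_rV n)
    (fun z : measurableTypeR R * 'rV[R]_n => f (rV_cons z))) => //.
  by apply: measurableT_comp => //; exact: measurable_rV_cons.
- by move=> t; exact: integral_ge0.
Qed.

(** Cubes have an explicit measure and replace a computation of the volume of the ball: the cube of
    half-side 1 contains the punctured ball, and the cube of half-side 1/n without the origin lies
    in it. *)
Definition cube n (a : R) : set 'rV[R]_n := [set x | forall i, `|x 0 i| <= a].

Arguments cube : clear implicits.

Lemma measurable_cube n a : measurable (cube n a).
Proof.
rewrite (_ : cube n a = \bigcap_(i in [set: 'I_n]) [set x : 'rV[R]_n | `|x 0 i| <= a]).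
  apply: fin_bigcap_measurable => // i _.
  rewrite -[X in measurable X]setTI.
  apply: (measurable_fun_le (f := fun x : 'rV[R]_n => `|x 0 i|) (g := cst a)) => //.
  by apply: measurableT_comp => //; exact: measurable_coord.
by apply/seteqP; split => x xa i; [move=> _; exact: xa|exact: xa].
Qed.

Lemma lebesgue_rV_cube n a : 0 <= a -> lebesgue_rV n (cube n a) = ((a *+ 2) ^+ n)%:E.
Proof.
move=> a0; elim: n => [|n IH].
  rewrite expr0 /= diracE mem_set// => i; by case: i.
rewrite /= /lebesgue_step /pushforward (_ : _ @^-1` _ = `[- a, a]%classic `*` cube n a).
  rewrite product_measure1E//; last exact: measurable_cube.
  rewrite exprS EFinM; congr (_ * _)%E; last exact: IH.
  have -> : (a *+ 2)%:E = lebesgue_measure (`[- a, a]%classic : set R); last by [].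
  rewrite lebesgue_measure_itv/= lte_fin.
  case: ltP => [_|]; first by rewrite -EFinB opprK mulr2n.
  move=> aa; have -> : a = 0 by lra.
  by rewrite mul0rn.
apply/seteqP; split => [[t v] /= H|[t v] /= [H1 H2] i].
  split => /=.
    by have := H ord0; rewrite mxE unlift_none/= in_itv/= ler_norml.
  by move=> i; have := H (lift ord0 i); rewrite mxE liftK.
rewrite mxE; case: unliftP => [j|] _ /=; first exact: H2.
by move: H1; rewrite in_itv/= ler_norml.
Qed.

Lemma dotvv_ge0 n (x : 'rV[R]_n) : 0 <= dotv x x.
Proof. by apply: sumr_ge0 => i _; rewrite -expr2 sqr_ge0. Qed.

Lemma enorm_sqr n (x : 'rV[R]_n) : enorm x ^+ 2 = dotv x x.
Proof. by rewrite sqr_sqrtr// dotvv_ge0. Qed.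

Lemma enorm_ge0 n (x : 'rV[R]_n) : 0 <= enorm x.
Proof. exact: sqrtr_ge0. Qed.

Lemma normr_coord n (x : 'rV[R]_n) i : `|x 0 i| <= enorm x.
Proof.
rewrite -ler_sqr ?nnegrE ?enorm_ge0// enorm_sqr real_normK ?num_real//.
rewrite /dotv (bigD1 i)//= -expr2 lerDl.
by apply: sumr_ge0 => j _; rewrite -expr2 sqr_ge0.
Qed.

Lemma lebesgue_rV_ball_lty n : (lebesgue_rV n (@punctured_ball R n) < +oo)%E.
Proof.
apply: (@le_lt_trans _ _ (lebesgue_rV n (cube n 1))).
  apply: le_measure; rewrite ?inE.
  - exact: measurable_punctured_ball.
  - exact: measurable_cube.
  by move=> x /= /andP[_ x1] i; rewrite (le_trans (normr_coord _ _)).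
by rewrite lebesgue_rV_cube// ltry.
Qed.

Lemma lebesgue_rV_ball_gt0 n : (0 < n)%N -> (0 < lebesgue_rV n (@punctured_ball R n))%E.
Proof.
move=> n0.
(* Each squared coordinate is at most n^-2 <= n^-1, so n of them add up to at most 1; [cube n 0] is
   the origin, which the punctured ball omits. *)
have H : cube n (n%:R^-1) `\` cube n 0 `<=` @punctured_ball R n.
  move=> x /= [xn x0]; apply/andP; split.
    rewrite lt_neqAle enorm_ge0 andbT eq_sym; apply: contra_notN x0 => /eqP x0 i.
    by rewrite -x0; exact: normr_coord.
  rewrite -(@ler_sqr _ _ 1) ?nnegrE ?enorm_ge0// enorm_sqr expr1n.
  rewrite /dotv (@le_trans _ _ (\sum_(i < n) n%:R^-1))//; last first.
    by rewrite sumr_const card_ord -[leLHS]mulr_natr mulVf// pnatr_eq0 -lt0n.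
  apply: ler_sum => i _; rewrite -expr2 -real_normK ?num_real//.
  have h : (n%:R^-1 : R) <= 1 by rewrite invf_le1 ?ler1n// ltr0n.
  rewrite (@le_trans _ _ (n%:R^-1 ^+ 2))//.
    by rewrite ler_sqr ?nnegrE// ?invr_ge0// xn.
  by rewrite expr2 ler_piMr// invr_ge0.
apply: (@lt_le_trans _ _ (lebesgue_rV n (cube n n%:R^-1 `\` cube n 0))); last first.
  apply: le_measure; rewrite ?inE => //.
  - by apply: measurableD; exact: measurable_cube.
  - exact: measurable_punctured_ball.
rewrite measureD//=; [|exact: measurable_cube|exact: measurable_cube|].
  rewrite setIidr.
    rewrite !lebesgue_rV_cube ?invr_ge0// mul0rn expr0n.
    by rewrite -[n == 0]negbK -lt0n n0/= sube0 lte_fin exprn_gt0// pmulrn_lgt0// invr_gt0 ltr0n.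
  by move=> x /= H0 i; rewrite (le_trans (H0 i))// invr_ge0.
by rewrite lebesgue_rV_cube ?ltry// invr_ge0.
Qed.

End lebesgue_rV_theory.

Section dotv_theory.
Context {R : realType} {n : nat}.
Implicit Types x y z : 'rV[R]_n.

Lemma dotvC x y : dotv x y = dotv y x.
Proof. by apply: eq_bigr => i _; rewrite mulrC. Qed.

Lemma dotvDl x y z : dotv (x + y) z = dotv x z + dotv y z.
Proof. by rewrite -big_split; apply: eq_bigr => i _; rewrite mxE mulrDl. Qed.

Lemma dotvZl a x y : dotv (a *: x) y = a * dotv x y.
Proof. by rewrite mulr_sumr; apply: eq_bigr => i _; rewrite mxE mulrA. Qed.

Lemma dotvNl x y : dotv (- x) y = - dotv x y.
Proof. by rewrite -scaleN1r dotvZl mulN1r. Qed.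

Lemma dotvBl x y z : dotv (x - y) z = dotv x z - dotv y z.
Proof. by rewrite dotvDl dotvNl. Qed.

Lemma dotvDr x y z : dotv x (y + z) = dotv x y + dotv x z.
Proof. by rewrite dotvC dotvDl !(dotvC x). Qed.

Lemma dotvZr a x y : dotv x (a *: y) = a * dotv x y.
Proof. by rewrite dotvC dotvZl dotvC. Qed.

Lemma dotvNr x y : dotv x (- y) = - dotv x y.
Proof. by rewrite dotvC dotvNl dotvC. Qed.

Lemma dotvBr x y z : dotv x (y - z) = dotv x y - dotv x z.
Proof. by rewrite dotvDr dotvNr. Qed.

Lemma dotv_deltal i x : dotv (delta_mx 0 i) x = x 0 i.
Proof.
rewrite /dotv (bigD1 i)//= big1 ?addr0 => [|j ji]; first by rewrite mxE !eqxx mul1r.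
by rewrite mxE (negbTE ji) andbF mul0r.
Qed.

Lemma dotv_deltar i x : dotv x (delta_mx 0 i) = x 0 i.
Proof. by rewrite dotvC dotv_deltal. Qed.

Lemma dotv_Cauchy_Schwarz x y : dotv x y ^+ 2 <= dotv x x * dotv y y.
Proof.
have [y0|y0] := eqVneq (dotv y y) 0.
  rewrite y0 mulr0; suff -> : dotv x y = 0 by rewrite expr0n.
  rewrite /dotv big1// => i _; have : y 0 i == 0.
    move/eqP: y0; rewrite psumr_eq0; last by move=> j _; rewrite -expr2 sqr_ge0.
    by move=> /allP /(_ i); rewrite mem_index_enum => /(_ isT); rewrite mulf_eq0 orbb.
  by move=> /eqP ->; rewrite mulr0.
have {}y0 : 0 < dotv y y by rewrite lt_neqAle eq_sym y0 dotvv_ge0.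
have := dotvv_ge0 (dotv y y *: x - dotv x y *: y).
rewrite !(dotvBl, dotvBr, dotvZl, dotvZr) (dotvC y x) => h.
suff : 0 <= dotv y y * (dotv x x * dotv y y - dotv x y ^+ 2) by rewrite pmulr_rge0// subr_ge0.
by apply: le_trans h _; rewrite le_eqVlt; apply/orP; left; apply/eqP; ring.
Qed.

Lemma normr_dotv_le x y : `|dotv x y| <= enorm x * enorm y.
Proof.
rewrite -ler_sqr ?nnegrE ?mulr_ge0 ?enorm_ge0// exprMn !enorm_sqr.
by rewrite real_normK ?num_real// dotv_Cauchy_Schwarz.
Qed.

Lemma enormZ a x : enorm (a *: x) = `|a| * enorm x.
Proof. by rewrite /enorm dotvZl dotvZr mulrA sqrtrM ?sqr_ge0// -expr2 sqrtr_sqr. Qed.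

Lemma enormN x : enorm (- x) = enorm x.
Proof. by rewrite -scaleN1r enormZ normrN1 mul1r. Qed.

Lemma uspherevv x : usphere x <-> dotv x x = 1.
Proof.
rewrite /usphere /= -enorm_sqr; split => [->|/eqP]; first by rewrite expr1n.
by rewrite sqrp_eq1 ?enorm_ge0// => /eqP.
Qed.

Lemma measurable_usphere : measurable (@usphere R n).
Proof.
rewrite (_ : usphere = setT `&` (@enorm R n) @^-1` [set 1]).
  by apply: measurable_enorm => //; exact: measurable_set1.
by rewrite setTI; apply/seteqP; split.
Qed.

Lemma measurable_dotv v : measurable_fun setT (fun x : 'rV[R]_n => dotv v x).
Proof.
by apply: measurable_sum => i; apply: measurable_funM => //; exact: measurable_coord.
Qed.

Lemma measurable_fun_rVD d (T : measurableType d) (f g : T -> 'rV[R]_n) :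
  measurable_fun setT f -> measurable_fun setT g ->
  measurable_fun setT (fun t => f t + g t).
Proof.
move=> mf mg; apply: measurable_fun_coordP => i.
rewrite (_ : (fun t => _) = fun t : T => f t 0 i + g t 0 i); last first.
  by apply/funext => t; rewrite mxE.
by apply: measurable_funD; exact: (measurableT_comp (measurable_coord i)).
Qed.

Lemma measurable_fun_rVZ d (T : measurableType d) (f : T -> 'rV[R]_n) (g : T -> R) :
  measurable_fun setT f -> measurable_fun setT g ->
  measurable_fun setT (fun t => g t *: f t).
Proof.
move=> mf mg; apply: measurable_fun_coordP => i.
rewrite (_ : (fun t => _) = fun t : T => g t * f t 0 i); last first.
  by apply/funext => t; rewrite mxE.
by apply: measurable_funM => //; exact: (measurableT_comp (measurable_coord i)).
Qed.

Lemma measurable_fun_rVN d (T : measurableType d) (f : T -> 'rV[R]_n) :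
  measurable_fun setT f -> measurable_fun setT (fun t => - f t).
Proof.
move=> mf; rewrite (_ : (fun t => _) = fun t => (-1) *: f t).
  exact: measurable_fun_rVZ.
by apply/funext => t; rewrite scaleN1r.
Qed.

End dotv_theory.

Lemma mule_pos_injr {R : realType} (a b c : \bar R) : (0 < a)%E -> (a < +oo)%E ->
  (b * a = c * a)%E -> b = c.
Proof.
case: a => //= r; rewrite lte_fin => r0 _ /(congr1 (fun z => z * r^-1%:E)%E).
by rewrite -!muleA -EFinM mulfV ?gt_eqF// !mule1.
Qed.

Section rotation.
Context {R : realType} {n : nat}.
Variables i j : 'I_n.
Implicit Types (x y : 'rV[R]_n) (r s : R).

(** The flow of [rotfield], a rotation of angle r when i != j. Written as x plus multiples of two
    basis vectors, it is visibly linear in x and smooth in r, with no case distinction on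
    coordinates. *)
Definition plane_rot r x : 'rV[R]_n :=
  x + ((cos r - 1) * x 0 i + sin r * x 0 j) *: delta_mx 0 i
    + ((cos r - 1) * x 0 j - sin r * x 0 i) *: delta_mx 0 j.

Definition rotfield x : 'rV[R]_n := x 0 j *: delta_mx 0 i - x 0 i *: delta_mx 0 j.

Lemma dotv_rotfield v x : dotv v (rotfield x) = x 0 j * v 0 i - x 0 i * v 0 j.
Proof. by rewrite dotvBr !dotvZr !dotv_deltar. Qed.

Lemma plane_rotZ r a x : plane_rot r (a *: x) = a *: plane_rot r x.
Proof. by apply/rowP => k; rewrite !mxE; ring. Qed.

Lemma plane_rotD r x y : plane_rot r (x + y) = plane_rot r x + plane_rot r y.
Proof. by apply/rowP => k; rewrite !mxE; ring. Qed.

Lemma plane_rot0 x : plane_rot 0 x = x.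
Proof. by apply/rowP => k; rewrite !mxE cos0 sin0; ring. Qed.

Lemma measurable_rot d (T : measurableType d) (f : T -> R) (g : T -> 'rV[R]_n) :
  measurable_fun setT f -> measurable_fun setT g ->
  measurable_fun setT (fun z => plane_rot (f z) (g z)).
Proof.
move=> mf mg; have mgk k : measurable_fun setT (fun z => g z 0 k).
  exact: (measurableT_comp (measurable_coord k)).
have mcos : measurable_fun setT (fun z => cos (f z) - 1).
  apply: measurable_funB => //; apply: measurableT_comp => //.
  by apply: continuous_measurable_fun; exact: continuous_cos.
have msin : measurable_fun setT (fun z => sin (f z)).
  apply: measurableT_comp => //.
  by apply: continuous_measurable_fun; exact: continuous_sin.
apply: measurable_fun_rVD.
  apply: measurable_fun_rVD => //; apply: measurable_fun_rVZ => //.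
  by apply: measurable_funD; exact: measurable_funM.
apply: measurable_fun_rVZ => //.
by apply: measurable_funB; exact: measurable_funM.
Qed.

Hypothesis ij : i != j.

Lemma plane_rotE r x k : plane_rot r x 0 k =
  if k == i then cos r * x 0 i + sin r * x 0 j else
  if k == j then cos r * x 0 j - sin r * x 0 i else x 0 k.
Proof.
rewrite !mxE eqxx/=; have [->|ki] := eqVneq k i.
  by rewrite (negbTE ij) /= mulr0 mulr1; ring.
have [->|kj] := eqVneq k j; last by rewrite /= !mulr0 !addr0.
by rewrite /= mulr0 mulr1; ring.
Qed.

Lemma plane_rot_rot r s x : plane_rot r (plane_rot s x) = plane_rot (r + s) x.
Proof.
have ji : j != i by rewrite eq_sym.
apply/rowP => k; rewrite !plane_rotE eqxx (negbTE ji) eqxx cosD sinD.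
have [_|_] := eqVneq k i; first by ring.
by have [_|//] := eqVneq k j; ring.
Qed.

Lemma plane_rotK r : cancel (plane_rot r) (plane_rot (- r)).
Proof. by move=> x; rewrite plane_rot_rot addNr plane_rot0. Qed.

Lemma plane_rotVK r : cancel (plane_rot (- r)) (plane_rot r).
Proof. by move=> x; rewrite plane_rot_rot addrN plane_rot0. Qed.

Lemma dotv_rot r x y : dotv (plane_rot r x) (plane_rot r y) = dotv x y.
Proof.
have dij : (delta_mx 0 i : 'rV[R]_n) 0 j = 0 by rewrite mxE eq_sym (negbTE ij) andbF.
have dji : (delta_mx 0 j : 'rV[R]_n) 0 i = 0 by rewrite mxE (negbTE ij) andbF.
have dii : (delta_mx 0 i : 'rV[R]_n) 0 i = 1 by rewrite mxE !eqxx.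
have djj : (delta_mx 0 j : 'rV[R]_n) 0 j = 1 by rewrite mxE !eqxx.
rewrite /plane_rot !(dotvDl, dotvDr, dotvZl, dotvZr, dotv_deltal, dotv_deltar) dij dji dii djj.
have := cos2Dsin2 r; set c := cos r; set s := sin r => cs.
have cs' : s ^+ 2 = 1 - c ^+ 2 by rewrite -cs addrAC subrr add0r.
by ring: cs'.
Qed.

Lemma dotv_rotl r x y : dotv (plane_rot r x) y = dotv x (plane_rot (- r) y).
Proof. by rewrite -[in LHS](plane_rotVK r y) dotv_rot. Qed.

Lemma enorm_rot r x : enorm (plane_rot r x) = enorm x.
Proof. by rewrite /enorm dotv_rot. Qed.

Lemma usphere_rot r x : usphere (plane_rot r x) <-> usphere x.
Proof. by rewrite /usphere/= enorm_rot. Qed.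

Lemma direction_rot r x : direction (plane_rot r x) = plane_rot r (direction x).
Proof. by rewrite /direction enorm_rot plane_rotZ. Qed.

(* A translation-invariant measure is determined by its value on one symmetric
   set: Tonelli and two translations give lam(A) lam(plane_rot^-1 B) = lam(B) lam(A)
   when A is a ball. *)
Lemma lebesgue_rV_rot r (B : set 'rV[R]_n) : measurable B ->
  lebesgue_rV n (plane_rot r @^-1` B) = lebesgue_rV n B.
Proof.
move=> mB; pose A := @punctured_ball R n; pose l := @lebesgue_rV R n.
have n0 : (0 < n)%N by case: n i => [|//] [].
have mA : measurable A by exact: measurable_punctured_ball.
have mT k (f g : 'rV[R]_n * 'rV[R]_n -> 'rV[R]_n) (D : set 'rV[R]_n) :
   k = (fun z => (\1_A (f z) * \1_D (g z) : R)%:E) -> measurable D ->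
   measurable_fun setT f -> measurable_fun setT g -> measurable_fun setT k.
  move=> -> mD mf mg; apply/measurable_EFinP/measurable_funM.
    exact: (measurableT_comp (measurable_indic mA)).
  exact: (measurableT_comp (measurable_indic mD)).
have mrD : measurable_fun setT (fun z : 'rV[R]_n * 'rV[R]_n => z.1 + plane_rot r z.2).
  apply: measurable_fun_rVD; first exact: measurable_fst.
  by apply: measurable_rot => //; exact: measurable_snd.
have mrB : measurable_fun setT (fun z : 'rV[R]_n * 'rV[R]_n => z.1 - plane_rot r z.2).
  apply: measurable_fun_rVD; first exact: measurable_fst.
  apply: measurable_fun_rVN; apply: measurable_rot => //; exact: measurable_snd.
have mrot : measurable (plane_rot r @^-1` B).
  by rewrite -[X in measurable X]setTI; exact: measurable_rot.
have mi (D : set 'rV[R]_n) (h : 'rV[R]_n -> 'rV[R]_n) : measurable D ->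
    measurable_fun setT h -> measurable_fun setT (fun y => (\1_D (h y) : R)%:E).
  by move=> mD mh; apply/measurable_EFinP; exact: (measurableT_comp (measurable_indic mD)).
have mc (D : set 'rV[R]_n) (c : R) (h : 'rV[R]_n -> 'rV[R]_n) : measurable D ->
    measurable_fun setT h -> measurable_fun setT (fun y => (c * \1_D (h y) : R)%:E).
  move=> mD mh; apply/measurable_EFinP/measurable_funM => //.
  exact: (measurableT_comp (measurable_indic mD)).
have iE (D : set 'rV[R]_n) : measurable D -> (\int[l]_x (\1_D x)%:E = l D)%E.
  by move=> mD; rewrite integral_indic// setIT.
have TR (D : set 'rV[R]_n) a (h : 'rV[R]_n -> 'rV[R]_n) : measurable D -> measurable_fun setT h ->
    (\int[l]_x (\1_D (h (x + a)%R))%:E = \int[l]_x (\1_D (h x))%:E)%E.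
  move=> mD mh; rewrite (ge0_integral_lebesgue_rVD (f := fun y => (\1_D (h y))%:E))//.
  exact: mi.
have ieq (D D' : set 'rV[R]_n) y y' : (D y <-> D' y') -> \1_D y = \1_D' y' :> R.
  by move=> h; rewrite !indicE (_ : (y \in D) = (y' \in D'))//; apply/idP/idP => /set_mem/h/mem_set.
have i0 (x : 'rV[R]_n) D : 0 <= \1_D x :> R by rewrite indicE; case: (_ \in _).
(* For fixed y the shift of x by [- plane_rot r y] turns f into g, so the double integrals agree.
   Integrating over y first gives lam(A) lam(plane_rot^-1 B) for f and lam(B) lam(A) for g. *)
pose f z : \bar R := (\1_A z.1 * \1_B (z.1 + plane_rot r z.2))%:E.
pose g z : \bar R := (\1_A (z.1 - plane_rot r z.2) * \1_B z.1)%:E.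
have mf : measurable_fun setT f by apply: mT => //.
have mg : measurable_fun setT g by apply: mT => //.
have f0 z : (0 <= f z)%E by rewrite lee_fin mulr_ge0.
have g0 z : (0 <= g z)%E by rewrite lee_fin mulr_ge0.
have E1 : (\int[l]_x \int[l]_y f (x, y) = l A * l (plane_rot r @^-1` B))%E.
  transitivity (\int[l]_x ((\1_A x)%:E * l (plane_rot r @^-1` B)))%E.
    apply: eq_integral => x _; rewrite /f/=.
    under eq_integral do rewrite EFinM.
    rewrite ge0_integralZl ?lee_fin//; last first.
      apply: mi => //.
      exact: (measurableT_comp mrD (measurable_pair1 x)).
    congr (_ * _)%E; rewrite -iE//.
    rewrite -(TR _ (plane_rot (- r) x) id)//.
    by apply: eq_integral => y _; congr (_%:E); apply: ieq; rewrite /= plane_rotD plane_rotVK// addrC.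
  rewrite ge0_integralZr//; last exact: mi.
  by rewrite iE.
have E2 : (\int[l]_x \int[l]_y g (x, y) = l B * l A)%E.
  transitivity (\int[l]_x ((\1_B x)%:E * l A))%E.
    apply: eq_integral => x _; rewrite /g/=.
    under eq_integral do rewrite mulrC EFinM.
    rewrite ge0_integralZl ?lee_fin//; last first.
      apply: mi => //.
      exact: (measurableT_comp mrB (measurable_pair1 x)).
    congr (_ * _)%E; rewrite -iE//.
    rewrite -(TR _ (plane_rot (- r) x) (fun y => x - plane_rot r y))//; last exact: (measurableT_comp mrB (measurable_pair1 x)).
    apply: eq_integral => y _; rewrite plane_rotD plane_rotVK// opprD addrCA subrr addr0; congr (_%:E); apply: ieq.
    (* After the shift the indicator of A is evaluated at [- plane_rot r y], and membership in A
       depends on the norm only. *)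
    by rewrite /A /punctured_ball/= enormN enorm_rot.
  rewrite ge0_integralZr//; last exact: mi.
  by rewrite iE.
have E12 : (\int[l]_x \int[l]_y f (x, y) = \int[l]_x \int[l]_y g (x, y))%E.
  rewrite (fubini_tonelli f mf f0) (fubini_tonelli g mg g0).
  apply: eq_integral => y _.
  rewrite -(ge0_integral_lebesgue_rVD (- plane_rot r y))//.
    by apply: eq_integral => x _; rewrite /f/g/= subrK.
  exact: (measurableT_comp mf (measurable_pair2 _)).
have lA0 : (0 < l A)%E by exact: lebesgue_rV_ball_gt0.
have lAoo : (l A < +oo)%E by exact: lebesgue_rV_ball_lty.
by move: E12; rewrite E1 E2 muleC; exact: mule_pos_injr.
Qed.

Lemma surface_measure_rot r (B : set 'rV[R]_n) : measurable B ->
  surface_measure (plane_rot r @^-1` B) = surface_measure B.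
Proof.
move=> mB; rewrite /surface_measure; congr (_ * _)%E.
rewrite -[RHS](lebesgue_rV_rot r); last first.
  apply: measurableI; last exact: measurable_punctured_ball.
  by rewrite -[X in measurable X]setTI; exact: measurable_direction.
congr (lebesgue_rV n _); apply/seteqP.
by split => x; rewrite /punctured_ball /= direction_rot enorm_rot.
Qed.

End rotation.

(** * The surface measure is finite, nonzero and carried by the sphere *)

Section surface_measure_theory.
Context {R : realType} {n : nat}.
Local Notation sigma := (@surface_measure R n).

Lemma surface_measure_lty : (sigma setT < +oo)%E.
Proof.
by rewrite /surface_measure preimage_setT setTI lte_mul_pinfty// lebesgue_rV_ball_lty.
Qed.

Let surface_fin_num_fun : fin_num_fun sigma.
Proof. exact: lty_fin_num_fun surface_measure_lty. Qed.

HB.instance Definition _ := Measure_isFinite.Build _ _ _ sigma surface_fin_num_fun.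

Lemma surface_measure_gt0 : (0 < n)%N -> (0 < sigma setT)%E.
Proof.
move=> n0; rewrite /surface_measure preimage_setT setTI.
by rewrite mule_gt0 ?lte_fin ?ltr0n// lebesgue_rV_ball_gt0.
Qed.

Lemma surface_measure_usphereC : sigma (~` usphere) = 0%E.
Proof.
rewrite /surface_measure (_ : _ `&` _ = set0) ?measure0 ?mule0//.
rewrite -subset0 => x [/= dx /andP[x0 _]]; apply: dx.
by rewrite /usphere /direction /= enormZ ger0_norm ?invr_ge0 ?enorm_ge0// mulVf// gt_eqF.
Qed.

Lemma ae_usphere : {ae sigma, forall x, usphere x}.
Proof.
exists (~` usphere); split => //; last exact: surface_measure_usphereC.
by apply: measurableC; exact: measurable_usphere.
Qed.

(** The complement of the sphere is null. Integrals can therefore run over the whole space, and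
    facts that hold on the sphere enter through [ae_usphere]. *)
Lemma integral_usphere (f : 'rV[R]_n -> \bar R) : measurable_fun setT f ->
  (\int[sigma]_(x in usphere) f x = \int[sigma]_x f x)%E.
Proof.
move=> mf; rewrite integral_mkcond; apply: ae_eq_integral => //.
- by apply/(measurable_restrictT _ _).1 => //; [exact: measurable_usphere|exact: measurable_funTS].
- have := ae_usphere; apply: filterS => x Sx _.
  by rewrite /patch mem_set.
Qed.

End surface_measure_theory.

(** * Polynomials separate integrable functions *)

Section polynomial_functions.
Context {R : realType} {n : nat}.
Implicit Types (v w x : 'rV[R]_n) (f g : 'rV[R]_n -> R).

(** Polynomials as a predicate on functions: constants, multiplication by a linear form and sums
    generate them all, and every induction has three cases only. *)
Inductive polyfun : ('rV[R]_n -> R) -> Prop :=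
| polyfun_cst c : polyfun (cst c)
| polyfun_mul v f : polyfun f -> polyfun (fun x => dotv v x * f x)
| polyfun_add f g : polyfun f -> polyfun g -> polyfun (fun x => f x + g x).

Lemma differentiable_dotv v x : differentiable (dotv v : 'rV[R]_n -> R) x.
Proof.
rewrite (_ : dotv v = \sum_(i < n) (v 0 i *: (fun y : 'rV[R]_n => y 0 i))); last first.
  by apply/funext => y; rewrite fct_sumE.
apply: differentiable_sum => i; apply: differentiableZ.
exact: differentiable_coord.
Qed.

Lemma derive_dotv v w x : 'D_w (dotv v) x = dotv v w.
Proof.
rewrite /derive; apply: cvg_lim => //.
apply: (cvg_near_cst (dotv v w)); near=> h.
rewrite /= dotvDr addrK dotvZr /GRing.scale/= mulKf//.
by near: h; exact: nbhs_dnbhs_neq.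
Unshelve. all: by end_near. Qed.

Lemma polyfun_dotv v : polyfun (dotv v).
Proof.
rewrite (_ : dotv v = fun x => dotv v x * cst 1 x); last first.
  by apply/funext => x; rewrite /= mulr1.
exact/polyfun_mul/polyfun_cst.
Qed.

Lemma polyfun_coord i : polyfun (fun x => x 0 i).
Proof.
rewrite (_ : (fun x => _) = dotv (delta_mx 0 i)); first exact: polyfun_dotv.
by apply/funext => x; rewrite dotv_deltal.
Qed.

Lemma polyfunM f g : polyfun f -> polyfun g -> polyfun (fun x => f x * g x).
Proof.
elim=> [c|v {}f _ IH|f1 f2 _ IH1 _ IH2] pg /=.
- elim: pg => [d|v {}g _ IHg|g1 g2 _ IH1 _ IH2] /=.
  + exact: polyfun_cst.
  + rewrite (_ : (fun x => _) = fun x => dotv v x * (c * g x)); first exact: polyfun_mul.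
    by apply/funext => x; rewrite mulrCA.
  + rewrite (_ : (fun x => _) = fun x => c * g1 x + c * g2 x); first exact: polyfun_add.
    by apply/funext => x; rewrite mulrDr.
- rewrite (_ : (fun x => _) = fun x => dotv v x * (f x * g x)).
    by apply: polyfun_mul; exact: IH.
  by apply/funext => x; rewrite mulrA.
- rewrite (_ : (fun x => _) = fun x => f1 x * g x + f2 x * g x).
    by apply: polyfun_add; [exact: IH1|exact: IH2].
  by apply/funext => x; rewrite mulrDl.
Qed.

Lemma polyfunZ c f : polyfun f -> polyfun (fun x => c * f x).
Proof. exact/polyfunM/polyfun_cst. Qed.

Lemma polyfunB f g : polyfun f -> polyfun g -> polyfun (fun x => f x - g x).
Proof.
move=> pf pg; rewrite (_ : (fun x => _) = fun x => f x + (-1) * g x).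
  by apply: polyfun_add => //; exact: polyfunZ.
by apply/funext => x; rewrite mulN1r.
Qed.

Lemma polyfunX f k : polyfun f -> polyfun (fun x => f x ^+ k).
Proof.
move=> pf; elim: k => [|k IH]; first exact: polyfun_cst.
rewrite (_ : (fun x => _) = fun x => f x * f x ^+ k); first exact: polyfunM.
by apply/funext => x; rewrite exprS.
Qed.

Lemma polyfun_rot i j r f : i != j -> polyfun f -> polyfun (f \o plane_rot i j r).
Proof.
move=> ij; elim=> [c|v {}f _ IH|f1 f2 _ IH1 _ IH2].
- exact: polyfun_cst.
- rewrite (_ : _ \o _ = fun x => dotv (plane_rot i j (- r) v) x * (f \o plane_rot i j r) x).
    exact: polyfun_mul.
  by apply/funext => x; rewrite /= dotv_rotl// opprK.
- exact: polyfun_add IH1 IH2.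
Qed.

Lemma polyfun_derive f : polyfun f ->
  (forall x, differentiable f x) /\ (forall w, polyfun (fun x => 'D_w f x)).
Proof.
elim=> [c|v {}f pf [IH1 IH2]|f1 f2 pf1 [IH11 IH12] pf2 [IH21 IH22]].
- split; first by move=> x; exact: differentiable_cst.
  move=> w; rewrite (_ : (fun x => _) = cst 0); first exact: polyfun_cst.
  by apply/funext => x; rewrite derive_cst.
- have E : (fun x => dotv v x * f x) = dotv v * f by [].
  split => [x|w].
    by rewrite E; apply: differentiableM => //; exact: differentiable_dotv.
  rewrite (_ : (fun x => _) = fun x => dotv v x * 'D_w f x + dotv v w * f x).
    by apply: polyfun_add; [exact: polyfun_mul|exact: polyfunZ].
  apply/funext => x; rewrite E deriveM; last 2 first.
    exact/diff_derivable/differentiable_dotv.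
    exact/diff_derivable.
  by rewrite derive_dotv /GRing.scale/= [f x * _]mulrC.
- split => [x|w].
    exact: differentiableD (IH11 x) (IH21 x).
  rewrite (_ : (fun x => _) = fun x => 'D_w f1 x + 'D_w f2 x); first exact: polyfun_add.
  by apply/funext => x; apply: deriveD; exact/diff_derivable.
Qed.

Lemma polyfun_measurable f : polyfun f -> measurable_fun setT f.
Proof.
elim=> [c|v {}f _ IH|f1 f2 _ IH1 _ IH2]; first exact: measurable_cst.
  by apply: measurable_funM => //; exact: measurable_dotv.
exact: measurable_funD.
Qed.

Lemma polyfun_bounded f : polyfun f -> exists M, forall x, usphere x -> `|f x| <= M.
Proof.
elim=> [c|v {}f _ [M HM]|f1 f2 _ [M1 H1] _ [M2 H2]].
- by exists `|c|.
- exists (enorm v * M) => x Sx; rewrite normrM ler_pM//; last exact: HM.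
  by rewrite (le_trans (normr_dotv_le _ _))// (_ : enorm x = 1)// mulr1.
- by exists (M1 + M2) => x Sx; rewrite (le_trans (ler_normD _ _))// lerD// ?H1 ?H2.
Qed.

(** Directional derivatives of polynomial fields are polynomial fields, so the iterated derivatives
    in [smooth] never leave the class and one differentiability argument serves all orders. *)
Lemma smooth_row_polyfun (F : 'I_n -> 'rV[R]_n -> R) :
  (forall i, polyfun (F i)) -> smooth (fun x => \row_i F i x).
Proof.
move=> pF s x.
have rowE (G : 'I_n -> 'rV[R]_n -> R) :
    (fun x => \row_i G i x) = \sum_(i < n) (fun x => G i x *: (delta_mx 0 i : 'rV[R]_n)).
  apply/funext => y; rewrite fct_sumE; apply/rowP => k; rewrite mxE summxE (bigD1 k)//= big1.
    by rewrite !mxE !eqxx mulr1 addr0.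
  by move=> i ik; rewrite !mxE eq_sym (negbTE ik) andbF mulr0.
have diffG (G : 'I_n -> 'rV[R]_n -> R) y : (forall i, polyfun (G i)) ->
    differentiable (fun x => \row_i G i x) y.
  move=> pG; rewrite rowE; apply: differentiable_sum => i.
  by apply: differentiableZl; have [] := polyfun_derive (pG i).
suff [G pG ->] : exists2 G : 'I_n -> 'rV[R]_n -> R, (forall i, polyfun (G i)) &
    foldr (fun v W y => 'D_v W y) (fun x => \row_i F i x) s = fun x => \row_i G i x.
  exact: diffG.
elim: s => [|v s [G pG IH]] /=; first by exists F.
exists (fun i y => 'D_v (G i) y); first by move=> i; have [] := polyfun_derive (pG i).
rewrite IH; apply/funext => y; apply/rowP => k; rewrite mxE.
have -> : G k = (fun z : 'rV[R]_n => z 0 k) \o (fun x => \row_i G i x).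
  by apply/funext => z; rewrite /= mxE.
have dG := diffG _ y pG.
rewrite [in RHS]deriveE; last first.
  by apply: differentiable_comp => //; exact: differentiable_coord.
rewrite diff_comp//=; last exact: differentiable_coord.
rewrite -!deriveE//; last exact: differentiable_coord.
have E : (fun z : 'rV[R]_n => z 0 k) = dotv (delta_mx 0 k).
  by apply/funext => z; rewrite dotv_deltal.
by rewrite E derive_dotv dotv_deltal.
Qed.

End polynomial_functions.

(** * Polynomials that converge to a step function *)

Section step_polynomials.
Context {R : realType}.

(** The polynomials of the Brosowski-Deutsch proof of the Stone-Weierstrass theorem, with threshold
    1/2. The factor k in the exponent makes the limit 0 also at t = 1/2, where the exponent 2^k
    alone would give exp(-1). *)
Definition step_poly (k : nat) (t : R) : R := (1 - t ^+ k) ^+ (k * 2 ^ k).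

Lemma step_poly_itv k t : 0 <= t <= 1 -> 0 <= step_poly k t <= 1.
Proof.
move=> /andP[t0 t1]; have h : 0 <= 1 - t ^+ k <= 1.
  by rewrite subr_ge0 exprn_ile1//= lerBlDr lerDl exprn_ge0.
by case/andP: h => h0 h1; rewrite exprn_ge0//= exprn_ile1.
Qed.

Lemma bernoulli_ineq (a : R) m : -1 <= a -> 1 + m%:R * a <= (1 + a) ^+ m.
Proof.
move=> a1; elim: m => [|m IH]; first by rewrite mul0r addr0 expr0.
rewrite exprS (@le_trans _ _ ((1 + a) * (1 + m%:R * a)))//; last first.
  by rewrite ler_wpM2l// -lerBlDl sub0r.
rewrite -natr1 -subr_ge0 (_ : _ - _ = m%:R * a ^+ 2); last by ring.
by rewrite mulr_ge0 ?sqr_ge0.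
Qed.

Lemma cvg_mul_expr (q : R) : `|q| < 1 -> k%:R * q ^+ k @[k --> \oo] --> (0 : R).
Proof.
(* By the inequality of means |q| <= r^2, with r < 1. One factor r^k absorbs k, by Bernoulli's
   inequality for 1 + a = 1/r; the other tends to 0. *)
move=> q1; set r := (1 + `|q|) / 2.
have q0 : 0 <= `|q| by [].
have r0 : 0 < r by rewrite /r; lra.
have r1 : r < 1 by rewrite /r; lra.
have qr : `|q| <= r ^+ 2.
  rewrite -subr_ge0 (_ : _ - _ = ((1 - `|q|) / 2) ^+ 2) ?sqr_ge0//.
  by rewrite /r; field.
pose a := r^-1 - 1.
have a0 : 0 < a by rewrite subr_gt0 invf_gt1.
have H k : `|k%:R * q ^+ k| <= a^-1 * r ^+ k.
  rewrite normrM normr_nat normrX.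
  rewrite (@le_trans _ _ (k%:R * (r ^+ k * r ^+ k)))//.
    by rewrite ler_wpM2l// -exprD addnn -mul2n exprM; apply: lerXn2r; rewrite ?nnegrE ?sqr_ge0.
  rewrite mulrA ler_wpM2r ?exprn_ge0 ?(ltW r0)//.
  rewrite -[leRHS]div1r ler_pdivlMr//.
  have ra : (1 + a) ^+ k * r ^+ k = 1.
    by rewrite -exprMn /a addrC subrK mulVf ?expr1n// gt_eqF.
  rewrite -[leRHS]ra mulrAC ler_wpM2r ?exprn_ge0 ?(ltW r0)//.
  rewrite (le_trans _ (bernoulli_ineq _ _))//; first by rewrite lerDr.
  by rewrite (le_trans _ (ltW a0)).
have lim : a^-1 * r ^+ k @[k --> \oo] --> (0 : R).
  rewrite -(mulr0 a^-1); apply: cvgM; first exact: cvg_cst.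
  by apply: cvg_expr; rewrite ger0_norm// ltW.
apply: (squeeze_cvgr (f := fun k => - (a^-1 * r ^+ k)) (h := fun k => a^-1 * r ^+ k)) => //.
  by near=> k; rewrite -ler_norml.
by rewrite -oppr0; exact: cvgN.
Unshelve. all: by end_near. Qed.

Lemma cvg_step_poly (t : R) : 0 <= t <= 1 ->
  step_poly k t @[k --> \oo] --> (if t < 2^-1 then 1 else 0 : R).
Proof.
move=> /andP[t0 t1]; case: ltP => t2.
- have q1 : `|2 * t| < 1 by rewrite ger0_norm ?mulr_ge0//; lra.
  have lim1 : 1 - k%:R * (2 * t) ^+ k @[k --> \oo] --> (1 - 0 : R).
    apply: cvgB; first exact: cvg_cst.
    exact: cvg_mul_expr.
  rewrite subr0 in lim1.
  apply: (squeeze_cvgr (f := fun k => 1 - k%:R * (2 * t) ^+ k) (h := cst 1)) => //; last exact: cvg_cst.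
  near=> k; apply/andP; split; last first.
    by have /andP[] : 0 <= step_poly k t <= 1 by apply: step_poly_itv; rewrite t0.
  rewrite /step_poly (le_trans _ (@bernoulli_ineq (- t ^+ k) (k * 2 ^ k) _))//.
    by rewrite natrM natrX exprMn mulrN mulrA.
  by rewrite lerNl opprK exprn_ile1.
- apply: (squeeze_cvgr (f := cst 0) (h := fun k => k.+1%:R^-1)); last 2 first.
    exact: cvg_cst.
    exact: cvg_harmonic.
  near=> k; apply/andP; split.
    by have /andP[] : 0 <= step_poly k t <= 1 by apply: step_poly_itv; rewrite t0.
  rewrite /step_poly; set m := (k * 2 ^ k)%N.
  have a0 : 0 <= t ^+ k by exact: exprn_ge0.
  have a1 : t ^+ k <= 1 by exact: exprn_ile1.
  (* Bernoulli again: m t^k = k (2t)^k >= k because 2t >= 1. As (1 - s)^m (1 + s)^m <= 1,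
     [step_poly] is then at most 1/(k + 1). *)
  have H1 : k.+1%:R <= (1 + t ^+ k) ^+ m.
    apply: le_trans (@bernoulli_ineq _ _ _); last by rewrite (le_trans _ a0).
    rewrite -natr1 addrC lerD2l /m natrM -mulrA ler_peMr// natrX -exprMn.
    by rewrite exprn_ege1//; lra.
  rewrite -[leRHS]div1r ler_pdivlMr ?ltr0n//.
  rewrite (@le_trans _ _ ((1 - t ^+ k) ^+ m * (1 + t ^+ k) ^+ m))//.
    by rewrite ler_wpM2l// exprn_ge0// subr_ge0.
  rewrite -exprMn exprn_ile1//.
    by rewrite mulr_ge0 ?subr_ge0// addr_ge0.
  rewrite -subr_ge0 (_ : 1 - _ = (t ^+ k) ^+ 2); last by ring.
  exact: sqr_ge0.
Unshelve. all: by end_near. Qed.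

End step_polynomials.

Section Rintegral_complements.
Context d (T : measurableType d) (R : realType) (mu : {measure set T -> \bar R}).
Implicit Types f g : T -> R.

Lemma Rdominated_convergence (f_ : nat -> T -> R) f g :
  (forall n, measurable_fun setT (f_ n)) -> measurable_fun setT f ->
  {ae mu, forall x, f_ n x @[n --> \oo] --> f x} ->
  mu.-integrable setT (EFin \o g) ->
  {ae mu, forall x n, `|f_ n x| <= g x} ->
  mu.-integrable setT (EFin \o f) /\
  \int[mu]_x f_ n x @[n --> \oo] --> \int[mu]_x f x.
Proof.
move=> mf_ mf cf ig bf.
have [|||//||i1 _ i3] := @dominated_convergence _ _ _ mu setT measurableT (fun n => EFin \o f_ n)
  (EFin \o f) (EFin \o g).
- by move=> n; exact/measurable_EFinP.
- exact/measurable_EFinP.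
- by apply: filterS cf => x cx _; apply: cvg_EFin => //; exact: nearW.
- by apply: filterS bf => x bx n _; rewrite /= lee_fin.
split=> //; rewrite /Rintegral; apply: fine_cvg.
rewrite fineK//; exact: integrable_fin_num.
Qed.

Lemma le_integrable_ae f g : measurable_fun setT f -> mu.-integrable setT (EFin \o g) ->
  {ae mu, forall x, `|f x| <= g x} -> mu.-integrable setT (EFin \o f).
Proof.
(* Dominated convergence for a constant sequence; only its integrability conclusion is kept. *)
move=> mf ig fg; have [] // := @Rdominated_convergence (fun=> f) f g.
- by apply: aeW => x; exact: cvg_cst.
- by apply: filterS fg => x fgx n.
Qed.

Lemma ae_eq_Rintegral f g : measurable_fun setT f -> measurable_fun setT g ->
  {ae mu, forall x, f x = g x} -> \int[mu]_x f x = \int[mu]_x g x.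
Proof.
move=> mf mg fg; rewrite /Rintegral; congr fine; apply: ae_eq_integral => //.
- exact/measurable_EFinP.
- exact/measurable_EFinP.
- by apply: filterS fg => x -> _.
Qed.

Lemma ae_eq_integrable f g : measurable_fun setT g ->
  {ae mu, forall x, f x = g x} -> mu.-integrable setT (EFin \o f) ->
  mu.-integrable setT (EFin \o g).
Proof.
move=> mg fg intf; apply: (@le_integrable_ae _ (fun x => `|f x|)) => //.
- exact: (integrable_norm intf).
- by apply: filterS fg => x ->.
Qed.

Lemma integrable_Rmeasurable f : mu.-integrable setT (EFin \o f) -> measurable_fun setT f.
Proof. by move=> /measurable_int /measurable_EFinP. Qed.

Lemma RintegrableZ (a : R) f : mu.-integrable setT (EFin \o f) ->
  mu.-integrable setT (EFin \o (fun x => a * f x)).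
Proof.
move=> fi; rewrite (_ : _ \o _ = fun x => (a%:E * (EFin \o f) x)%E).
  exact: integrableZl.
by apply/funext => x /=; rewrite EFinM.
Qed.

Lemma RintegrableD f g : mu.-integrable setT (EFin \o f) ->
  mu.-integrable setT (EFin \o g) -> mu.-integrable setT (EFin \o (fun x => f x + g x)).
Proof.
move=> fi gi; rewrite (_ : _ \o _ = (EFin \o f) \+ (EFin \o g))%E; first exact: integrableD.
by apply/funext => x /=; rewrite EFinD.
Qed.

Lemma RintegrableB f g : mu.-integrable setT (EFin \o f) ->
  mu.-integrable setT (EFin \o g) -> mu.-integrable setT (EFin \o (fun x => f x - g x)).
Proof.
move=> fi gi; rewrite (_ : _ \o _ = (EFin \o f) \- (EFin \o g))%E; first exact: integrableB.
by apply/funext => x /=; rewrite EFinB.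
Qed.

Lemma Rintegrable_sum I (s : seq I) (F : I -> T -> R) :
  (forall i, mu.-integrable setT (EFin \o F i)) ->
  mu.-integrable setT (EFin \o (fun x => \sum_(i <- s) F i x)).
Proof.
move=> iF; elim: s => [|i s IH].
  rewrite (_ : _ \o _ = cst 0%E); first exact: integrable0.
  by apply/funext => x /=; rewrite big_nil.
rewrite (_ : _ \o _ = EFin \o (fun x => F i x + \sum_(j <- s) F j x)).
  exact: RintegrableD.
by apply/funext => x /=; rewrite big_cons.
Qed.

Lemma Rintegral_sum I (s : seq I) (F : I -> T -> R) :
  (forall i, mu.-integrable setT (EFin \o F i)) ->
  \int[mu]_x (\sum_(i <- s) F i x) = \sum_(i <- s) \int[mu]_x F i x.
Proof.
move=> iF; elim: s => [|i s IH].
  under eq_Rintegral do rewrite big_nil.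
  by rewrite big_nil Rintegral_cst// mul0r.
under eq_Rintegral do rewrite big_cons.
by rewrite big_cons RintegralD// ?IH//; exact: Rintegrable_sum.
Qed.

End Rintegral_complements.

Section moments.
Context {R : realType} {n : nat}.
Local Notation sigma := (@surface_measure R n).
Implicit Types (x : 'rV[R]_n) (f : 'rV[R]_n -> R) (L : seq ('I_n * R)).

Lemma integrableM_bounded (Z f : 'rV[R]_n -> R) (M : R) : sigma.-integrable setT (EFin \o Z) ->
  measurable_fun setT f -> (forall x, usphere x -> `|f x| <= M) ->
  sigma.-integrable setT (EFin \o (fun x => Z x * f x)).
Proof.
move=> iZ mf fM; apply: (@le_integrable_ae _ _ _ sigma _ (fun x => `|M| * `|Z x|)).
- by apply: measurable_funM => //; exact: integrable_Rmeasurable iZ.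
- exact/RintegrableZ/(integrable_norm iZ).
- apply: filterS ae_usphere => x Sx; rewrite normrM mulrC ler_wpM2r//.
  by rewrite (le_trans (fM _ Sx))// ler_norm.
Qed.

(** Constraints come as a list, not as one bound per coordinate: intersecting is concatenating, and
    constraints can be removed one at a time by induction. *)
Definition orthant L := [set x : 'rV[R]_n | forall ic, ic \in L -> x 0 ic.1 < ic.2].

Lemma measurable_coord_lt (i : 'I_n) (c : R) : measurable [set x : 'rV[R]_n | x 0 i < c].
Proof.
rewrite (_ : [set _ | _] = setT `&` (fun x : 'rV[R]_n => x 0 i) @^-1` `]-oo, c[).
  by apply: measurable_coord => //; exact: measurable_itv.
by rewrite setTI; apply/seteqP; split => x; rewrite /= in_itv.
Qed.

Lemma orthant_cons ic L : orthant (ic :: L) = [set x : 'rV[R]_n | x 0 ic.1 < ic.2] `&` orthant L.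
Proof.
apply/seteqP; split=> [x H|x [H1 H2] jc].
  by split => [|jc jL]; apply: H; rewrite inE ?eqxx// jL orbT.
by rewrite inE => /orP[/eqP ->//|]; exact: H2.
Qed.

Lemma measurable_orthant L : measurable (orthant L).
Proof.
elim: L => [|ic L IH].
  by rewrite (_ : orthant _ = setT)//; apply/seteqP; split.
by rewrite orthant_cons; apply: measurableI => //; exact: measurable_coord_lt.
Qed.

Lemma Rintegral_orthant_polyfun (Z : 'rV[R]_n -> R) : sigma.-integrable setT (EFin \o Z) ->
  (forall f, polyfun f -> \int[sigma]_x (Z x * f x) = 0) ->
  forall L f, polyfun f -> \int[sigma]_x (Z x * \1_(orthant L) x * f x) = 0.
Proof.
move=> iZ HZ; elim=> [|[i c] L IH] f pf.
  rewrite -[RHS](HZ _ pf); apply: eq_Rintegral => x _.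
  by rewrite indicE mem_set ?mulr1.
(* The affine change t = b (x_i + K) sends c to 1/2, and K is large enough for t to stay in [0, 1]
   when |x_i| <= 1, whatever the sign of c. *)
pose K := 1 + 2 * `|c|.
pose b := (2 * (c + K))^-1.
have cK : 0 < c + K.
  by rewrite /K; have := ler_norm (- c); rewrite normrN => ?; have := normr_ge0 c; lra.
pose q k x := step_poly k (b * (x 0 i + K)).
have pq k : polyfun (q k).
  apply: polyfunX; apply: polyfunB; first exact: polyfun_cst.
  apply: polyfunX; apply: polyfunZ; apply: polyfun_add; last exact: polyfun_cst.
  exact: polyfun_coord.
have tx x : usphere x -> 0 <= b * (x 0 i + K) <= 1.
  move=> Sx; have := normr_coord x i; rewrite (_ : enorm x = 1)// ler_norml => /andP[h1 h2].
  apply/andP; split.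
    rewrite mulr_ge0 ?invr_ge0 ?mulr_ge0 ?(ltW cK)//.
    by rewrite /K; have := normr_ge0 c; lra.
  rewrite /b mulrC ler_pdivrMr ?mulr_gt0// mul1r /K.
  have := ler_norm (- c); rewrite normrN; have := normr_ge0 c; lra.
have txlt x : (b * (x 0 i + K) < 2^-1) = (x 0 i < c).
  by rewrite /b invfM -mulrA gtr_pMr ?invr_gt0// mulrC ltr_pdivrMr// mul1r ltrD2r.
have [M HM] := polyfun_bounded pf.
have mL := measurable_indic (measurable_orthant L).
have mZ := integrable_Rmeasurable iZ.
have [|||||_ cv] := @Rdominated_convergence _ _ _ sigma
  (fun k x => Z x * \1_(orthant L) x * (q k x * f x))
  (fun x => Z x * \1_(orthant ((i, c) :: L)) x * f x) (fun x => `|M| * `|Z x|).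
- move=> k; apply: measurable_funM; first exact: measurable_funM.
  by apply: measurable_funM; exact: polyfun_measurable.
- apply: measurable_funM; last exact: polyfun_measurable.
  by apply: measurable_funM => //; exact: (measurable_indic (measurable_orthant _)).
- apply: filterS ae_usphere => x Sx.
  rewrite orthant_cons indicI /= -[_ * \1_(orthant L) x as X in _ * X * _]mulrC mulrA -mulrA.
  apply: cvgM; first exact: cvg_cst.
  apply: cvgM; last exact: cvg_cst.
  have := cvg_step_poly (tx _ Sx); rewrite txlt.
  by rewrite indicE /mkset /in_mem /= /in_set asboolb; case: ifP.
- exact/RintegrableZ/(integrable_norm iZ).
- apply: filterS ae_usphere => x Sx k.
  have [q0 q1] := andP (step_poly_itv k (tx _ Sx)).
  rewrite [leRHS]mulrC normrM ler_pM//.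
    by rewrite normrM indicE; case: (x \in _); rewrite ?normr1 ?normr0 ?mulr1// mulr0.
  rewrite normrM (@le_trans _ _ (1 * `|f x|))//.
    by rewrite ler_wpM2r// ger0_norm.
  by rewrite mul1r (le_trans (HM _ Sx))// ler_norm.
- suff cv0 : \int[sigma]_x (Z x * \1_(orthant L) x * (q k x * f x)) @[k --> \oo] --> (0 : R).
    exact: (cvg_unique _ cv cv0).
  apply: cvg_near_cst; apply: nearW => k; apply: IH.
  exact: polyfunM.
Qed.

(* Polynomials step_poly approximate the indicators of the orthants, a pi-system
   generating the Borel sets. *)
Lemma polyfun_ae_eq0 (Z : 'rV[R]_n -> R) : sigma.-integrable setT (EFin \o Z) ->
  (forall f, polyfun f -> \int[sigma]_x (Z x * f x) = 0) ->
  {ae sigma, forall x, Z x = 0}.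
Proof.
move=> iZ HZ; pose G := [set A | exists L, A = orthant L].
have mZ := integrable_Rmeasurable iZ.
have GI : setI_closed G.
  move=> _ _ [L1 ->] [L2 ->]; exists (L1 ++ L2); apply/seteqP; split.
    by move=> x [H1 H2] ic; rewrite mem_cat => /orP[/H1|/H2].
  by move=> x H; split => ic icL; apply: H; rewrite mem_cat icL ?orbT.
pose H := [set A | measurable A /\ \int[sigma]_(x in A) Z x = 0].
have iZA A : measurable A -> sigma.-integrable A (EFin \o Z).
  by move=> mA; apply: integrableS iZ.
have lH : lambda_system setT H.
  split => //.
  - by split=> //; rewrite -[RHS](HZ _ (polyfun_cst 1)); apply: eq_Rintegral => x _; rewrite /= mulr1.
  - move=> A B BA [mA A0] [mB B0]; split; first exact: measurableD.
    move: A0; rewrite -{1}(setDUK BA) Rintegral_setU ?B0 ?add0r//.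
    + exact: measurableD.
    + by rewrite setDUK//; exact: iZA.
    + by apply/disj_setPS => x [Bx [_ nBx]].
  - move=> F ndF HF; have mF k : measurable (F k) by have [] := HF k.
    split; first exact: bigcup_measurable.
    rewrite Rintegral_mkcond.
    have [|||||_ cv] := @Rdominated_convergence _ _ _ sigma
      (fun k => Z \_ (F k)) (Z \_ (\bigcup_k F k)) (fun x => `|Z x|).
    + by move=> k; apply/(measurable_restrictT _ _).1 => //; exact: measurable_funTS.
    + apply/(measurable_restrictT _ _).1; first exact: bigcup_measurable.
      exact: measurable_funTS.
    + apply: aeW => x; apply: cvg_near_cst.
      have [[k0 _ Fk0]|nF] := pselect ((\bigcup_k F k) x).
        exists k0 => // k /= k0k; rewrite /patch !mem_set//; first by exists k0.
        by have /subsetPset := ndF _ _ k0k; exact.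
      apply: nearW => k; rewrite /patch !memNset// => Fkx.
      by apply: nF; exists k.
    + exact: integrable_norm.
    + by apply: aeW => x k; rewrite /patch; case: ifP; rewrite ?normr0.
    + suff cv0 : \int[sigma]_x (Z \_ (F k)) x @[k --> \oo] --> (0 : R).
        exact: (cvg_unique _ cv cv0).
      apply: cvg_near_cst; apply: nearW => k; rewrite -Rintegral_mkcond.
      by have [] := HF k.
have GH : G `<=` H.
  move=> _ [L ->]; split; first exact: measurable_orthant.
  rewrite Rintegral_mkcond -[RHS](Rintegral_orthant_polyfun iZ HZ L (polyfun_cst 1)).
  apply: eq_Rintegral => x _; rewrite /= mulr1 /patch indicE.
  by case: ifP; rewrite ?mulr1 ?mulr0.
have mH A : measurable A -> H A.
  move=> mA; apply: (lambda_system_subset GI lH GH) => //.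
  suff sub : @measurable _ 'rV[R]_n `<=` <<s G >> by exact: sub.
  have mcoord i : measurable_fun setT ((fun x : 'rV[R]_n => x 0 i) : g_sigma_algebraType G -> R).
    apply: (measurability _ (RGenInftyO.measurableE R)) => _ [_ [c ->] <-].
    apply: sub_sigma_algebra; exists [:: (i, c)]; apply/seteqP; split => x /=.
      by move=> [_]; rewrite in_itv/= => xc ic; rewrite inE => /eqP ->.
    by move=> H1; split => //; rewrite in_itv/=; have /= := H1 (i, c); rewrite inE; apply.
  apply: smallest_sub; first exact: smallest_sigma_algebra.
  rewrite -bigcup_seq; apply: bigcup_sub => i _ B [C mC <-].
  exact: mcoord.
have : ae_eq sigma setT (EFin \o Z) (cst 0%E).
  apply: integral_ae_eq => //.
  move=> E _ mE; rewrite integral0 -[LHS]fineK.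
    by have [_] := mH _ mE; rewrite /Rintegral => ->.
  exact: integrable_fin_num (iZA _ mE).
by apply: filterS => x /(_ I)/= [].
Qed.

End moments.

(** * Absolute continuity along rotation orbits *)

(** No integrability is assumed: Tonelli applies to the positive and negative parts, and the
    integral is by definition their difference, whatever its value. *)
Lemma measurable_Rintegral d1 d2 (T1 : measurableType d1) (T2 : measurableType d2) (R : realType)
  (m : {sigma_finite_measure set T2 -> \bar R}) (G : T1 * T2 -> R) :
  measurable_fun setT G -> measurable_fun setT (fun x => \int[m]_y G (x, y)).
Proof.
move=> mG; apply: (@measurableT_comp _ _ _ _ _ _ (@fine R)) => //.
have : measurable_fun setT (EFin \o G) by exact/measurable_EFinP.
rewrite -/(fubini_F m (EFin \o G)); move: (EFin \o G) => F mF.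
rewrite (_ : fubini_F m F = fun x => (\int[m]_y (F^\+ (x, y)) - \int[m]_y (F^\- (x, y)))%E).
  apply: emeasurable_funB; apply: measurable_fun_fubini_tonelli_F => //.
  - exact: measurable_funepos.
  - exact: measurable_funeneg.
apply/funext => x; rewrite /fubini_F [LHS]integralE.
under eq_integral do rewrite funepos_comp/=.
by under [X in (_ - X = _)%E]eq_integral do rewrite funeneg_comp/=.
Qed.

Section unit_time.
Context {R : realType}.
Local Notation leb := (@lebesgue_measure R).
Implicit Types (f g : R -> R).

Fact unit_itv_lty : (leb `[0%R, 1%R] < +oo)%E.
Proof. by rewrite lebesgue_measure_itv/= lte_fin ltr01 -EFinB ltry. Qed.

(** Lebesgue measure on [0, 1], seen as a finite measure on the whole line, so that product measures
    and Fubini with the surface measure carry no domain. *)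
Definition unit_time : set (measurableTypeR R) -> \bar R :=
  @mfrestr _ (measurableTypeR R) R `[0, 1]%classic leb (measurable_itv _) unit_itv_lty.

HB.instance Definition _ := Measure.on unit_time.

Let unit_time_fin : fin_num_fun unit_time.
Proof. exact: fin_num_measure. Qed.

HB.instance Definition _ := Measure_isFinite.Build _ _ _ unit_time unit_time_fin.

Lemma unit_time_setC : unit_time (~` `[0, 1]%classic) = 0%E.
Proof. by rewrite /unit_time /= /mfrestr /mrestr setICl measure0. Qed.

Lemma ae_unit_time : {ae unit_time, forall t : measurableTypeR R, (t : R) \in `[0, 1]}.
Proof.
exists (~` `[0, 1]%classic); split => //; last exact: unit_time_setC.
by apply: measurableC; exact: measurable_itv.
Qed.

Lemma integral_unit_time (f : R -> \bar R) : measurable_fun setT f ->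
  (\int[unit_time]_t f t = \int[leb]_(t in `[0%R, 1%R]) f t)%E.
Proof.
move=> mf; transitivity (\int[unit_time]_(t in `[0%R, 1%R]) f t)%E.
  rewrite [RHS]integral_mkcond; apply: ae_eq_integral => //.
    by apply/(measurable_restrictT _ _).1 => //; exact: measurable_funTS.
  by apply: filterS ae_unit_time => t t01 _; rewrite /patch mem_set.
apply: eq_measure_integral => A mA A01.
by rewrite -[LHS]/(leb (A `&` `[0%R, 1%R]%classic)) setIidl.
Qed.

Lemma integrable_unit_time (f : R -> \bar R) : measurable_fun setT f ->
  unit_time.-integrable setT f <-> leb.-integrable `[0%R, 1%R] f.
Proof.
move=> mf; have E : (\int[unit_time]_t `|f t| = \int[leb]_(t in `[0%R, 1%R]) `|f t|)%E.
  by apply: (@integral_unit_time (fun t => `|f t|%E)); exact: measurableT_comp.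
split=> /integrableP[_ fi]; apply/integrableP; split => //.
- exact: measurable_funTS.
- by rewrite -E.
- by rewrite E.
Qed.

Lemma Rintegral_unit_time f : measurable_fun setT f ->
  \int[unit_time]_t f t = \int[leb]_(t in `[0%R, 1%R]) f t.
Proof. by move=> mf; rewrite /Rintegral integral_unit_time//; exact/measurable_EFinP. Qed.

(** The moving endpoint is a factor of the integrand and not part of the domain, which makes joint
    measurability and Fubini immediate. On [0, 1] this is the primitive of g that vanishes at 0. *)
Definition prim g s : R := \int[unit_time]_r (g r * (r <= s)%R%:R).

Lemma measurable_le_nat d (T : measurableType d) (f g : T -> R) :
  measurable_fun setT f -> measurable_fun setT g ->
  measurable_fun setT (fun t => (f t <= g t)%R%:R : R).
Proof.
move=> mf mg; rewrite (_ : (fun t => _) = fun t => if f t <= g t then 1 else 0 : R).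
  by apply: measurable_fun_ifT => //; exact: measurable_fun_ler.
by apply/funext => t; case: (_ <= _).
Qed.

Lemma integrable_prim g s : unit_time.-integrable setT (EFin \o g) ->
  unit_time.-integrable setT (EFin \o (fun r => g r * (r <= s)%R%:R)).
Proof.
move=> ig; apply: (@le_integrable_ae _ _ _ unit_time _ (fun r => `|g r|)).
- apply: measurable_funM; first exact: integrable_Rmeasurable ig.
  by apply: measurable_le_nat.
- exact: integrable_norm.
- apply: aeW => r; rewrite normrM; case: (r <= s); rewrite ?normr1 ?normr0 ?mulr1//.
  by rewrite mulr0.
Qed.

Lemma primE g s : 0 <= s <= 1 -> measurable_fun setT g ->
  prim g s = \int[leb]_(r in `[0%R, s]) g r.
Proof.
move=> /andP[s0 s1] mg; rewrite /prim Rintegral_unit_time; last first.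
  by apply: measurable_funM => //; exact: measurable_le_nat.
rewrite Rintegral_mkcond [RHS]Rintegral_mkcond; apply: eq_Rintegral => r _.
have E (t : R) : (r \in `[0, t]%classic) = (0 <= r <= t).
  by apply/idP/idP => [/set_mem|h]; [|apply/mem_set]; rewrite /= in_itv.
rewrite /patch !E; have [r0|] := leP 0 r; last by [].
have [rs|rs] := leP r s; first by rewrite (le_trans rs)//= mulr1.
by rewrite mulr0; case: ifP.
Qed.

Lemma measurable_prim g : measurable_fun setT g -> measurable_fun setT (prim g).
Proof.
move=> mg; apply: (@measurable_Rintegral _ _ R (measurableTypeR R) R unit_time
  (fun z : R * measurableTypeR R => g z.2 * (z.2 <= z.1)%R%:R)).
apply: measurable_funM; first exact: (measurableT_comp mg).
exact: measurable_le_nat.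
Qed.

Lemma le_norm_prim g s : unit_time.-integrable setT (EFin \o g) ->
  `|prim g s| <= \int[unit_time]_r `|g r|.
Proof.
move=> ig; apply: le_trans (le_normr_Rintegral _ _) _ => //; first exact: integrable_prim.
apply: le_Rintegral => //.
- by apply: integrable_norm; exact: integrable_prim.
- exact: integrable_norm.
- move=> r _; rewrite normrM; case: (r <= s); rewrite ?normr1 ?normr0 ?mulr1//.
  by rewrite mulr0.
Qed.

Lemma primB g h s : unit_time.-integrable setT (EFin \o g) ->
  unit_time.-integrable setT (EFin \o h) ->
  prim g s - prim h s = prim (fun r => g r - h r) s.
Proof.
move=> ig ih; rewrite /prim -RintegralB//; try exact: integrable_prim.
by apply: eq_Rintegral => r _; rewrite mulrBl.
Qed.

Lemma continuous_bounded_cc f a b : a <= b -> continuous f ->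
  exists2 C, 0 <= C & forall t, t \in `[a, b] -> `|f t| <= C.
Proof.
move=> ab cf; have [||c _ Hc] := @EVT_max R (fun t => `|f t|) a b; first by [].
  by apply: continuous_subspaceT => t; apply: continuous_comp; [exact: cf|exact: norm_continuous].
by exists `|f c|.
Qed.

Lemma continuous_integrable01 f : continuous f -> unit_time.-integrable setT (EFin \o f).
Proof.
move=> cf; apply/integrable_unit_time.
  by apply/measurable_EFinP; exact: continuous_measurable_fun.
apply: continuous_compact_integrable; first exact: segment_compact.
exact: continuous_subspaceT.
Qed.

(* The case of a C^1 curve; the general case follows by L^1 approximation of g. *)
Lemma prim_chain_continuous g (f0 : R) (beta beta' K K' : R -> R) : continuous g ->
  (forall t, is_derive t (1 : R) beta (beta' t)) -> continuous beta' ->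
  (forall t, is_derive t (1 : R) K (K' t)) -> continuous K' ->
  let f s := f0 + prim g s in
  \int[unit_time]_r (beta' (f r) * g r * K r + beta (f r) * K' r) =
  beta (f 1) * K 1 - beta (f 0) * K 0.
Proof.
move=> cg dbeta cbeta' dK cK' f.
have mg : measurable_fun setT g by exact: continuous_measurable_fun.
(* Starting at -1 and going up to 2 puts [0, 1] in the interior, so the derivatives at 0 and 1 are
   two-sided. *)
pose F x := \int[leb]_(t in `[-1, x]) g t.
have iF : leb.-integrable `[-1%R, 2%R] (EFin \o g).
  apply: continuous_compact_integrable; first exact: segment_compact.
  exact: continuous_subspaceT.
pose f1 s := f0 + (F s - F 0).
have fE (s : R) : s \in `[0, 1] -> f s = f1 s.
  rewrite in_itv => /= /andP[s0 s1]; rewrite /f /f1 primE ?s0//; congr (_ + _).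
  have h1 : (BLeft (-1) <= BRight (0 : R))%O by rewrite bnd_simp; lra.
  have h2 : (BRight 0 <= BRight s)%O by rewrite bnd_simp.
  have iFs : leb.-integrable `[-1%R, s] (EFin \o g).
    by apply: integrableS iF => //; apply: subset_itvl; rewrite bnd_simp; lra.
  rewrite /F (Rintegral_itvB iFs h1 h2) Rintegral_itv_obnd_cbnd//.
  by apply: integrableS iFs => //; apply: subset_itv; rewrite bnd_simp//; lra.
have dF (s : R) : -1 < s -> s < 2 -> is_derive s (1 : R) F (g s).
  move=> s1 s2; have [] := @continuous_FTC1 R g (BLeft (-1)) s 2 s2 iF s1 (cg s).
  by move=> dF Fg; split => //; rewrite -derive1E.
have df1 (s : R) : -1 < s -> s < 2 -> is_derive s (1 : R) f1 (g s).
  move=> s1 s2; have := dF _ s1 s2 => dFs.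
  have -> : f1 = cst (f0 - F 0) + F by apply/funext => x; rewrite -[RHS]/(f0 - F 0 + F x) /f1 addrAC addrA.
  by rewrite -[g s]add0r; apply: is_deriveD.
pose h r := beta' (f1 r) * g r * K r + beta (f1 r) * K' r.
pose H r := beta (f1 r) * K r.
have dH (s : R) : -1 < s -> s < 2 -> is_derive s (1 : R) H (h s).
  move=> s1 s2; have dfs := df1 _ s1 s2.
  have dbs := dbeta (f1 s). have dKs := dK s.
  have dbf : is_derive s (1 : R) (beta \o f1) (beta' (f1 s) * g s).
    exact: is_derive1_comp.
  have -> : H = (beta \o f1) * K by [].
  have -> : h s = (beta \o f1) s *: K' s + K s *: (beta' (f1 s) * g s).
    by rewrite /h /GRing.scale/= [K s * _]mulrC addrC.
  exact: is_deriveM.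
have cf1 (s : R) : s \in `[0, 1] -> {for s, continuous f1}.
  rewrite in_itv => /= /andP[s0 s1]; apply/differentiable_continuous/derivable1_diffP.
  by apply: ex_derive; apply: df1; lra.
have cK : continuous K by move=> t; apply/differentiable_continuous/derivable1_diffP; exact: ex_derive.
have cbeta : continuous beta.
  by move=> t; apply/differentiable_continuous/derivable1_diffP; exact: ex_derive.
have ch : {within `[0, 1], continuous h}.
  apply: continuous_in_subspaceT => s /set_mem s01.
  rewrite /continuous_at; apply: cvgD; (apply: cvgM; [|by [exact: cK|exact: cK']]).
    apply: cvgM; last exact: cg.
    exact: (continuous_comp (cf1 _ s01) (cbeta' (f1 s))).
  exact: (continuous_comp (cf1 _ s01) (cbeta (f1 s))).
have cH (s : R) : s \in `[0, 1] -> {for s, continuous H}.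
  move=> s01; rewrite /continuous_at; apply: cvgM; last exact: cK.
  exact: (continuous_comp (cf1 _ s01) (cbeta (f1 s))).
have dHoo : derivable_oo_LRcontinuous H 0 1.
  split.
  - move=> x; rewrite in_itv => /= /andP[x0 x1].
    by apply: (@ex_derive _ _ _ _ _ _ (h x)); apply: dH; lra.
  - by apply: cvg_at_right_filter; apply: cH; rewrite in_itv/= lexx ler01.
  - by apply: cvg_at_left_filter; apply: cH; rewrite in_itv/= lexx ler01.
have H'h : {in `]0, 1[, H^`()%classic =1 h}.
  move=> x; rewrite in_itv => /= /andP[x0 x1]; rewrite derive1E.
  by apply: derive_val; apply: dH; lra.
have fE0 : f 0 = f1 0 by apply: fE; rewrite in_itv/= lexx ler01.
have fE1 : f 1 = f1 1 by apply: fE; rewrite in_itv/= lexx ler01.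
have FTC := continuous_FTC2 ltr01 ch dHoo H'h.
rewrite fE0 fE1 -[RHS]/(fine ((H 1)%:E - (H 0)%:E)%E) -FTC.
rewrite Rintegral_unit_time.
  by apply: eq_Rintegral => x /set_mem x01; rewrite /h fE.
have mf : measurable_fun setT f.
  by apply: measurable_funD => //; exact: measurable_prim.
apply: measurable_funD.
  apply: measurable_funM; last exact: continuous_measurable_fun.
  apply: measurable_funM => //.
  by apply: measurableT_comp => //; exact: continuous_measurable_fun.
apply: measurable_funM; last exact: continuous_measurable_fun.
by apply: measurableT_comp => //; exact: continuous_measurable_fun.
Qed.

Lemma prim_chain g (f0 : R) (beta beta' K K' : R -> R) :
  unit_time.-integrable setT (EFin \o g) ->
  (forall t, is_derive t (1 : R) beta (beta' t)) -> continuous beta' ->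
  (forall t, is_derive t (1 : R) K (K' t)) -> continuous K' ->
  let f s := f0 + prim g s in
  \int[unit_time]_r (beta' (f r) * g r * K r + beta (f r) * K' r) =
  beta (f 1) * K 1 - beta (f 0) * K 0.
Proof.
move=> ig dbeta cbeta' dK cK' f.
have mg := integrable_Rmeasurable ig.
have cK : continuous K by move=> t; apply/differentiable_continuous/derivable1_diffP; exact: ex_derive.
have cbeta : continuous beta.
  by move=> t; apply/differentiable_continuous/derivable1_diffP; exact: ex_derive.
(* The sequence is shifted so that the L^1 distance to g is at most 1 from the start: all the curves
   then stay in one interval [-M, M], on which beta and beta' are bounded. *)
have [g_ [cg_ e_1 e_0]] : exists g_ : nat -> R -> R,
    [/\ forall k, continuous (g_ k), forall k, \int[unit_time]_r `|g r - g_ k r| <= 1 &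
     \int[unit_time]_r `|g r - g_ k r| @[k --> \oo] --> (0 : R)].
  have [|||g_ [cg_ ig_ lim]] := @approximation_continuous_integrable R `[0, 1]%classic g.
  - exact: measurable_itv.
  - exact: unit_itv_lty.
  - by apply/integrable_unit_time => //; exact/measurable_EFinP.
  have mgg k : measurable_fun setT (fun r => `|g r - g_ k r|).
    apply: measurableT_comp => //; apply: measurable_funB => //.
    exact: continuous_measurable_fun.
  have lim' : \int[unit_time]_r `|g r - g_ k r| @[k --> \oo] --> (0 : R).
    under eq_fun do rewrite Rintegral_unit_time//.
    by apply: fine_cvg.
  have [N _ HN] : \forall k \near \oo, \int[unit_time]_r `|g r - g_ k r| <= 1.
    by apply: (cvgr_le (0 : R)) => //; exact: ltr01.
  exists (fun k => g_ (k + N)%N); split => [k|k|]; first exact: cg_.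
    by apply: HN; rewrite /= leq_addl.
  by have := lim'; rewrite -(cvg_shiftn N); apply.
have ig_ k := continuous_integrable01 (cg_ k).
pose f_ k s := f0 + prim (g_ k) s.
have fB k s : `|f_ k s - f s| <= \int[unit_time]_r `|g r - g_ k r|.
  rewrite /f_ /f opprD addrACA subrr add0r distrC primB//.
  by apply: le_norm_prim; exact: RintegrableB.
pose M := `|f0| + \int[unit_time]_r `|g r| + 1.
have fM s : `|f s| <= M.
  rewrite /f /M -[leRHS]addrA (le_trans (ler_normD _ _))// lerD2l.
  by rewrite (le_trans (le_norm_prim _ ig))// lerDl.
have f_M k s : `|f_ k s| <= M.
  rewrite -(subrK (f s) (f_ k s)) (le_trans (ler_normD _ _))//.
  rewrite addrC /M lerD// ?(le_trans (fB _ _) (e_1 k))//.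
  rewrite /f (le_trans (ler_normD _ _))// lerD2l; exact: le_norm_prim.
have M0 : 0 <= M by rewrite (le_trans _ (fM 0)).
have cf s : f_ k s @[k --> \oo] --> f s.
  apply/cvgrPdist_le => e e0; near=> k; rewrite distrC (le_trans (fB k s))//.
  by near: k; apply: (cvgr_le (0 : R)).
have [C1 C10 HC1] : exists2 C, 0 <= C & forall t, `|t| <= M -> `|beta' t| <= C.
  have [|C C0 HC] := @continuous_bounded_cc beta' (- M) M _ cbeta'; first lra.
  by exists C => // t tM; apply: HC; rewrite in_itv/= -ler_norml.
have [C2 C20 HC2] : exists2 C, 0 <= C & forall t, `|t| <= M -> `|beta t| <= C.
  have [|C C0 HC] := @continuous_bounded_cc beta (- M) M _ cbeta; first lra.
  by exists C => // t tM; apply: HC; rewrite in_itv/= -ler_norml.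
have [C3 C30 HC3] := continuous_bounded_cc ler01 cK.
have [C4 C40 HC4] := continuous_bounded_cc ler01 cK'.
have mcont (h : R -> R) : continuous h -> measurable_fun setT h.
  exact: continuous_measurable_fun.
have mf : measurable_fun setT f.
  by apply: measurable_funD => //; exact: measurable_prim.
have mf_ k : measurable_fun setT (f_ k).
  by apply: measurable_funD => //; apply: measurable_prim; exact: mcont.
have mterm (h l : R -> R) : measurable_fun setT h -> measurable_fun setT l ->
    measurable_fun setT (fun r => beta' (h r) * l r * K r).
  move=> mh ml; apply: measurable_funM; last exact: mcont.
  by apply: measurable_funM => //; apply: (measurableT_comp (mcont _ cbeta')).
have mterm2 (h : R -> R) : measurable_fun setT h ->
    measurable_fun setT (fun r => beta (h r) * K' r).
  move=> mh; apply: measurable_funM; last exact: mcont.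
  by apply: (measurableT_comp (mcont _ cbeta)).
have bterm (h l : R -> R) : (forall r, `|h r| <= M) ->
    {ae unit_time, forall r : measurableTypeR R, `|beta' (h r) * l r * K r| <= C1 * C3 * `|l r|}.
  move=> hM; apply: filterS ae_unit_time => r r01.
  by rewrite !normrM mulrAC ler_wpM2r// ler_pM// ?HC1// HC3.
have bterm2 (h : R -> R) : (forall r, `|h r| <= M) ->
    {ae unit_time, forall r : measurableTypeR R, `|beta (h r) * K' r| <= C2 * C4}.
  move=> hM; apply: filterS ae_unit_time => r r01.
  by rewrite !normrM ler_pM// ?HC2// HC4.
have iterm (h l : R -> R) : measurable_fun setT h -> (forall r, `|h r| <= M) ->
    unit_time.-integrable setT (EFin \o l) ->
    unit_time.-integrable setT (EFin \o (fun r => beta' (h r) * l r * K r)).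
  move=> mh hM il; apply: (le_integrable_ae _ _ (bterm h l hM)).
    by apply: mterm => //; exact: integrable_Rmeasurable il.
  exact/RintegrableZ/(integrable_norm il).
have icst (c : R) : unit_time.-integrable setT (EFin \o (fun=> c)).
  exact: finite_measure_integrable_cst.
have iterm2 (h : R -> R) : measurable_fun setT h -> (forall r, `|h r| <= M) ->
    unit_time.-integrable setT (EFin \o (fun r => beta (h r) * K' r)).
  by move=> mh hM; apply: (le_integrable_ae _ _ (bterm2 h hM)); [exact: mterm2|exact: icst].
(* [J] uses the curve [f_ k] but keeps g, so dominated convergence applies with a multiple of |g|
   plus a constant. It differs from the boundary term [I] of the continuous case by at most C1 C3
   times the L^1 distance of g and [g_ k]. *)
pose J k := \int[unit_time]_r (beta' (f_ k r) * g r * K r + beta (f_ k r) * K' r).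
have limJ : J k @[k --> \oo] -->
    \int[unit_time]_r (beta' (f r) * g r * K r + beta (f r) * K' r).
  have [|||||_ cv] := @Rdominated_convergence _ _ _ unit_time
    (fun k r => beta' (f_ k r) * g r * K r + beta (f_ k r) * K' r)
    (fun r => beta' (f r) * g r * K r + beta (f r) * K' r)
    (fun r => C1 * C3 * `|g r| + C2 * C4).
  - by move=> k; apply: measurable_funD; [exact: mterm|exact: mterm2].
  - by apply: measurable_funD; [exact: mterm|exact: mterm2].
  - apply: aeW => r; apply: cvgD.
      apply: cvgM; last exact: cvg_cst.
      apply: cvgM; last exact: cvg_cst.
      by apply: continuous_cvg; [exact: cbeta'|exact: cf].
    apply: cvgM; last exact: cvg_cst.
    by apply: continuous_cvg; [exact: cbeta|exact: cf].
  - by apply: RintegrableD => //; exact/RintegrableZ/(integrable_norm ig).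
  - apply: filterS ae_unit_time => r r01 k.
    rewrite (le_trans (ler_normD _ _))// lerD//.
      by rewrite !normrM mulrAC ler_wpM2r// ler_pM// ?HC1// HC3.
    by rewrite !normrM ler_pM// ?HC2// HC4.
  - exact: cv.
pose I k := beta (f_ k 1) * K 1 - beta (f_ k 0) * K 0.
have limI : I k @[k --> \oo] --> beta (f 1) * K 1 - beta (f 0) * K 0.
  apply: cvgB; apply: cvgM; try exact: cvg_cst.
    by apply: continuous_cvg; [exact: cbeta|exact: cf].
  by apply: continuous_cvg; [exact: cbeta|exact: cf].
have IJ k : I k - J k = \int[unit_time]_r (beta' (f_ k r) * (g_ k r - g r) * K r).
  rewrite /I -(prim_chain_continuous f0 (cg_ k) dbeta cbeta' dK cK') /J -RintegralB//.
  - by apply: eq_Rintegral => r _; rewrite -/(f_ k r) opprD addrACA subrr addr0 mulrBr mulrBl.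
  - by apply: RintegrableD; [exact: (iterm (f_ k) (g_ k))|exact: (iterm2 (f_ k))].
  - by apply: RintegrableD; [exact: (iterm (f_ k))|exact: (iterm2 (f_ k))].
have limIJ : I k - J k @[k --> \oo] --> (0 : R).
  apply: (squeeze_cvgr (f := fun k => - (C1 * C3 * \int[unit_time]_r `|g r - g_ k r|))
    (h := fun k => C1 * C3 * \int[unit_time]_r `|g r - g_ k r|)).
  - near=> k; rewrite -ler_norml IJ.
    have ig_g : unit_time.-integrable setT (EFin \o (fun r => g_ k r - g r)).
      exact: RintegrableB.
    rewrite (le_trans (le_normr_Rintegral _ _))//; first exact: iterm.
    rewrite -RintegralZl//; last by apply: integrable_norm; exact: RintegrableB.
    rewrite /Rintegral fine_le//.
    + by apply: integrable_fin_num => //; apply: integrable_norm; exact: iterm.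
    + apply: integrable_fin_num => //; apply: RintegrableZ.
      by apply: integrable_norm; exact: RintegrableB.
    + apply: ae_ge0_le_integral => //.
      * by apply/measurable_EFinP/measurableT_comp => //; apply: mterm => //; exact: integrable_Rmeasurable ig_g.
      * by move=> r _; rewrite lee_fin !mulr_ge0.
      * apply/measurable_EFinP/measurable_funM => //; apply: measurableT_comp => //.
        by apply: measurable_funB => //; exact: mcont.
      * have := bterm (f_ k) (fun r => g_ k r - g r) (f_M k).
        by apply: filterS => r br _; rewrite lee_fin distrC.
  - rewrite -oppr0; apply: cvgN; rewrite -(mulr0 (C1 * C3)).
    by apply: cvgM; first exact: cvg_cst.
  - rewrite -(mulr0 (C1 * C3)).
    by apply: cvgM; first exact: cvg_cst.
have limJ' : J k @[k --> \oo] --> beta (f 1) * K 1 - beta (f 0) * K 0.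
  rewrite -[X in _ --> X]subr0 (_ : J = fun k => I k - (I k - J k)); last first.
    by apply/funext => k; rewrite subKr.
  exact: cvgB.
exact: (cvg_unique _ limJ limJ').
Unshelve. all: by end_near. Qed.

End unit_time.

Section Rfubini.
Context d1 d2 (T1 : measurableType d1) (T2 : measurableType d2) (R : realType).
Variables (m1 : {sigma_finite_measure set T1 -> \bar R}).
Variables (m2 : {sigma_finite_measure set T2 -> \bar R}).
Variable F : T1 * T2 -> R.
Hypothesis iF : (m1 \x m2)%E.-integrable setT (EFin \o F).

(** The inner real integral has a value for every x, also where the section is not integrable; it
    matches the extended one for almost every x, which is enough. *)
Lemma Rfubini1 : \int[m1]_x \int[m2]_y F (x, y) = fine (\int[m1 \x m2]_z (F z)%:E)%E.
Proof.
rewrite -(integral12_prod_meas1 iF); congr fine; apply: ae_eq_integral => //.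
- apply/measurable_EFinP/measurable_Rintegral.
  exact: integrable_Rmeasurable iF.
- exact: (measurable_fubini_F iF).
- have := ae_integrable1 iF; apply: filterS => x ix _ /=.
  by rewrite /Rintegral fineK//; exact: integrable_fin_num.
Qed.

Lemma Rfubini2 : \int[m2]_y \int[m1]_x F (x, y) = fine (\int[m1 \x m2]_z (F z)%:E)%E.
Proof.
rewrite -(integral21_prod_meas1 iF); congr fine; apply: ae_eq_integral => //.
- apply/measurable_EFinP.
  apply: (@measurable_Rintegral _ _ T2 T1 R m1 (fun z => F (z.2, z.1))).
  by apply: (measurableT_comp (integrable_Rmeasurable iF)); exact: measurable_swap.
- exact: (measurable_fubini_G iF).
- have := ae_integrable2 iF; apply: filterS => y iy _ /=.
  by rewrite /Rintegral fineK//; exact: integrable_fin_num.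
Qed.

Lemma Rfubini : \int[m1]_x \int[m2]_y F (x, y) = \int[m2]_y \int[m1]_x F (x, y).
Proof. by rewrite Rfubini1 Rfubini2. Qed.

Lemma Rfubini_integrable1 : m1.-integrable setT (EFin \o (fun x => \int[m2]_y F (x, y))).
Proof.
have H := integrable_fubini_F iF.
have E : {ae m1, forall x, fine (fubini_F m2 (EFin \o F) x) = \int[m2]_y F (x, y)}.
  by apply: aeW => x.
apply/integrableP; split.
  by apply/measurable_EFinP/measurable_Rintegral; exact: integrable_Rmeasurable iF.
have /integrableP[_] := H; apply: le_lt_trans.
apply: ge0_le_integral => //.
- apply: measurableT_comp => //.
  by apply/measurable_EFinP/measurable_Rintegral; exact: integrable_Rmeasurable iF.
- by apply: measurableT_comp => //; exact: (measurable_fubini_F iF).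
- move=> x _; rewrite /Rintegral /fubini_F /=.
  by case: (integral _ _ _) => //=; rewrite normr0 leey.
Qed.

End Rfubini.

Lemma diff_plane_curve {R : realType} (V : normedModType R) (x a b : V)
    (k1 k2 : R -> R) (t dk1 dk2 : R) :
  is_derive t (1 : R) k1 dk1 -> is_derive t (1 : R) k2 dk2 ->
  differentiable (fun r => x + k1 r *: a + k2 r *: b) t /\
  'd (fun r => x + k1 r *: a + k2 r *: b) t 1 = dk1 *: a + dk2 *: b.
Proof.
have diffk (k : R -> R) dk (w : V) : is_derive t (1 : R) k dk ->
    differentiable (fun r => k r *: w) t /\ 'd (fun r => k r *: w) t 1 = dk *: w.
  move=> dkt; have dk' : differentiable k t by apply/derivable1_diffP; exact: ex_derive.
  split; first exact: differentiableZl.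
  by rewrite diffZl// -deriveE// derive_val.
move=> /(diffk _ _ a)[d1 e1] /(diffk _ _ b)[d2 e2].
have d0 := differentiable_cst x t.
have d01 := differentiableD d0 d1.
split; first exact: (differentiableD d01 d2).
by rewrite (diffD d01 d2) (diffD d0 d1) /= diff_cst /= add0r e1 e2.
Qed.

Lemma Rintegrable_fst d1 d2 (T1 : measurableType d1) (T2 : measurableType d2) (R : realType)
    (m1 : {sigma_finite_measure set T1 -> \bar R}) (m2 : {finite_measure set T2 -> \bar R})
    (u : T1 -> R) :
  m1.-integrable setT (EFin \o u) ->
  (m1 \x m2)%E.-integrable setT (EFin \o (fun z => u z.1)).
Proof.
move=> iu; have mu := integrable_Rmeasurable iu.
have mF : measurable_fun setT (EFin \o (fun z : T1 * T2 => u z.1)).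
  by apply/measurable_EFinP; exact: (measurableT_comp mu).
apply/(@integrable12ltyP _ _ _ _ R m1 m2 _ mF).
under eq_integral => x _ do rewrite /= integral_cst//.
rewrite ge0_integralZr//; last by apply/measurable_EFinP; exact: measurableT_comp.
have /integrableP[_ iuoo] := iu.
by rewrite lte_mul_pinfty//; [exact: integral_ge0|rewrite ge0_fin_numE; [exact: iuoo|exact: integral_ge0]|
  exact: fin_num_fun_lty].
Qed.

Section orbits.
Context {R : realType} {n : nat}.
Variables i j : 'I_n.
Hypothesis ij : i != j.
Local Notation sigma := (@surface_measure R n).
Local Notation ut := (@unit_time R).
Local Notation rot := (plane_rot i j).
Local Notation X := (@rotfield R n i j).
Implicit Types (x : 'rV[R]_n) (u g f : 'rV[R]_n -> R).

Lemma integrable_rot f r : sigma.-integrable setT (EFin \o f) ->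
  sigma.-integrable setT (EFin \o (f \o rot r)).
Proof.
move=> fi; apply: (integrable_preserving (phi := rot r) _ _ fi).
  exact: measurable_rot.
by move=> A mA; exact: surface_measure_rot.
Qed.

Lemma Rintegral_rot f r : sigma.-integrable setT (EFin \o f) ->
  \int[sigma]_x f (rot r x) = \int[sigma]_x f x.
Proof.
move=> fi; rewrite /Rintegral; congr fine.
apply: (integral_preserving (phi := rot r) _ _ fi).
  exact: measurable_rot.
by move=> A mA; exact: surface_measure_rot.
Qed.

Lemma measurable_orbit f : measurable_fun setT f ->
  measurable_fun setT (fun z : 'rV[R]_n * measurableTypeR R => f (rot z.2 z.1)).
Proof.
move=> mf; apply: (measurableT_comp mf); exact: measurable_rot.
Qed.

(** By invariance the L^1 norm of [f \o rot r] does not depend on r, and the time measure is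
    finite. *)
Lemma integrable_orbit f : sigma.-integrable setT (EFin \o f) ->
  (sigma \x ut)%E.-integrable setT
    (EFin \o (fun z : 'rV[R]_n * measurableTypeR R => f (rot z.2 z.1))).
Proof.
move=> fi; have mf := integrable_Rmeasurable fi.
have mF : measurable_fun setT (EFin \o (fun z : 'rV[R]_n * measurableTypeR R => f (rot z.2 z.1))).
  by apply/measurable_EFinP; exact: measurable_orbit.
apply/(@integrable21ltyP _ _ _ (measurableTypeR R) R sigma ut _ mF).
under eq_integral => r _.
  rewrite (_ : (\int[sigma]_x _ = \int[sigma]_x `|(f x)%:E|)%E); last first.
    apply: (@ge0_integral_preserving _ _ _ _ _ sigma sigma (rot r) _ _ (fun x => `|(f x)%:E|%E)) => //.
    - exact: measurable_rot.
    - by move=> A mA; exact: surface_measure_rot.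
    - by apply: measurableT_comp => //; exact/measurable_EFinP.
  over.
rewrite integral_cst//; have /integrableP[_ fioo] := fi.
by rewrite lte_mul_pinfty//; [exact: integral_ge0|rewrite ge0_fin_numE//; exact: integral_ge0|
  exact: fin_num_fun_lty].
Qed.

Lemma ae_usphere_fst :
  {ae (sigma \x ut)%E, forall z : 'rV[R]_n * measurableTypeR R, usphere z.1}.
Proof.
exists ((~` usphere) `*` setT); split.
- by apply: measurableX => //; apply: measurableC; exact: measurable_usphere.
- rewrite product_measure1E//; last by apply: measurableC; exact: measurable_usphere.
  by transitivity (0 * ut setT)%E; [congr (_ * _)%E; exact: surface_measure_usphereC|exact: mul0e].
- by move=> [x r] /= H; split.
Qed.

Lemma derive_rotfield f x : differentiable f x ->
  'D_(X x) f x = x 0 j * 'D_(delta_mx 0 i) f x - x 0 i * 'D_(delta_mx 0 j) f x.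
Proof. by move=> df; rewrite !deriveE// linearB !linearZ. Qed.

(** The velocity of the orbit at time t is the rotation field at the current point; the rest is the
    chain rule. *)
Lemma is_derive_orbit f x (t : R) : differentiable f (rot t x) ->
  is_derive t (1 : R) (fun r => f (rot r x)) ('D_(X (rot t x)) f (rot t x)).
Proof.
move=> df.
pose ki (r : R) := (cos r - 1) * x 0 i + sin r * x 0 j.
pose kj (r : R) := (cos r - 1) * x 0 j - sin r * x 0 i.
have dki : is_derive t (1 : R) ki (- sin t * x 0 i + cos t * x 0 j).
  have -> : ki = (fun r => (x 0 i) *: (cos r - 1)) + (fun r => x 0 j *: sin r).
    by apply/funext => r; rewrite /ki !fctE ![_ *: _]mulrC.
  by apply: is_derive_eq; rewrite /GRing.scale/=; ring.
have dkj : is_derive t (1 : R) kj (- sin t * x 0 j - cos t * x 0 i).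
  have -> : kj = (fun r => (x 0 j) *: (cos r - 1)) - (fun r => x 0 i *: sin r).
    by apply/funext => r; rewrite /kj !fctE ![_ *: _]mulrC.
  by apply: is_derive_eq; rewrite /GRing.scale/=; ring.
have [dg dgE] := diff_plane_curve x (delta_mx 0 i) (delta_mx 0 j) dki dkj.
set gam := (fun r => _) in dg dgE.
have {}dgE : 'd gam t 1 = X (rot t x).
  rewrite dgE /rotfield !plane_rotE// !eqxx eq_sym (negbTE ij).
  by apply/rowP => k; rewrite !mxE; ring.
split.
  by apply: diff_derivable; exact: (@differentiable_comp _ _ _ _ gam f).
rewrite deriveE; last exact: (@differentiable_comp _ _ _ _ gam f).
by rewrite (@diff_comp _ _ _ _ gam f)//= dgE -deriveE.
Qed.

End orbits.

Lemma prim_derive {R : realType} (K K' : R -> R) (s : R) : 0 <= s <= 1 ->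
  (forall t, is_derive t (1 : R) K (K' t)) -> continuous K' -> prim K' s = K s - K 0.
Proof.
move=> s01 dK cK'; rewrite primE//; last exact: continuous_measurable_fun.
have cK : continuous K by move=> t; apply/differentiable_continuous/derivable1_diffP; exact: ex_derive.
move: s01 => /andP[]; rewrite le_eqVlt => /predU1P[<- _|s0 _].
  by rewrite set_itv1 Rintegral_set1 subrr.
have cK's : {within `[0, s], continuous K'} by exact: continuous_subspaceT.
have dKoo : derivable_oo_LRcontinuous K 0 s.
  split.
  - by move=> x _; apply: (@ex_derive _ _ _ _ _ _ (K' x)).
  - exact/cvg_at_right_filter/cK.
  - exact/cvg_at_left_filter/cK.
have KK' : {in `]0, s[, K^`()%classic =1 K'}.
  by move=> x _; rewrite derive1E; exact: derive_val.
by rewrite /Rintegral (continuous_FTC2 s0 cK's dKoo KK').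
Qed.

Section difference_quotient.
Context {R : realType} {n : nat}.
Variables i j : 'I_n.
Hypothesis ij : i != j.
Local Notation sigma := (@surface_measure R n).
Local Notation ut := (@unit_time R).
Local Notation rot := (plane_rot i j).
Local Notation X := (@rotfield R n i j).
Implicit Types (x : 'rV[R]_n) (u g f : 'rV[R]_n -> R).

Lemma polyfunN f : polyfun f -> polyfun (fun x => - f x).
Proof.
move=> pf; rewrite (_ : (fun x => _) = (fun x => -1 * f x)); first exact: polyfunZ.
by apply/funext => x; rewrite mulN1r.
Qed.

Lemma polyfun_rotfield f : polyfun f -> polyfun (fun x => 'D_(X x) f x).
Proof.
move=> /polyfun_derive[df pf].
rewrite (_ : (fun x => _) = (fun x : 'rV[R]_n => x 0 j * 'D_(delta_mx 0 i) f x -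
    x 0 i * 'D_(delta_mx 0 j) f x)); last by apply/funext => x; exact: derive_rotfield.
by apply: polyfunB; apply: polyfunM => //; exact: polyfun_coord.
Qed.

Lemma is_derive_orbit_shift f x (a t : R) : differentiable f (rot (t + a) x) ->
  is_derive t (1 : R) (fun r => f (rot (r + a) x)) ('D_(X (rot (t + a) x)) f (rot (t + a) x)).
Proof.
rewrite -(plane_rot_rot ij) => df.
rewrite (_ : (fun r => _) = (fun r => f (rot r (rot a x)))).
  exact: is_derive_orbit.
by apply/funext => r; rewrite (plane_rot_rot ij).
Qed.

(** The rotation field is invariant under its own flow: both sides are the derivative at t = 0 of f
    (rot (t + r) x). *)
Lemma derive_comp_rot f x (r : R) : polyfun f ->
  'D_(X x) (f \o rot r) x = 'D_(X (rot r x)) f (rot r x).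
Proof.
move=> pf; have [df _] := polyfun_derive pf.
have [dfr _] := polyfun_derive (polyfun_rot r ij pf).
have d1 := is_derive_orbit ij (dfr (rot 0 x)).
have d2 := is_derive_orbit_shift (df (rot (0 + r) x)).
rewrite plane_rot0 in d1; rewrite add0r in d2.
have E : (fun t => (f \o rot r) (rot t x)) = (fun t => f (rot (t + r) x)).
  by apply/funext => t /=; rewrite (plane_rot_rot ij) addrC.
rewrite E in d1.
exact: etrans (esym (@derive_val _ _ _ _ _ _ _ d1)) (@derive_val _ _ _ _ _ _ _ d2).
Qed.

Lemma is_derive_orbitN f x (t : R) : polyfun f ->
  is_derive t (1 : R) (fun r => f (rot (- r) x)) (- 'D_(X (rot (- t) x)) f (rot (- t) x)).
Proof.
move=> pf; have [df _] := polyfun_derive pf.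
have d1 := is_derive_orbit ij (df (rot (- t) x)).
have := @is_derive1_comp _ (fun r => f (rot r x)) -%R t _ _ d1 (is_deriveN (is_derive_id t 1)).
by rewrite mulrN1.
Qed.

Lemma continuous_orbitN f x : polyfun f -> continuous (fun t : R => f (rot (- t) x)).
Proof.
move=> pf t; apply/differentiable_continuous/derivable1_diffP; apply: ex_derive.
exact: is_derive_orbitN.
Qed.

(* Both sides have the same integral against every polynomial f: by rotation
   invariance it is the integral over 0 <= r <= s of the derivative in r of
   the integral of u(x) f(rot (-r) x). *)
Lemma orbit_prim u g (s : R) : 0 <= s <= 1 ->
  sigma.-integrable setT (EFin \o u) -> sigma.-integrable setT (EFin \o g) ->
  (forall f, polyfun f ->
    \int[sigma]_x (g x * f x) = - \int[sigma]_x (u x * 'D_(X x) f x)) ->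
  {ae sigma, forall x, u (rot s x) - u x = prim (fun r => g (rot r x)) s}.
Proof.
move=> s01 iu ig W.
have mu := integrable_Rmeasurable iu; have mg := integrable_Rmeasurable ig.
have m1 : measurable_fun setT (fun z : 'rV[R]_n * measurableTypeR R => (z.2 <= s)%R%:R : R).
  by apply: measurable_le_nat => //; exact: measurable_snd.
have le1 (a : R) (b : bool) : `|a * b%:R| <= `|a|.
  by case: b; rewrite ?mulr1// mulr0 normr0.
pose F (z : 'rV[R]_n * measurableTypeR R) := g (rot z.2 z.1) * (z.2 <= s)%R%:R.
have iF : (sigma \x ut)%E.-integrable setT (EFin \o F).
  apply: (@le_integrable_ae _ _ _ _ F (fun z => `|g (rot z.2 z.1)|)).
  - by apply: measurable_funM => //; exact: measurable_orbit.
  - by apply: integrable_norm; exact: integrable_orbit.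
  - by apply: aeW => z; exact: le1.
pose P x := prim (fun r => g (rot r x)) s.
have iP : sigma.-integrable setT (EFin \o P) := Rfubini_integrable1 iF.
have iur : sigma.-integrable setT (EFin \o (u \o rot s)) by exact: integrable_rot.
pose Z x := u (rot s x) - u x - P x.
have iZ : sigma.-integrable setT (EFin \o Z).
  by apply: RintegrableB => //; exact: RintegrableB.
have bd (h w : 'rV[R]_n -> R) : polyfun h -> sigma.-integrable setT (EFin \o w) ->
    sigma.-integrable setT (EFin \o (fun x => w x * h x)).
  move=> ph iw; have [M hM] := polyfun_bounded ph.
  by apply: (@integrableM_bounded _ _ _ _ M) => //; exact: polyfun_measurable.
have : {ae sigma, forall x, Z x = 0}.
  apply: polyfun_ae_eq0 => // f pf.
  have iZf := bd f _ pf.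
  have -> : \int[sigma]_x (Z x * f x) = \int[sigma]_x (u (rot s x) * f x) -
      \int[sigma]_x (u x * f x) - \int[sigma]_x (P x * f x).
    rewrite -RintegralB//; [|exact: (iZf _ iur)|exact: iZf].
    rewrite -RintegralB//; [|by apply: RintegrableB; [exact: (iZf _ iur)|exact: iZf]|exact: iZf].
    by apply: eq_Rintegral => x _; rewrite /Z !mulrBl.
  have -> : \int[sigma]_x (u (rot s x) * f x) = \int[sigma]_x (u x * f (rot (- s) x)).
    rewrite -(Rintegral_rot ij s (bd _ _ (polyfun_rot (- s) ij pf) iu)).
    by apply: eq_Rintegral => x _ /=; rewrite plane_rotK.
  pose h x := 'D_(X x) f x; have ph : polyfun h := polyfun_rotfield pf.
  suff -> : \int[sigma]_x (P x * f x) =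
      \int[sigma]_x (u x * f (rot (- s) x)) - \int[sigma]_x (u x * f x) by rewrite subrr.
  have step1 : \int[sigma]_x (P x * f x) =
      \int[ut]_r ((r <= s)%R%:R * \int[sigma]_x (g (rot r x) * f x)).
    have [M hM] := polyfun_bounded pf; have mf := polyfun_measurable pf.
    pose G (z : 'rV[R]_n * measurableTypeR R) := F z * f z.1.
    have mG : measurable_fun setT G.
      by apply: measurable_funM; [exact: integrable_Rmeasurable iF|exact: (measurableT_comp mf)].
    have iG : (sigma \x ut)%E.-integrable setT (EFin \o G).
      apply: (@le_integrable_ae _ _ _ _ G (fun z => M * `|F z|)) => //.
        by apply: RintegrableZ; exact: integrable_norm.
      apply: filterS ae_usphere_fst => z Sz.
      by rewrite /G normrM mulrC ler_wpM2r// hM.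
    transitivity (\int[sigma]_x \int[ut]_r G (x, r)).
      apply: ae_eq_Rintegral.
      - by apply: measurable_funM => //; exact: integrable_Rmeasurable iP.
      - exact: measurable_Rintegral.
      - have := ae_integrable1 iF; apply: filterS => x iFx.
        exact: (esym (RintegralZr (f x) measurableT iFx)).
    rewrite (Rfubini iG); apply: eq_Rintegral => r _.
    rewrite -RintegralZl//; last exact: (bd _ _ pf (integrable_rot ij r ig)).
    by apply: eq_Rintegral => x _; rewrite /G /F /=; ring.
  (* Invariance moves the rotation from g to f; the hypothesis [W], used for the rotated polynomial,
     then moves the derivative onto it. *)
  have step2 (r : R) : \int[sigma]_x (g (rot r x) * f x) = - \int[sigma]_x (u x * h (rot (- r) x)).
    transitivity (\int[sigma]_x (g x * f (rot (- r) x))).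
      rewrite -(Rintegral_rot ij r (bd _ _ (polyfun_rot (- r) ij pf) ig)).
      by apply: eq_Rintegral => x _ /=; rewrite plane_rotK.
    apply: etrans (W _ (polyfun_rot (- r) ij pf)) _; apply: (congr1 -%R).
    apply: eq_Rintegral => x _; apply: (congr1 (fun a => u x * a)).
    exact: derive_comp_rot.
  have step3 : \int[ut]_r ((r <= s)%R%:R * \int[sigma]_x (u x * - h (rot (- r) x))) =
      \int[sigma]_x (u x * prim (fun r => - h (rot (- r) x)) s).
    have [M hM] := polyfun_bounded ph; have mh := polyfun_measurable ph.
    pose G (z : 'rV[R]_n * measurableTypeR R) := u z.1 * (- h (rot (- z.2) z.1) * (z.2 <= s)%R%:R).
    have mG : measurable_fun setT G.
      apply: measurable_funM; first exact: (measurableT_comp mu).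
      apply: measurable_funM => //; apply: measurableT_comp => //.
      apply: (measurableT_comp mh); apply: measurable_rot => //.
      by apply: measurableT_comp => //; exact: measurable_snd.
    have iG : (sigma \x ut)%E.-integrable setT (EFin \o G).
      apply: (@le_integrable_ae _ _ _ _ G (fun z => M * `|u z.1|)) => //.
        by apply: RintegrableZ; apply: integrable_norm; exact: Rintegrable_fst.
      apply: filterS ae_usphere_fst => z Sz.
      rewrite /G normrM mulrC ler_wpM2r//; apply: (le_trans (le1 _ _)).
      by rewrite normrN hM//; exact/usphere_rot.
    have := esym (Rfubini iG); rewrite /G /=.
    under eq_Rintegral => r _.
      rewrite (_ : (fun _ => _) = (fun x => (r <= s)%R%:R * (u x * - h (rot (- r) x)))); last first.
        by apply/funext => x; ring.
      rewrite RintegralZl//; last first.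
        by apply: bd => //; apply: polyfunN; exact: (polyfun_rot _ ij ph).
      over.
    move=> ->; apply: eq_Rintegral => x _; rewrite /prim RintegralZl//.
    apply: integrable_prim; apply: continuous_integrable01.
    exact: (continuous_orbitN (polyfunN ph)).
  rewrite step1; transitivity (\int[ut]_r ((r <= s)%R%:R * \int[sigma]_x (u x * - h (rot (- r) x)))).
    apply: eq_Rintegral => r _; rewrite step2; congr (_ * _).
    rewrite -mulN1r -RintegralZl//; last by apply: bd => //; exact: (polyfun_rot _ ij ph).
    by apply: eq_Rintegral => x _; ring.
  rewrite step3 -RintegralB//; [|by apply: bd => //; exact: (polyfun_rot _ ij pf)|exact: bd].
  apply: eq_Rintegral => x _.
  (* The integrand is the derivative in r of the smooth function f (rot (- r) x), so the time
     integral reduces to its end values. *)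
  have -> : prim (fun r => - h (rot (- r) x)) s = f (rot (- s) x) - f (rot (- 0) x).
    apply: (@prim_derive _ (fun r => f (rot (- r) x))) => //; last exact: continuous_orbitN (polyfunN ph).
    by move=> t; exact: is_derive_orbitN.
  by rewrite oppr0 plane_rot0 mulrBr.
by apply: filterS => x /eqP; rewrite subr_eq0 => /eqP.
Qed.

End difference_quotient.

(** Tonelli for |f|: either iterated statement says that the integral of |f| over the product is
    0. *)
Lemma ae_swap d1 d2 (T1 : measurableType d1) (T2 : measurableType d2) (R : realType)
    (m1 : {sigma_finite_measure set T1 -> \bar R}) (m2 : {sigma_finite_measure set T2 -> \bar R})
    (f : T1 * T2 -> R) : measurable_fun setT f ->
  {ae m2, forall y, {ae m1, forall x, f (x, y) = 0}} ->
  {ae m1, forall x, {ae m2, forall y, f (x, y) = 0}}.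
Proof.
move=> mf f0; pose F (z : T1 * T2) : \bar R := `|f z|%:E.
have mF : measurable_fun setT F by apply/measurable_EFinP; exact: measurableT_comp.
have F0 z : (0 <= F z)%E by rewrite lee_fin.
have E := @fubini_tonelli _ _ T1 T2 R m1 m2 F mF F0.
have G0 : (\int[m2]_y fubini_G m1 F y = 0)%E.
  rewrite -[RHS](@integral0 _ _ _ m2 setT); apply: ae_eq_integral => //.
    exact: measurable_fun_fubini_tonelli_G.
  apply: filterS f0 => y f0 _; rewrite /fubini_G.
  rewrite -[RHS](@integral0 _ _ _ m1 setT); apply: ae_eq_integral => //.
    apply/measurable_EFinP; apply: measurableT_comp => //; exact: (measurableT_comp mf).
  by apply: filterS f0 => x fxy _; rewrite /F fxy normr0.
rewrite G0 in E.
have mFF : measurable_fun setT (fubini_F m2 F) by exact: measurable_fun_fubini_tonelli_F.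
have /(ae_eq_integral_abs _ measurableT mFF) : (\int[m1]_x `|fubini_F m2 F x| = 0)%E.
  rewrite -E; apply: eq_integral => x _; rewrite gee0_abs//.
  exact: integral_ge0.
apply: filterS => x /(_ I) Fx0.
have mfx : measurable_fun setT (fun y => (f (x, y))%:E).
  by apply/measurable_EFinP; exact: (measurableT_comp mf).
have /(ae_eq_integral_abs _ measurableT mfx) : (\int[m2]_y `|(f (x, y))%:E| = 0)%E by [].
by apply: filterS => y /(_ I) [].
Qed.

Lemma prim0 {R : realType} (g : R -> R) : measurable_fun setT g -> prim g 0 = 0.
Proof. by move=> mg; rewrite primE ?lexx ?ler01// set_itv1 Rintegral_set1. Qed.

Lemma unit_time_setT (R : realType) : @unit_time R setT = 1%E.
Proof.
rewrite /unit_time /= /mfrestr /mrestr setTI lebesgue_measure_itv /= lte_fin ltr01.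
by rewrite oppr0 adde0.
Qed.

Section orbit_parts.
Context {R : realType} {n : nat}.
Variables i j : 'I_n.
Hypothesis ij : i != j.
Local Notation sigma := (@surface_measure R n).
Local Notation ut := (@unit_time R).
Local Notation rot := (plane_rot i j).
Implicit Types (x : 'rV[R]_n).
Variables (u g : 'rV[R]_n -> R).
Hypotheses (iu : sigma.-integrable setT (EFin \o u)) (ig : sigma.-integrable setT (EFin \o g)).
Hypothesis u_prim : forall s : R, 0 <= s <= 1 ->
  {ae sigma, forall x, u (rot s x) - u x = prim (fun r => g (rot r x)) s}.

Let mu := integrable_Rmeasurable iu.
Let mg := integrable_Rmeasurable ig.

(** [u_prim] has an exceptional set of points for each time. Exchanging the quantifiers leaves one
    null set of points off which u is a primitive at almost every time, so the one-variable chain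
    rule applies orbit by orbit. *)
Lemma ae_orbit_prim : {ae sigma, forall x, {ae ut, forall r : measurableTypeR R,
  u (rot r x) = u x + prim (fun q => g (rot q x)) r}}.
Proof.
pose f (z : 'rV[R]_n * measurableTypeR R) :=
  u (rot z.2 z.1) - (u z.1 + prim (fun q => g (rot q z.1)) z.2).
have mf : measurable_fun setT f.
  apply: measurable_funB; first exact: measurable_orbit.
  apply: measurable_funD; first exact: (measurableT_comp mu).
  apply: (@measurable_Rintegral _ _ _ (measurableTypeR R) R ut
    (fun z : ('rV[R]_n * measurableTypeR R) * measurableTypeR R =>
       g (rot z.2 z.1.1) * (z.2 <= z.1.2)%R%:R)).
  apply: measurable_funM; last first.
    apply: measurable_le_nat; first exact: measurable_snd.
    by apply: (measurableT_comp measurable_snd); exact: measurable_fst.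
  apply: (measurableT_comp mg); apply: measurable_rot; first exact: measurable_snd.
  by apply: (measurableT_comp measurable_fst); exact: measurable_fst.
have : {ae sigma, forall x, {ae ut, forall r : measurableTypeR R, f (x, r) = 0}}.
  apply: ae_swap => //; apply: filterS ae_unit_time => r; rewrite in_itv/= => r01.
  have := u_prim r01; apply: filterS => x e; apply/eqP.
  by rewrite /f /= -e subr_eq0; apply/eqP; ring.
apply: filterS => x; apply: filterS => r /eqP.
by rewrite subr_eq0 => /eqP.
Qed.

Variables (beta beta' : R -> R).
Hypotheses (dbeta : forall t, is_derive t (1 : R) beta (beta' t)) (cbeta' : continuous beta').
Variables (K K' : 'rV[R]_n -> R) (M : R).
Hypotheses (mK : measurable_fun setT K) (mK' : measurable_fun setT K').
Hypotheses (KM : forall x, usphere x -> `|K x| <= M) (K'M : forall x, usphere x -> `|K' x| <= M).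
Hypothesis dK : forall x, usphere x -> forall t,
  is_derive t (1 : R) (fun r => K (rot r x)) (K' (rot t x)).
Hypothesis cK' : forall x, usphere x -> continuous (fun t : R => K' (rot t x)).
Hypothesis ib : sigma.-integrable setT (EFin \o (fun x => beta (u x))).
Hypothesis ib' : sigma.-integrable setT (EFin \o (fun x => beta' (u x) * g x)).

(** The chain rule on the orbit of x over time 1 turns the time integral of the integrand into a
    difference of values of beta(u) K at [rot 1 x] and x. Integrated over the sphere, this
    difference vanishes by invariance, while the other side is the integral in the statement, the
    same at every time. *)
Lemma Rintegral_orbit_parts :
  \int[sigma]_x (beta' (u x) * g x * K x + beta (u x) * K' x) = 0.
Proof.
pose H x := beta' (u x) * g x * K x + beta (u x) * K' x.
have ibK := integrableM_bounded ib mK KM.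
have iH : sigma.-integrable setT (EFin \o H).
  apply: RintegrableD; first exact: (integrableM_bounded ib' mK KM).
  exact: (integrableM_bounded ib mK' K'M).
have iHr := integrable_orbit ij iH.
have igr := integrable_orbit ij ig.
have mb : measurable_fun setT beta.
  apply: continuous_measurable_fun => t.
  by apply/differentiable_continuous/derivable1_diffP; exact: ex_derive.
have mb' : measurable_fun setT beta' by exact: continuous_measurable_fun.
(* [ae_orbit_prim] says nothing about a given time, and the boundary term needs r = 1 exactly. *)
have ux1 : {ae sigma, forall x, u (rot 1 x) - u x = prim (fun r => g (rot r x)) 1}.
  by apply: u_prim; rewrite ler01 lexx.
have E : {ae sigma, forall x, \int[ut]_r H (rot r x) =
    beta (u (rot 1 x)) * K (rot 1 x) - beta (u x) * K x}.
  apply: filter_app (ae_integrable1 igr).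
  apply: filterS3 ae_usphere ux1 ae_orbit_prim => x Sx e1 ex igx.
  have := @prim_chain _ (fun r => g (rot r x)) (u x) beta beta' (fun r => K (rot r x))
    (fun r => K' (rot r x)) igx dbeta cbeta' (dK Sx) (cK' Sx).
  rewrite /= -e1 prim0; last exact: integrable_Rmeasurable igx.
  rewrite addr0 plane_rot0 (_ : u x + _ = u (rot 1 x)); last by ring.
  move=> <-; have mgx := integrable_Rmeasurable igx.
  have section1 (f : 'rV[R]_n -> R) : measurable_fun setT f ->
      measurable_fun setT (fun r : measurableTypeR R => f (rot r x)).
    by move=> mf; apply: (measurableT_comp mf); exact: measurable_rot.
  have mux : measurable_fun setT (fun r : measurableTypeR R => u x + prim (fun q => g (rot q x)) r).
    by apply: measurable_funD => //; exact: measurable_prim.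
  apply: ae_eq_Rintegral.
  - by apply: (section1 H); exact: integrable_Rmeasurable iH.
  - apply: measurable_funD; apply: measurable_funM; try exact: section1.
      by apply: measurable_funM => //; exact: (measurableT_comp mb').
    exact: (measurableT_comp mb).
  - by apply: filterS ex => r; rewrite /H => ->.
have ibKr := integrable_rot ij 1 ibK.
have : \int[sigma]_x \int[ut]_r H (rot r x) = 0.
  rewrite (ae_eq_Rintegral _ _ E).
  - by rewrite RintegralB// (Rintegral_rot ij 1 ibK) subrr.
  - exact: integrable_Rmeasurable (Rfubini_integrable1 iHr).
  - by apply: measurable_funB; [exact: integrable_Rmeasurable ibKr|exact: integrable_Rmeasurable ibK].
rewrite (Rfubini iHr).
under eq_Rintegral => r _ do rewrite /= (Rintegral_rot ij r iH).
have ut1 := unit_time_setT R.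
by rewrite (Rintegral_cst ut)// [X in fine X]ut1 mulr1.
Qed.

End orbit_parts.

(** * Integration by parts *)

Lemma continuous_sumr {R : realType} (T : topologicalType) I (s : seq I) (F : I -> T -> R) :
  (forall i, continuous (F i)) -> continuous (fun x => \sum_(i <- s) F i x).
Proof.
move=> cF; elim: s => [|i s IH] x.
  by under eq_fun do rewrite big_nil; exact: cvg_cst.
under eq_fun do rewrite big_cons.
exact: cvgD (cF i x) (IH x).
Qed.

Section continuous_functions.
Context {R : realType} {n : nat}.
Implicit Types (x : 'rV[R]_n) (f : 'rV[R]_n -> R).

(** The sigma-algebra is generated by the coordinates, so open sets are not measurable by
    definition. Rounding every coordinate down to a multiple of 1/(k + 1) gives functions with
    countably many values on measurable cells, which converge to f by continuity. *)
Lemma continuous_measurable_rV f : continuous f -> measurable_fun setT f.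
Proof.
move=> cf.
pose fl (k : nat) x : 'rV[int]_n := \row_i Num.floor (k.+1%:R * x 0 i).
pose pt (k : nat) (z : 'rV[int]_n) : 'rV[R]_n := \row_i ((z 0 i)%:~R / k.+1%:R).
apply: (@measurable_fun_cvg _ _ _ _ (fun k x => f (pt k (fl k x)))) => [k|x _].
  move=> _ B mB; rewrite setTI.
  pose A (z : 'rV[int]_n) : set 'rV[R]_n :=
    if f (pt k z) \in B then \bigcap_i (fun x : 'rV[R]_n => k.+1%:R * x 0 i) @^-1`
      `[(z 0 i)%:~R, (z 0 i + 1)%:~R[%classic else set0.
  rewrite [X in measurable X](_ : _ = \bigcup_z A z).
    apply: countable_bigcupT_measurable; first exact: countableP.
    move=> z; rewrite /A; case: ifP => // _; apply: fin_bigcap_measurable => // i _.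
    rewrite -[X in measurable X]setTI.
    have mi : measurable_fun setT (fun x : 'rV[R]_n => k.+1%:R * x 0 i).
      by apply: measurable_funM => //; exact: measurable_coord.
    by apply: mi => //; exact: measurable_itv.
  apply/seteqP; split => [x /= Bx|x [z _]].
    exists (fl k x) => //; rewrite /A mem_set// => i _ /=.
    by rewrite in_itv/= mxE floor_itv.
  rewrite /A; case: ifPn => // /set_mem Bz H /=.
  suff -> : fl k x = z by [].
  apply/rowP => i; rewrite mxE; apply: floor_def.
  by have /= := H i I; rewrite in_itv.
have cpt : pt k (fl k x) @[k --> \oo] --> x.
  apply/cvgrPdist_le => e e0; near=> k.
  rewrite /Num.Def.normr /= mx_normrE; apply: (le_trans (y := k.+1%:R^-1)); last first.
    near: k.
    by have := @cvg_harmonic R => /cvgrPdist_le/(_ e e0); apply: filterS => k;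
      rewrite sub0r normrN ger0_norm// invr_ge0.
  apply: bigmax_le; first by rewrite invr_ge0.
  move=> [a i] _ /=; rewrite !mxE ord1.
  have k0 : 0 < k.+1%:R :> R by [].
  have /andP[h1 h2] := floor_itv (k.+1%:R * x 0 i).
  move: h1 h2; set m : R := (Num.floor _)%:~R; rewrite intrD1 -/m => h1 h2.
  have -> : x 0 i - m / k.+1%:R = (k.+1%:R * x 0 i - m) / k.+1%:R by field; rewrite gt_eqF.
  rewrite ger0_norm; last by rewrite divr_ge0// subr_ge0.
  by rewrite -[leRHS]mul1r ler_wpM2r ?invr_ge0 ?ltW// ltrBlDr addrC.
exact: (@cvg_comp _ _ _ (fun k => pt k (fl k x)) f _ _ _ cpt (cf x)).
Unshelve. all: by end_near. Qed.

Lemma continuous_usphere_bounded f : continuous f ->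
  exists2 M, 0 <= M & forall x, usphere x -> `|f x| <= M.
Proof.
move=> cf; pose A := [set v : 'rV[R]_n | forall i, `[-1, 1]%classic (v ord0 i)].
have cA : compact A 
  by apply: (@rV_compact R n (fun=> `[-1, 1]%classic)) => i; exact: segment_compact.
have : compact (f @` A).
  by apply: continuous_compact => //; exact: continuous_subspaceT.
move=> /compact_bounded[M0 [_ hM]].
exists (`|M0| + 1) => // x Sx; apply: hM.
  by rewrite (le_lt_trans (ler_norm _))// ltrDl.
exists x => // i /=; rewrite in_itv/= -ler_norml.
by rewrite (le_trans (normr_coord _ _))// (_ : enorm x = 1).
Qed.

End continuous_functions.

(** * Smooth tangent fields and the weak gradient *)

Section tangential.
Context {R : realType} {n : nat}.
Implicit Types (x w : 'rV[R]_n) (u f : 'rV[R]_n -> R) (V : 'rV[R]_n -> 'rV[R]_n).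
Local Notation sigma := (@surface_measure R n).

Lemma derive_coord V x w k : differentiable V x ->
  'D_w (fun y => V y 0 k) x = ('D_w V x) 0 k.
Proof.
move=> dV.
have dVk : differentiable (fun y => V y 0 k) x.
  by apply: (@differentiable_comp _ _ _ _ V (fun z : 'rV[R]_n => z 0 k)) => //; exact: differentiable_coord.
rewrite deriveE// (@diff_comp _ _ _ _ V (fun z : 'rV[R]_n => z 0 k))//=; last exact: differentiable_coord.
rewrite -!deriveE//; last exact: differentiable_coord.
have E : (fun z : 'rV[R]_n => z 0 k) = dotv (delta_mx 0 k).
  by apply/funext => z; rewrite dotv_deltal.
by rewrite E derive_dotv dotv_deltal.
Qed.

Lemma smooth_coord V k : smooth V ->
  (forall x, differentiable (fun y => V y 0 k) x) /\
  (forall w, continuous (fun x => ('D_w V x) 0 k)).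
Proof.
move=> sV; split=> [x|w x].
  by apply: (@differentiable_comp _ _ _ _ V (fun z : 'rV[R]_n => z 0 k));
    [exact: (sV [::] x)|exact: differentiable_coord].
apply: differentiable_continuous.
by apply: (@differentiable_comp _ _ _ _ (fun y => 'D_w V y) (fun z : 'rV[R]_n => z 0 k));
  [exact: (sV [:: w] x)|exact: differentiable_coord].
Qed.

Lemma derive_row V x w : differentiable V x -> 'D_w V x = \sum_j w 0 j *: 'D_(delta_mx 0 j) V x.
Proof.
move=> dV; rewrite deriveE// {1}(row_sum_delta w) linear_sum; apply: eq_bigr => j _.
by rewrite linearZ/= deriveE.
Qed.

(** The directions in [surface_div] depend on x. Here only fixed directions remain, and the
    continuity of the divergence follows from smoothness. *)
Lemma surface_divE V x : differentiable V x ->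
  surface_div V x = \sum_i ('D_(delta_mx 0 i) V x) 0 i -
    \sum_i \sum_j x 0 i * (x 0 j * ('D_(delta_mx 0 j) V x) 0 i).
Proof.
move=> dV; rewrite /surface_div -sumrB; apply: eq_bigr => i _.
rewrite deriveE// linearB linearZ /= -!deriveE// mxE [in X in _ + X]mxE [X in _ - X = _]mxE.
congr (_ - _); rewrite (derive_row x dV) summxE mulr_sumr; apply: eq_bigr => j _.
by rewrite mxE.
Qed.

Lemma continuous_surface_div V : smooth V -> continuous (surface_div V).
Proof.
move=> sV; rewrite (_ : surface_div V = (fun x => \sum_i ('D_(delta_mx 0 i) V x) 0 i -
    \sum_i \sum_j x 0 i * (x 0 j * ('D_(delta_mx 0 j) V x) 0 i))); last first.
  by apply/funext => x; rewrite surface_divE//; exact: (sV [::] x).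
have cD i w : continuous (fun x => ('D_w V x) 0 i) by have [] := smooth_coord i sV.
have cc i : continuous (fun x : 'rV[R]_n => x 0 i) by exact: coord_continuous.
have c1 : continuous (fun x => \sum_i ('D_(delta_mx 0 i) V x) 0 i).
  by apply: continuous_sumr => i x; exact: cD.
have c2 : continuous (fun x => \sum_i \sum_j x 0 i * (x 0 j * ('D_(delta_mx 0 j) V x) 0 i)).
  apply: continuous_sumr => i; apply: continuous_sumr => j x.
  exact: cvgM (cc i x) (cvgM (cc j x) (cD i (delta_mx 0 j) x)).
by move=> x; exact: cvgB (c1 x) (c2 x).
Qed.

End tangential.

Section weak_gradient.
Context {R : realType} {n : nat}.
Implicit Types (x w : 'rV[R]_n) (u f : 'rV[R]_n -> R) (V Psi : 'rV[R]_n -> 'rV[R]_n).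
Local Notation sigma := (@surface_measure R n).

Lemma is_surface_grad_integrable u Psi k : is_surface_grad u Psi ->
  sigma.-integrable setT (EFin \o (fun x => Psi x 0 k)).
Proof. by case=> H _ _; apply/Lfun1_integrable; exact: H. Qed.

Lemma integrable_dotv Psi V : (forall k, sigma.-integrable setT (EFin \o (fun x => Psi x 0 k))) ->
  (forall k, measurable_fun setT (fun x => V x 0 k)) ->
  (forall k, exists M, forall x, usphere x -> `|V x 0 k| <= M) ->
  sigma.-integrable setT (EFin \o (fun x => dotv (Psi x) (V x))).
Proof.
move=> iP mV bV; apply: Rintegrable_sum => k; have [M hM] := bV k.
exact: (integrableM_bounded (iP k) (mV k) hM).
Qed.

Lemma smooth_measurable V k : smooth V -> measurable_fun setT (fun x => V x 0 k).
Proof.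
move=> /(smooth_coord k)[dV _]; apply: continuous_measurable_rV => x.
exact/differentiable_continuous.
Qed.

Lemma smooth_bounded V k : smooth V -> exists M, forall x, usphere x -> `|V x 0 k| <= M.
Proof.
move=> /(smooth_coord k)[dV _].
have cV : continuous (fun x => V x 0 k) by move=> x; exact/differentiable_continuous.
by have [M _ hM] := continuous_usphere_bounded cV; exists M.
Qed.

Lemma surface_grad_test u Psi V : sigma.-integrable setT (EFin \o u) ->
  is_surface_grad u Psi -> smooth_tangent V ->
  \int[sigma]_x dotv (Psi x) (V x) = - \int[sigma]_x (u x * surface_div V x).
Proof.
move=> iu uPsi tV; have [sV _] := tV; have iP k := is_surface_grad_integrable k uPsi.
case: uPsi => _ _ /(_ V tV).
rewrite integral_usphere; last first.
  apply/measurable_EFinP; apply: (@integrable_Rmeasurable _ _ _ sigma).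
  by apply: integrable_dotv => // k; [exact: smooth_measurable|exact: smooth_bounded].
rewrite integral_usphere; last first.
  apply/measurable_EFinP; apply: measurable_funM; first exact: integrable_Rmeasurable iu.
  by apply: continuous_measurable_rV; exact: continuous_surface_div.
by rewrite /Rintegral => ->; rewrite fineN.
Qed.

(** The test field is f X with X the rotation field: X is tangent and divergence free, so the
    divergence of f X is the derivative of f along X. This is the hypothesis [W] of [orbit_prim]. *)
Lemma surface_grad_rotfield u Psi (i j : 'I_n) f : sigma.-integrable setT (EFin \o u) ->
  is_surface_grad u Psi -> polyfun f ->
  \int[sigma]_x (dotv (Psi x) (rotfield i j x) * f x) =
  - \int[sigma]_x (u x * 'D_(rotfield i j x) f x).
Proof.
move=> iu uPsi pf; have [df pDf] := polyfun_derive pf.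
pose F k x := f x * rotfield i j x 0 k.
have pX k : polyfun (fun x : 'rV[R]_n => rotfield i j x 0 k).
  rewrite (_ : (fun x => _) = (fun x : 'rV[R]_n => (delta_mx 0 i : 'rV[R]_n) 0 k * x 0 j -
      (delta_mx 0 j : 'rV[R]_n) 0 k * x 0 i)); last by apply/funext => x; rewrite !mxE; ring.
  by apply: polyfunB; apply: polyfunZ; exact: polyfun_coord.
have pF k : polyfun (F k) by exact: polyfunM.
pose V x := \row_k F k x.
have VE x : V x = f x *: rotfield i j x by apply/rowP => k; rewrite /V /F [LHS]mxE [RHS]mxE.
have sV : smooth V by exact: smooth_row_polyfun.
have tV : smooth_tangent V.
  split=> // x _; rewrite VE dotvZl dotvC dotv_rotfield; ring.
transitivity (\int[sigma]_x dotv (Psi x) (V x)).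
  by apply: eq_Rintegral => x _; rewrite VE dotvZr mulrC.
rewrite (surface_grad_test iu uPsi tV); apply: (congr1 -%R).
apply: eq_Rintegral => x _; apply: (congr1 (fun a => u x * a)).
(* The k-th row of the matrix of the linear field X. The matrix is antisymmetric, which gives both
   the tangency [xX] and the vanishing of the trace. *)
pose v k := (delta_mx 0 i : 'rV[R]_n) 0 k *: delta_mx 0 j - (delta_mx 0 j : 'rV[R]_n) 0 k *: delta_mx 0 i : 'rV[R]_n.
have XE y k : rotfield i j y 0 k = dotv (v k) y.
  by rewrite /v dotvBl !dotvZl !dotv_deltal !mxE; ring.
have dVE w k : ('D_w V x) 0 k = 'D_w f x * dotv (v k) x + f x * dotv (v k) w.
  rewrite -derive_coord; last exact: (sV [::] x).
  rewrite (_ : (fun y => V y 0 k) = f * dotv (v k)); last first.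
    by apply/funext => y; rewrite VE mxE XE.
  rewrite deriveM; [|exact/diff_derivable|exact/diff_derivable/differentiable_dotv].
  by rewrite derive_dotv /GRing.scale/= addrC [X in X + _]mulrC.
have xX (y : 'rV[R]_n) : \sum_k y 0 k * dotv (v k) y = 0.
  under eq_bigr do rewrite -XE.
  by rewrite -[LHS]/(dotv y (rotfield i j y)) dotv_rotfield; ring.
rewrite /surface_div.
under eq_bigr do rewrite dVE.
rewrite big_split /= -mulr_sumr (_ : \sum_(k < n) dotv (v k) (delta_mx 0 k - x 0 k *: x) = 0).
  rewrite mulr0 addr0 deriveE//.
  transitivity ('d f x (\sum_(k < n) dotv (v k) x *: (delta_mx 0 k - x 0 k *: x))).
    by rewrite linear_sum; apply: eq_bigr => k _; rewrite deriveE// mulrC; exact: (esym (linearZ _ _)).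
  congr ('d f x _).
  transitivity (rotfield i j x - (\sum_k x 0 k * dotv (v k) x) *: x).
    rewrite (row_sum_delta (rotfield i j x)) scaler_suml -sumrB; apply: eq_bigr => k _.
    by rewrite scalerBr XE scalerA mulrC.
  by rewrite xX scale0r subr0.
under eq_bigr do rewrite dotvBr dotvZr.
rewrite sumrB xX subr0; under eq_bigr do rewrite dotv_deltar /v.
rewrite (_ : \sum_(k < n) _ = \sum_k (delta_mx 0 j : 'rV[R]_n) 0 k * (delta_mx 0 i : 'rV[R]_n) 0 k -
   \sum_k (delta_mx 0 i : 'rV[R]_n) 0 k * (delta_mx 0 j : 'rV[R]_n) 0 k); last first.
  by rewrite -sumrB; apply: eq_bigr => k _; rewrite !mxE; ring.
by rewrite -/(dotv _ _) -/(dotv _ _) dotvC subrr.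
Qed.

End weak_gradient.

Section integration_by_parts.
Context {R : realType} {n : nat}.
Implicit Types (x w v : 'rV[R]_n) (f : 'rV[R]_n -> R).
Local Notation sigma := (@surface_measure R n).

Lemma continuous_plane_rot (i j : 'I_n) x : continuous (fun t : R => plane_rot i j t x).
Proof.
have cos1 (a : R) : continuous (fun r : R => (cos r - 1) * a).
  by move=> r; apply: cvgM (cvgB (@continuous_cos R r) (cvg_cst _)) (cvg_cst _).
have sin1 (a : R) : continuous (fun r : R => sin r * a).
  by move=> r; apply: cvgM (@continuous_sin R r) (cvg_cst _).
move=> t; have ci := cvgD (cos1 (x 0 i) t) (sin1 (x 0 j) t).
have cj := cvgB (cos1 (x 0 j) t) (sin1 (x 0 i) t).
apply: cvgD.
  by apply: cvgD; [exact: cvg_cst|apply: cvgZ; [exact: ci|exact: cvg_cst]].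
by apply: cvgZ; [exact: cj|exact: cvg_cst].
Qed.

Lemma bounded_itv (h : R -> R) : (forall c, -1 <= c <= 1 -> {for c, continuous h}) ->
  exists2 M, 0 <= M & forall c, -1 <= c <= 1 -> `|h c| <= M.
Proof.
move=> ch; have : compact (h @` `[-1, 1]%classic).
  apply: continuous_compact; last exact: segment_compact.
  by apply: continuous_in_subspaceT => c /set_mem; rewrite /= in_itv; exact: ch.
move=> /compact_bounded[M0 [_ hM]].
exists (`|M0| + 1) => // c c1; apply: hM.
  by rewrite (le_lt_trans (ler_norm _))// ltrDl.
by exists c => //; rewrite /= in_itv.
Qed.

(** The sum of x_j w_i X_ij is |x|^2 w - (w . x) x, which is w for a tangent vector on the sphere:
    the rotation fields span the tangent space, with explicit coefficients. *)
Lemma sum_rotfield v w x : usphere x -> dotv w x = 0 ->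
  \sum_i \sum_j dotv v (rotfield i j x) * (x 0 j * w 0 i) = dotv v w.
Proof.
move=> /uspherevv x1 wx.
transitivity (\sum_i \sum_j ((x 0 j * x 0 j) * (v 0 i * w 0 i)
    - (w 0 i * x 0 i) * (x 0 j * v 0 j))).
  by apply: eq_bigr => i _; apply: eq_bigr => j _; rewrite dotv_rotfield; ring.
under eq_bigr do rewrite sumrB -mulr_suml -mulr_sumr.
by rewrite sumrB -mulr_sumr -mulr_suml -!/(dotv _ _) x1 wx mul1r mul0r subr0.
Qed.

(** The divergence of Y = sum_ij x_j Y_i X_ij: since the X_ij are divergence free, only the
    derivatives of the coefficients x_j Y_i along X_ij contribute. *)
Lemma sum_derive_rotfield (Y : 'rV[R]_n -> 'rV[R]_n) x : differentiable Y x ->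
  usphere x -> dotv (Y x) x = 0 ->
  \sum_i \sum_j (rotfield i j x 0 j * Y x 0 i + x 0 j * ('D_(rotfield i j x) Y x) 0 i) =
  surface_div Y x.
Proof.
move=> dY /uspherevv x1 Yx; rewrite surface_divE//.
have DX i j : 'D_(rotfield i j x) Y x = x 0 j *: 'D_(delta_mx 0 i) Y x - x 0 i *: 'D_(delta_mx 0 j) Y x.
  by rewrite !deriveE// linearB !linearZ.
transitivity (\sum_i \sum_j ((x 0 j * (delta_mx 0 i : 'rV[R]_n) 0 j * Y x 0 i - x 0 i * Y x 0 i)
  + ((x 0 j * x 0 j) * ('D_(delta_mx 0 i) Y x) 0 i
     - x 0 i * (x 0 j * ('D_(delta_mx 0 j) Y x) 0 i)))).
  apply: eq_bigr => i _; apply: eq_bigr => j _; rewrite DX !mxE !eqxx/=; ring.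
have E1 (a : R) : \sum_j (x 0 j * x 0 j) * a = a by rewrite -mulr_suml -[X in X * a]/(dotv x x) x1 mul1r.
have E2 i (a : R) : \sum_j x 0 j * (delta_mx 0 i : 'rV[R]_n) 0 j * a = x 0 i * a.
  by rewrite -mulr_suml -[X in X * a]/(dotv x (delta_mx 0 i)) dotv_deltar.
under eq_bigr => i _ do rewrite big_split/= !sumrB E1 E2 sumr_const card_ord.
rewrite big_split/= !sumrB sumrMnl.
have -> : \sum_i x 0 i * Y x 0 i = 0 by rewrite -[LHS]/(dotv x (Y x)) dotvC.
by rewrite mul0rn subr0 add0r.
Qed.

End integration_by_parts.

Section continuous_arith.
Context {R : realType} {T : topologicalType}.
Implicit Types f g : T -> R.

Lemma continuousM_fun f g : continuous f -> continuous g -> continuous (fun x => f x * g x).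
Proof. by move=> cf cg x; apply: cvgM; [exact: cf|exact: cg]. Qed.

Lemma continuousD_fun f g : continuous f -> continuous g -> continuous (fun x => f x + g x).
Proof. by move=> cf cg x; apply: cvgD; [exact: cf|exact: cg]. Qed.

Lemma continuousB_fun f g : continuous f -> continuous g -> continuous (fun x => f x - g x).
Proof. by move=> cf cg x; apply: cvgB; [exact: cf|exact: cg]. Qed.

End continuous_arith.

Section zonal_parts.
Context {R : realType} {n : nat}.
Implicit Types (x w v : 'rV[R]_n) (f : 'rV[R]_n -> R).
Local Notation sigma := (@surface_measure R n).

Lemma dotv_itv v x : usphere v -> usphere x -> -1 <= dotv v x <= 1.
Proof.
move=> Sv Sx; rewrite -ler_norml (le_trans (normr_dotv_le _ _))//.
by rewrite (_ : enorm v = 1)// (_ : enorm x = 1)// mulr1.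
Qed.

Lemma derive_zonal (h : R -> R) (dh : R) v x w : is_derive (dotv v x) (1 : R) h dh ->
  differentiable (h \o dotv v) x /\ 'D_w (h \o dotv v) x = dh * dotv v w.
Proof.
move=> hd; have dh' : differentiable h (dotv v x).
  by apply/derivable1_diffP; exact: ex_derive.
have dv := differentiable_dotv v x.
have dhv : differentiable (h \o dotv v) x by exact: differentiable_comp.
split=> //; rewrite deriveE// diff_comp//= -(deriveE w dv) derive_dotv diff1E//.
by rewrite derive1E derive_val mulrC.
Qed.

Lemma continuous_dotv v : continuous (dotv v : 'rV[R]_n -> R).
Proof. by move=> x; exact/differentiable_continuous/differentiable_dotv. Qed.

Variables (Phi : 'rV[R]_n) (h h' : R -> R) (Y : 'rV[R]_n -> 'rV[R]_n).
Hypotheses (SPhi : usphere Phi) (mh : measurable_fun setT h) (mh' : measurable_fun setT h').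
Hypothesis dh : forall c : R, -1 <= c <= 1 -> is_derive c (1 : R) h (h' c).
Hypothesis ch' : forall c : R, -1 <= c <= 1 -> {for c, continuous h'}.
Hypothesis tY : smooth_tangent Y.

Let ch (c : R) : -1 <= c <= 1 -> {for c, continuous h}.
Proof.
by move=> /dh dhc; apply/differentiable_continuous/derivable1_diffP; exact: ex_derive.
Qed.

Let sY : smooth Y := proj1 tY.

(** The coefficient of X_ij in the decomposition of the field h Y; [K'] below is its derivative
    along X_ij. *)
Let K (i j : 'I_n) x := h (dotv Phi x) * (x 0 j * Y x 0 i).

Let P (i j : 'I_n) x := dotv Phi (rotfield i j x) * (x 0 j * Y x 0 i).

Let Q (i j : 'I_n) x :=
  rotfield i j x 0 j * Y x 0 i + x 0 j * ('D_(rotfield i j x) Y x) 0 i.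

Let K' (i j : 'I_n) x := h' (dotv Phi x) * P i j x + h (dotv Phi x) * Q i j x.

Let cY i : continuous (fun x => Y x 0 i).
Proof. by move=> x; apply: differentiable_continuous; have [] := smooth_coord i sY. Qed.

Let cX i j k : continuous (fun x : 'rV[R]_n => rotfield i j x 0 k).
Proof.
rewrite (_ : (fun x => _) = (fun x : 'rV[R]_n => dotv ((delta_mx 0 i : 'rV[R]_n) 0 k *: delta_mx 0 j -
    (delta_mx 0 j : 'rV[R]_n) 0 k *: delta_mx 0 i) x)); first exact: continuous_dotv.
by apply/funext => x; rewrite dotvBl !dotvZl !dotv_deltal !mxE; ring.
Qed.

Let cc k : continuous (fun x : 'rV[R]_n => x 0 k).
Proof. exact: coord_continuous. Qed.

Let cq i j : continuous (fun x => x 0 j * Y x 0 i).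
Proof. exact: continuousM_fun. Qed.

Let cP i j : continuous (P i j).
Proof.
apply: continuousM_fun => //; apply: continuous_sumr => k.
by apply: continuousM_fun; [exact: cst_continuous|exact: cX].
Qed.

Let cQ i j : continuous (Q i j).
Proof.
have cDX : continuous (fun x => ('D_(rotfield i j x) Y x) 0 i).
  rewrite (_ : (fun x => _) = (fun x => x 0 j * ('D_(delta_mx 0 i) Y x) 0 i -
      x 0 i * ('D_(delta_mx 0 j) Y x) 0 i)).
    have [_ cD] := smooth_coord i sY.
    by apply: continuousB_fun; exact: continuousM_fun.
  apply/funext => x; rewrite (deriveE _ (sY [::] x)) linearB !linearZ /=.
  by rewrite -!deriveE ?mxE//; exact: (sY [::] x).
by apply: continuousD_fun; exact: continuousM_fun.
Qed.

Let dKE i j x : usphere x ->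
  differentiable (K i j) x /\ 'D_(rotfield i j x) (K i j) x = K' i j x.
Proof.
move=> Sx; have := dh (dotv_itv SPhi Sx) => dhx.
have [d1 e1] := derive_zonal (rotfield i j x) dhx.
have dj := differentiable_coord x 0 j.
have [/(_ x) dYi _] := smooth_coord i sY.
have dq : differentiable ((fun y : 'rV[R]_n => y 0 j) * (fun y => Y y 0 i)) x by exact: differentiableM.
have KE : K i j = (h \o dotv Phi) * ((fun y : 'rV[R]_n => y 0 j) * (fun y => Y y 0 i)) by [].
split; first by rewrite KE; exact: differentiableM.
rewrite KE deriveM; [|exact: diff_derivable|exact: diff_derivable].
rewrite deriveM; [|exact: diff_derivable|exact: diff_derivable].
rewrite e1 derive_coord; last exact: (sY [::] x).
have -> : 'D_(rotfield i j x) (fun y : 'rV[R]_n => y 0 j) x = rotfield i j x 0 j.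
  rewrite (_ : (fun y => _) = dotv (delta_mx 0 j)); last by apply/funext => z; rewrite dotv_deltal.
  by rewrite derive_dotv dotv_deltal.
rewrite /K' /P /Q /GRing.scale /= -[(_ * _ : 'rV[R]_n -> R) x]/(x 0 j * Y x 0 i).
ring.
Qed.


Let boundedK (i j : 'I_n) (f : 'rV[R]_n -> R) (k : R -> R) :
  (forall c : R, -1 <= c <= 1 -> {for c, continuous k}) -> continuous f ->
  exists M : R, forall x, usphere x -> `|k (dotv Phi x) * f x| <= M.
Proof.
move=> /bounded_itv[M1 M10 h1] /continuous_usphere_bounded[M2 M20 h2].
exists (M1 * M2) => x Sx; rewrite normrM ler_pM// ?h2// h1//.
exact: dotv_itv.
Qed.

Let continuous_zonal_orbit i j x (k : R -> R) : i != j -> usphere x ->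
  (forall c : R, -1 <= c <= 1 -> {for c, continuous k}) ->
  continuous (fun t : R => k (dotv Phi (plane_rot i j t x))).
Proof.
move=> ij Sx ck t.
have ct : {for t, continuous (fun t : R => dotv Phi (plane_rot i j t x))}.
  exact: (@continuous_comp _ _ _ (fun t : R => plane_rot i j t x) (dotv Phi) t
    (@continuous_plane_rot R n i j x t) (@continuous_dotv Phi _)).
apply: (@continuous_comp _ _ _ (fun t : R => dotv Phi (plane_rot i j t x)) k t ct); apply: ck.
by apply: dotv_itv => //; exact/usphere_rot.
Qed.

Let continuous_orbit_fun i j x f : continuous f -> continuous (fun t : R => f (plane_rot i j t x)).
Proof. move=> cf t; exact: (@continuous_comp _ _ _ (fun t : R => plane_rot i j t x) f t
  (@continuous_plane_rot R n i j x t) (cf _)).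
 Qed.

Variables (u : 'rV[R]_n -> R) (Psi : 'rV[R]_n -> 'rV[R]_n) (beta beta' : R -> R).
Hypotheses (iu : sigma.-integrable setT (EFin \o u)) (uPsi : is_surface_grad u Psi).
Hypotheses (dbeta : forall t, is_derive t (1 : R) beta (beta' t)) (cbeta' : continuous beta').
Hypothesis ib : sigma.-integrable setT (EFin \o (fun x => beta (u x))).
Hypothesis ib' : forall k, sigma.-integrable setT (EFin \o (fun x => beta' (u x) * Psi x 0 k)).

Let iP k := is_surface_grad_integrable k uPsi.

Let mdotv : measurable_fun setT (dotv Phi : 'rV[R]_n -> R).
Proof. by apply: continuous_measurable_rV; exact: continuous_dotv. Qed.

Let rotE i j x : dotv (Psi x) (rotfield i j x) = Psi x 0 i * x 0 j - Psi x 0 j * x 0 i.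
Proof. by rewrite dotv_rotfield; ring. Qed.

Let integrable_coordM (f : 'rV[R]_n -> R) k : sigma.-integrable setT (EFin \o f) ->
  sigma.-integrable setT (EFin \o (fun x => f x * x 0 k)).
Proof.
move=> fi; have [M _ hM] := continuous_usphere_bounded (cc (k := k)).
by apply: (integrableM_bounded fi _ hM); exact: measurable_coord.
Qed.

Let ig i j : sigma.-integrable setT (EFin \o (fun x => dotv (Psi x) (rotfield i j x))).
Proof.
rewrite (_ : (fun x => _) = (fun x => Psi x 0 i * x 0 j - Psi x 0 j * x 0 i)).
  by apply: RintegrableB; exact: integrable_coordM.
by apply/funext => x; exact: rotE.
Qed.

Let ib'g i j : sigma.-integrable setT (EFin \o (fun x => beta' (u x) * dotv (Psi x) (rotfield i j x))).
Proof.
rewrite (_ : (fun x => _) = (fun x => beta' (u x) * Psi x 0 i * x 0 j - beta' (u x) * Psi x 0 j * x 0 i)).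
  by apply: RintegrableB; exact: integrable_coordM.
by apply/funext => x; rewrite rotE; ring.
Qed.

Let mK i j : measurable_fun setT (K i j).
Proof.
apply: measurable_funM; first exact: (measurableT_comp mh).
exact: continuous_measurable_rV.
Qed.

Let mK' i j : measurable_fun setT (K' i j).
Proof.
apply: measurable_funD; apply: measurable_funM; try exact: continuous_measurable_rV.
- exact: (measurableT_comp mh').
- exact: (measurableT_comp mh).
Qed.

Let bK i j : exists M : R, forall x, usphere x -> `|K i j x| <= M.
Proof. exact: boundedK. Qed.

Let bK' i j : exists M : R, forall x, usphere x -> `|K' i j x| <= M.
Proof.
have [M1 h1] := boundedK i j ch' (cP (i := i) (j := j)).
have [M2 h2] := boundedK i j ch (cQ (i := i) (j := j)).
exists (M1 + M2) => x Sx; rewrite (le_trans (ler_normD _ _))// lerD//; [exact: h1|exact: h2].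
Qed.

Let F i j x := beta' (u x) * dotv (Psi x) (rotfield i j x) * K i j x + beta (u x) * K' i j x.

Let iF i j : sigma.-integrable setT (EFin \o F i j).
Proof.
have [M1 h1] := bK i j; have [M2 h2] := bK' i j.
apply: RintegrableD; first exact: (integrableM_bounded (ib'g i j) (mK i j) h1).
exact: (integrableM_bounded ib (mK' i j) h2).
Qed.

Let F0 i j : \int[sigma]_x F i j x = 0.
Proof.
(* The double sum includes the diagonal, where X_ii = 0 and [plane_rot] is not a rotation. *)
have [<-|ij] := eqVneq i j.
  rewrite (_ : F i i = cst 0); first by rewrite Rintegral_cst// mul0r.
  apply/funext => x.
  have X0 : rotfield i i x = 0 by rewrite /rotfield subrr.
  rewrite /F /K' /P /Q X0 deriveE; last exact: (sY [::] x).
  have d0 v : dotv v 0 = 0 by rewrite /dotv big1// => k _; rewrite mxE mulr0.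
  by rewrite linear0 !d0 !mxE [RHS]/=; ring.
have [M1 h1] := bK i j; have [M2 h2] := bK' i j.
apply: (@Rintegral_orbit_parts _ _ _ _ ij u _ iu (ig i j) _ beta beta' dbeta cbeta'
  (K i j) (K' i j) (Num.max M1 M2)) => //.
- move=> s s01.
  apply: (@orbit_prim _ _ i j ij u (fun x => dotv (Psi x) (rotfield i j x)) s s01 iu (ig i j)).
  by move=> f pf; exact: surface_grad_rotfield.
- by move=> x Sx; rewrite le_max h1.
- by move=> x Sx; rewrite le_max h2 ?orbT.
- move=> x Sx t; have Sr : usphere (plane_rot i j t x) by exact/usphere_rot.
  have [dKx <-] := dKE i j Sr.
  exact: is_derive_orbit.
- move=> x Sx; apply: continuousD_fun; apply: continuousM_fun.
  + exact: continuous_zonal_orbit.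
  + by apply: (@continuous_orbit_fun i j x (P i j)).
  + exact: continuous_zonal_orbit.
  + by apply: (@continuous_orbit_fun i j x (Q i j)).
Qed.

(** The divergence theorem for the field beta(u) h Y with u merely Sobolev: the identities [F0] are
    summed over all pairs (i, j), and [sum_rotfield] and [sum_derive_rotfield] recombine the sum. *)
Lemma zonal_parts :
  \int[sigma]_x (beta' (u x) * (h (dotv Phi x) * dotv (Psi x) (Y x)) +
    beta (u x) * (h' (dotv Phi x) * dotv Phi (Y x) + h (dotv Phi x) * surface_div Y x)) = 0.
Proof.
have iS : sigma.-integrable setT (EFin \o (fun x => \sum_i \sum_j F i j x)).
  by apply: Rintegrable_sum => i; exact: Rintegrable_sum.
transitivity (\int[sigma]_x (\sum_i \sum_j F i j x)).
  apply: ae_eq_Rintegral; last 2 first.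
  - exact: integrable_Rmeasurable iS.
  - apply: filterS ae_usphere => x Sx.
    have Yx := proj2 tY x Sx.
    rewrite -(sum_rotfield (Psi x) Sx Yx) -(sum_rotfield Phi Sx Yx).
    rewrite -(sum_derive_rotfield (sY [::] x) Sx Yx).
    rewrite !mulr_sumr -big_split mulr_sumr -big_split /=; apply: eq_bigr => i _.
    rewrite !mulr_sumr -big_split mulr_sumr -big_split /=; apply: eq_bigr => j _.
    by rewrite /F /K /K' /P /Q; ring.
  have mu := integrable_Rmeasurable iu.
  have mY k : measurable_fun setT (fun x => Y x 0 k) by exact: smooth_measurable.
  have mhd := measurableT_comp mh mdotv. have mhd' := measurableT_comp mh' mdotv.
  have mb : measurable_fun setT (fun x => beta (u x)) := integrable_Rmeasurable ib.
  have mb' : measurable_fun setT (fun x => beta' (u x)).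
    by apply: (measurableT_comp _ mu); exact: continuous_measurable_fun.
  apply: measurable_funD; apply: measurable_funM => //.
    apply: measurable_funM => //; apply: measurable_sum => k.
    by apply: measurable_funM => //; exact: integrable_Rmeasurable (iP k).
  apply: measurable_funD; apply: measurable_funM => //.
    by apply: measurable_sum => k; apply: measurable_funM.
  by apply: continuous_measurable_rV; exact: continuous_surface_div.
rewrite Rintegral_sum; last by move=> i; exact: Rintegrable_sum.
rewrite big1// => i _; rewrite Rintegral_sum//.
by rewrite big1// => j _; exact: F0.
Qed.

End zonal_parts.

(** * Powers of the absolute value *)

Section norm_powers.
Context {R : realType}.
Implicit Types (t a p c : R) (f : R -> R).

Lemma is_derive_powR a t : 0 < t -> is_derive t (1 : R) (fun r : R => r `^ a) (a * t `^ (a - 1)).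
Proof.
move=> t0; have tin : t \in `]0, +oo[ by rewrite in_itv/= t0.
split; first exact: derivable_powR.
by rewrite -derive1E powR_derive1.
Qed.

Lemma is_derive_oppC f t df : is_derive (- t) (1 : R) f df ->
  is_derive t (1 : R) (fun r : R => f (- r)) (- df).
Proof.
move=> d; have := @is_derive1_comp _ f -%R t _ _ d (is_deriveN (is_derive_id t 1)).
by rewrite mulrN1.
Qed.

Lemma cvg_norm_powR0 a : 0 < a -> `|t| `^ a @[t --> (0 : R)] --> (0 : R).
Proof.
move=> a0; apply/cvgrPdist_le => e e0; near=> t.
rewrite sub0r normrN ger0_norm ?powR_ge0//.
have -> : e = (e `^ a^-1) `^ a by rewrite -powRrM mulVf ?gt_eqF// powRr1// ltW.
rewrite ge0_ler_powR// ?nnegrE ?powR_ge0//; first exact: ltW.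
apply: ltW; near: t; have := @nbhs0_lt R R (e `^ a^-1).
by apply; exact: powR_gt0.
Unshelve. all: by end_near. Qed.

(** Derivatives of powers are available only away from 0; at 0 the difference quotient is at most
    |t|^a. Both derivative lemmas below use this. *)
Lemma is_derive0_le_powR f a : 0 < a -> (forall t, `|f t| <= `|t| `^ a * `|t|) ->
  is_derive (0 : R) (1 : R) f 0.
Proof.
move=> a0 fle; have f0 : f 0 = 0.
  by apply/eqP; rewrite -normr_le0 (le_trans (fle 0))// normr0 mulr0.
have lim : h^-1 *: ((f \o shift 0) (h *: (1 : R)) - f 0) @[h --> 0^'] --> (0 : R).
  apply/cvgr0Pnorm_le => e e0; near=> h.
  have h0 : h != 0 by near: h; exact: nbhs_dnbhs_neq.
  rewrite /= f0 subr0 addr0 /GRing.scale/= mulr1 normrM normfV.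
  rewrite ler_pdivrMl ?normr_gt0// (le_trans (fle h))// mulrC ler_wpM2l//.
  near: h; apply: nbhs_dnbhs.
  have /cvgr0Pnorm_le/(_ e e0) := cvg_norm_powR0 a0.
  by apply: filterS => t; rewrite ger0_norm ?powR_ge0.
split; first by apply/cvg_ex; exists 0.
exact: cvg_lim lim.
Unshelve. all: by end_near. Qed.

(** The sign is carried by the factor t. At t = 0 with p < 2 the power is a default value, which
    this factor cancels. Negative t reduces to positive t by parity. *)
Lemma is_derive_norm_powR p t : 1 < p ->
  is_derive t (1 : R) (fun r : R => `|r| `^ p) (p * (`|t| `^ (p - 2) * t)).
Proof.
move=> p1.
have pos (s : R) : 0 < s -> is_derive s (1 : R) (fun r : R => `|r| `^ p) (p * (`|s| `^ (p - 2) * s)).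
  move=> s0; apply: (@near_eq_is_derive _ _ _ (fun r => r `^ p)).
    by near=> r; rewrite ger0_norm// ltW//; near: r; exact: lt_nbhsr.
  have := is_derive_powR p s0.
  suff -> : s `^ (p - 1) = `|s| `^ (p - 2) * s by [].
  rewrite gtr0_norm// -[X in _ * X]powRr1 ?ltW// -powRD; first by congr powR; ring.
  by rewrite (gt_eqF s0) implybT.
have [t0|t0|<-] := ltgtP 0 t.
- exact: pos.
- have := is_derive_oppC (pos (- t) _); rewrite oppr_gt0 => /(_ t0).
  rewrite normrN !mulrN opprK.
  by congr is_derive; apply/funext => r; rewrite normrN.
- rewrite !mulr0; apply: (@is_derive0_le_powR _ (p - 1)); first by rewrite subr_gt0.
  by move=> s; rewrite ger0_norm ?powR_ge0// mulrC mulr_powRB1// (lt_trans ltr01).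
Unshelve. all: by end_near. Qed.

Lemma is_derive_norm_powRM a t : 0 <= a ->
  is_derive t (1 : R) (fun r : R => `|r| `^ a * r) ((a + 1) * `|t| `^ a).
Proof.
rewrite le_eqVlt => /predU1P[<-|a0].
  rewrite powRr0 add0r mulr1 (_ : (fun _ => _) = id); first exact: is_derive_id.
  by apply/funext => r; rewrite powRr0 mul1r.
have a1 : 0 < a + 1 by rewrite addr_gt0.
have powa (s : R) : 0 < s -> s `^ (a + 1) = `|s| `^ a * s.
  by move=> s0; rewrite -(mulr_powRB1 (ltW s0) a1) addrK mulrC gtr0_norm.
have pos (s : R) : 0 < s -> is_derive s (1 : R) (fun r : R => `|r| `^ a * r) ((a + 1) * `|s| `^ a).
  move=> s0; apply: (@near_eq_is_derive _ _ _ (fun r => r `^ (a + 1))).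
    by near=> r; rewrite powa//; near: r; exact: lt_nbhsr.
  by have := is_derive_powR (a + 1) s0; rewrite addrK gtr0_norm.
have [t0|t0|<-] := ltgtP 0 t.
- exact: pos.
- have := is_derive_oppC (pos (- t) _); rewrite oppr_gt0 => /(_ t0) d.
  have := is_deriveN d; rewrite opprK normrN.
  by congr is_derive; apply/funext => r; rewrite /GRing.opp/= normrN mulrN opprK.
- rewrite normr0 powR0 ?gt_eqF// mulr0; apply: (is_derive0_le_powR a0) => s.
  by rewrite normrM ger0_norm ?powR_ge0.
Unshelve. all: by end_near. Qed.

Lemma continuous_norm_powR a : 0 <= a -> continuous (fun t => `|t| `^ a).
Proof.
rewrite le_eqVlt => /predU1P[<-|a0] t.
  rewrite (_ : (fun _ => _) = cst 1); first exact: cst_continuous.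
  by apply/funext => r; rewrite powRr0.
have [->|t0] := eqVneq t 0.
  by rewrite /continuous_at normr0 powR0 ?gt_eqF//; exact: cvg_norm_powR0.
have n0 : 0 < `|t| by rewrite normr_gt0.
apply: (@continuous_comp _ _ _ (fun r : R => `|r|) (fun r => r `^ a) t (@norm_continuous R R t)).
have := is_derive_powR a n0 => d.
by apply/differentiable_continuous/derivable1_diffP; exact: ex_derive.
Qed.

(** For p < 2 the power alone blows up at 0, but the absolute value of the product is p |t|^(p -
    1). *)
Lemma continuous_norm_powRM p : 1 < p -> continuous (fun t => p * (`|t| `^ (p - 2) * t)).
Proof.
move=> p1 t; have [->|t0] := eqVneq t 0.
  have p0 : 0 < p by rewrite (lt_trans ltr01).
  rewrite /continuous_at !mulr0; apply/cvgr0Pnorm_le => e e0.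
  have ep : 0 < p^-1 * e by rewrite mulr_gt0 ?invr_gt0.
  near=> s.
  have -> : `|p * (`|s| `^ (p - 2) * s)| = p * `|s| `^ (p - 1).
    rewrite normrM gtr0_norm// normrM ger0_norm ?powR_ge0//; congr (_ * _).
    have [->|s0] := eqVneq s 0; first by rewrite normr0 mulr0 powR0// gt_eqF// subr_gt0.
    rewrite -[X in _ * X]powRr1// -powRD; first by congr powR; ring.
    by rewrite normr_eq0 s0 implybT.
  rewrite -ler_pdivlMl//; near: s.
  have p10 : 0 < p - 1 by rewrite subr_gt0.
  have /cvgr0Pnorm_le/(_ _ ep) := cvg_norm_powR0 p10.
  by apply: filterS => s; rewrite ger0_norm ?powR_ge0.
have n0 : 0 < `|t| by rewrite normr_gt0.
have c1 : {for t, continuous (fun r : R => `|r| `^ (p - 2))}.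
  apply: (@continuous_comp _ _ _ (fun r : R => `|r|) (fun r => r `^ (p - 2)) t (@norm_continuous R R t)).
  have := is_derive_powR (p - 2) n0 => d.
  by apply/differentiable_continuous/derivable1_diffP; exact: ex_derive.
by apply: cvgM; [exact: cvg_cst|apply: cvgM => //; exact: c1].
Unshelve. all: by end_near. Qed.

End norm_powers.

(** * The gradient of the height function x -> Phi . x *)

Section zonal_field.
Context {R : realType} {n : nat}.
Implicit Types (x w v : 'rV[R]_n).
Local Notation sigma := (@surface_measure R n).
Variable Phi : 'rV[R]_n.
Hypothesis SPhi : usphere Phi.

(** On the sphere this is the projection of Phi on the tangent space, that is, the surface gradient
    of cos d; its length is sin d. *)
Definition zonal_field x : 'rV[R]_n := Phi - dotv Phi x *: x.

Lemma dotv_zonal_field v x : dotv v (zonal_field x) = dotv v Phi - dotv Phi x * dotv v x.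
Proof. by rewrite dotvBr dotvZr. Qed.

Lemma zonal_field_tangent : smooth_tangent zonal_field.
Proof.
split; last first.
  by move=> x /uspherevv x1; rewrite dotvC dotv_zonal_field x1 mulr1 dotvC subrr.
rewrite (_ : zonal_field = fun x => \row_i (Phi 0 i - dotv Phi x * x 0 i)).
  apply: smooth_row_polyfun => i; apply: polyfunB; first exact: polyfun_cst.
  by apply: polyfunM; [exact: polyfun_dotv|exact: polyfun_coord].
by apply/funext => x; apply/rowP => i; rewrite !mxE.
Qed.

Lemma dotv_Phi_zonal_field x : dotv Phi (zonal_field x) = 1 - dotv Phi x ^+ 2.
Proof. by rewrite dotv_zonal_field (uspherevv _).1// expr2. Qed.

Lemma enorm_zonal_field x : usphere x -> enorm (zonal_field x) = Num.sqrt (1 - dotv Phi x ^+ 2).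
Proof.
move=> /uspherevv x1; rewrite /enorm; congr Num.sqrt.
rewrite dotv_zonal_field dotvC dotv_Phi_zonal_field.
suff -> : dotv (zonal_field x) x = 0 by rewrite mulr0 subr0.
by rewrite dotvC dotv_zonal_field x1 mulr1 dotvC subrr.
Qed.

(** The eigenvalue equation of the Laplace-Beltrami operator for the first spherical harmonic Phi .
    x. The factor n - 1 is the source of the n in [alpha]. *)
Lemma surface_div_zonal_field x : usphere x ->
  surface_div zonal_field x = - ((n%:R - 1) * dotv Phi x).
Proof.
move=> /uspherevv x1; have [sV _] := zonal_field_tangent.
have dV := sV [::] x.
have D (i j : 'I_n) : ('D_(delta_mx 0 j) zonal_field x) 0 i =
    - (Phi 0 j * x 0 i + dotv Phi x * (delta_mx 0 j : 'rV[R]_n) 0 i).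
  rewrite -derive_coord// (_ : (fun y => _) = cst (Phi 0 i) - dotv Phi * (dotv (delta_mx 0 i))); last first.
    by apply/funext => y; rewrite !mxE -[RHS]/(Phi 0 i - dotv Phi y * dotv (delta_mx 0 i) y) dotv_deltal.
  have d1 := differentiable_dotv Phi x; have d2 := differentiable_dotv (delta_mx 0 i) x.
  rewrite deriveB; [|exact: derivable_cst|by apply: derivableM; exact: diff_derivable].
  rewrite deriveM; [|exact: diff_derivable|exact: diff_derivable].
  rewrite derive_cst !derive_dotv /GRing.scale/= !dotv_deltar dotv_deltal sub0r.
  by rewrite !mxE eqxx /= [j == i]eq_sym; ring.
rewrite surface_divE//.
under eq_bigr do rewrite D.
under [X in _ - X]eq_bigr => i _.
  under eq_bigr do rewrite D.
  over.
rewrite sumrN big_split/= -[X in - (X + _)]/(dotv Phi x) -mulr_sumr.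
have -> : \sum_i (delta_mx 0 i : 'rV[R]_n) 0 i = n%:R.
  by under eq_bigr do rewrite mxE !eqxx; rewrite sumr_const card_ord.
have -> : \sum_(i < n) \sum_(j < n)
    x 0 i * (x 0 j * - (Phi 0 j * x 0 i + dotv Phi x * (delta_mx 0 j : 'rV[R]_n) 0 i)) =
    - (dotv Phi x + dotv Phi x).
  transitivity (- \sum_i (x 0 i * x 0 i * dotv Phi x + dotv Phi x * (x 0 i * x 0 i))).
    rewrite -sumrN; apply: eq_bigr => i _.
    transitivity (- (x 0 i * x 0 i * (\sum_j Phi 0 j * x 0 j) +
        dotv Phi x * x 0 i * (\sum_j x 0 j * (delta_mx 0 i : 'rV[R]_n) 0 j))).
      rewrite !mulr_sumr -big_split/= -sumrN; apply: eq_bigr => j _.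
      by rewrite !mxE !eqxx/= [j == i]eq_sym; ring.
    by rewrite -[\sum_j Phi 0 j * _]/(dotv Phi x) -[X in _ * _ * X + _]/(dotv _ _)
      -[\sum_j x 0 j * _]/(dotv x (delta_mx 0 i)) dotv_deltar; ring.
  by rewrite big_split/= -mulr_suml -mulr_sumr -[\sum_i _]/(dotv x x) x1 mul1r mulr1.
by ring.
Qed.

End zonal_field.

Section zonal_identity.
Context {R : realType} {n : nat}.
Implicit Types (x w v : 'rV[R]_n).
Local Notation sigma := (@surface_measure R n).
Variable Phi : 'rV[R]_n.
Hypothesis SPhi : usphere Phi.

(** A crude form of Young's inequality, obtained by comparing a and b; it serves integrability only,
    where constants do not matter. *)
Lemma powR_mul_le_add (p a b : R) : 1 < p -> 0 <= a -> 0 <= b -> a `^ (p - 1) * b <= a `^ p + b `^ p.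
Proof.
move=> p1 a0 b0; have p0 : 0 < p by rewrite (lt_trans ltr01).
have [ba|ab] := leP b a.
  rewrite (le_trans (y := a `^ p)) ?lerDl ?powR_ge0//.
  by rewrite -(mulr_powRB1 a0 p0) mulrC ler_wpM2r ?powR_ge0.
rewrite (le_trans (y := b `^ p)) ?lerDr ?powR_ge0//.
rewrite -(mulr_powRB1 b0 p0) mulrC ler_wpM2l// ge0_ler_powR ?nnegrE ?subr_ge0 ?(ltW p1)//.
exact: ltW.
Qed.

Lemma norm_powRM (p t : R) : 1 < p -> `| `|t| `^ (p - 2) * t| = `|t| `^ (p - 1).
Proof.
move=> p1; rewrite normrM ger0_norm ?powR_ge0//.
have [->|t0] := eqVneq t 0; first by rewrite normr0 mulr0 powR0// gt_eqF// subr_gt0.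
rewrite -[X in _ * X]powRr1// -powRD; first by congr powR; ring.
by rewrite normr_eq0 t0 implybT.
Qed.

Variables (p : R) (u : 'rV[R]_n -> R) (Psi : 'rV[R]_n -> 'rV[R]_n).
Hypotheses (p1 : 1 < p) (iu : sigma.-integrable setT (EFin \o u)).
Hypotheses (iup : sigma.-integrable setT (EFin \o (fun x => `|u x| `^ p)))
           (uPsi : is_surface_grad u Psi)
           (iPsip : sigma.-integrable setT (EFin \o (fun x => enorm (Psi x) `^ p))).

Let iP k := is_surface_grad_integrable k uPsi.

Let ib' k : sigma.-integrable setT
  (EFin \o (fun x => p * (`|u x| `^ (p - 2) * u x) * Psi x 0 k)).
Proof.
have mu := integrable_Rmeasurable iu; have mP := integrable_Rmeasurable (iP k).
apply: (@le_integrable_ae _ _ _ sigma _ (fun x => p * (`|u x| `^ p + enorm (Psi x) `^ p))).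
- apply: measurable_funM => //; apply: measurable_funM => //; apply: measurable_funM => //.
  by apply: (measurableT_comp (measurable_powR _)); exact: measurableT_comp.
- by apply: RintegrableZ; exact: RintegrableD.
apply: aeW => x; have p0 : 0 < p by rewrite (lt_trans ltr01).
rewrite -mulrA normrM gtr0_norm// ler_wpM2l ?(ltW p0)// normrM norm_powRM//.
rewrite (le_trans _ (powR_mul_le_add p1 (normr_ge0 (u x)) (enorm_ge0 (Psi x))))//.
by rewrite ler_wpM2l ?powR_ge0// normr_coord.
Qed.

(** Both Hardy inequalities and the moment identities of the test profiles come from this identity;
    they differ by the weight h along the zonal field. *)
Lemma zonal_parts_powR (h h' : R -> R) : measurable_fun setT h -> measurable_fun setT h' ->
  (forall c : R, -1 <= c <= 1 -> is_derive c (1 : R) h (h' c)) ->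
  (forall c : R, -1 <= c <= 1 -> {for c, continuous h'}) ->
  let I x := p * (`|u x| `^ (p - 2) * u x) * (h (dotv Phi x) * dotv (Psi x) (zonal_field Phi x)) +
    `|u x| `^ p * (h' (dotv Phi x) * (1 - dotv Phi x ^+ 2) - (n%:R - 1) * dotv Phi x * h (dotv Phi x)) in
  sigma.-integrable setT (EFin \o I) /\ \int[sigma]_x I x = 0.
Proof.
move=> mh mh' dh ch' I.
have tY := zonal_field_tangent Phi; have [sY _] := tY.
have ch (c : R) : -1 <= c <= 1 -> {for c, continuous h}.
  by move=> /dh dhc; apply/differentiable_continuous/derivable1_diffP; exact: ex_derive.
have mdotv : measurable_fun setT (dotv Phi : 'rV[R]_n -> R).
  by apply: continuous_measurable_rV; exact: continuous_dotv.
have mhd := measurableT_comp mh mdotv; have mhd' := measurableT_comp mh' mdotv.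
have iI : sigma.-integrable setT (EFin \o I).
  apply: RintegrableD.
    rewrite (_ : (fun x => _) = fun x => \sum_k (p * (`|u x| `^ (p - 2) * u x) * Psi x 0 k) *
       (h (dotv Phi x) * zonal_field Phi x 0 k)).
      apply: Rintegrable_sum => k.
      have [M1 _ h1] := bounded_itv ch; have [M2 h2] := smooth_bounded k sY.
      apply: (@integrableM_bounded _ _ _ _ (M1 * M2) (ib' k)).
        by apply: measurable_funM => //; exact: smooth_measurable.
      by move=> x Sx; rewrite normrM ler_pM// ?h2// h1//; exact: dotv_itv.
    by apply/funext => x; rewrite /dotv !mulr_sumr; apply: eq_bigr => k _; ring.
  pose g c := h' c * (1 - c ^+ 2) - (n%:R - 1) * c * h c.
  have [|M _ hM] := @bounded_itv _ g.
    move=> c c1; have cid : {for c, continuous (@id R)} by [].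
    have c2 : {for c, continuous (fun c : R => 1 - c ^+ 2)}.
      by apply: cvgB; [exact: cvg_cst|exact: cvgM].
    apply: cvgB; first by apply: cvgM; [exact: ch'|exact: c2].
    by apply: cvgM; [apply: cvgM; [exact: cvg_cst|exact: cid]|exact: ch].
  apply: (@integrableM_bounded _ _ _ (g \o dotv Phi) M iup).
    apply: (measurableT_comp _ mdotv); apply: measurable_funB; apply: measurable_funM => //.
    by apply: measurable_funB => //; exact: measurable_funX.
  by move=> x Sx; apply: hM; exact: dotv_itv.
split=> //.
have := @zonal_parts R n Phi h h' (zonal_field Phi) SPhi mh mh' dh ch' tY u Psi
  (fun t => `|t| `^ p) (fun t => p * (`|t| `^ (p - 2) * t)) iu uPsi
  (fun t => is_derive_norm_powR t p1) (continuous_norm_powRM p1) iup ib'.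
move=> E; rewrite -[RHS]E; apply: ae_eq_Rintegral.
- exact: integrable_Rmeasurable iI.
- have mu := integrable_Rmeasurable iu.
  have mY k : measurable_fun setT (fun x => zonal_field Phi x 0 k) by exact: smooth_measurable.
  apply: measurable_funD; apply: measurable_funM; first last.
  + apply: measurable_funD; apply: measurable_funM => //.
      by apply: measurable_sum => k; apply: measurable_funM.
    by apply: continuous_measurable_rV; exact: continuous_surface_div.
  + exact: integrable_Rmeasurable iup.
  + apply: measurable_funM => //; apply: measurable_sum => k.
    by apply: measurable_funM => //; exact: integrable_Rmeasurable (iP k).
  + apply: measurable_funM => //; apply: measurable_funM => //.
    by apply: (measurableT_comp (measurable_powR _)); exact: measurableT_comp.
- apply: filterS ae_usphere => x Sx; rewrite /I dotv_Phi_zonal_field// surface_div_zonal_field//.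
  by congr (_ + _); congr (_ * _); ring.
Qed.

End zonal_identity.

(** * Hardy inequalities *)

Section weights.
Context {R : realType}.
Implicit Types (a b c p eps : R).

(** Young's inequality for t a^(p - 1) and b / t with exponents q = p / (p - 1) and p. The choice t
    = al^((p - 1) / p) gives t^q = al and t^(-p) = al^(1 - p). *)
Lemma Young_powR p al a b : 1 < p -> 0 < al -> 0 <= a -> 0 <= b ->
  p * (a `^ (p - 1) * b) <= (p - 1) * al * a `^ p + al `^ (1 - p) * b `^ p.
Proof.
move=> p1 al0 a0 b0; have p0 : 0 < p by rewrite (lt_trans ltr01).
have p10 : 0 < p - 1 by rewrite subr_gt0.
pose q := p / (p - 1); have q0 : 0 < q by rewrite divr_gt0.
pose t := al `^ ((p - 1) / p); have t0 : 0 < t by rewrite powR_gt0.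
have pq : q^-1 + p^-1 = 1 by rewrite /q; field; rewrite !gt_eqF.
have h1 : 0 <= t * a `^ (p - 1) by rewrite mulr_ge0 ?powR_ge0// ltW.
have h2 : 0 <= t^-1 * b by rewrite mulr_ge0 ?invr_ge0// ltW.
have := conjugate_powR h1 h2 q0 p0 pq.
have -> : t * a `^ (p - 1) * (t^-1 * b) = a `^ (p - 1) * b by field; rewrite gt_eqF.
rewrite -(ler_pM2l p0); move/le_trans; apply.
rewrite !powRM ?powR_ge0 ?invr_ge0 ?(ltW t0)//.
have -> : t `^ q = al.
  rewrite -powRrM (_ : _ * q = 1); first by rewrite powRr1// ltW.
  by rewrite /q; field; rewrite !gt_eqF.
have -> : (t^-1) `^ p = al `^ (1 - p).
  rewrite -powR_inv1 ?(ltW t0)// -!powRrM; congr powR.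
  by field; rewrite gt_eqF.
have -> : (a `^ (p - 1)) `^ q = a `^ p.
  by rewrite -powRrM; congr powR; rewrite /q; field; rewrite gt_eqF.
by rewrite le_eqVlt; apply/orP; left; apply/eqP; rewrite /q; field; rewrite !gt_eqF.
Qed.

Definition reg_sin2 eps c : R := eps + (1 - c ^+ 2).

(** The minus sign makes the divergence of the weighted [zonal_field] positive near the poles when b
    < n - 1. *)
Definition zonal_weight a b eps c : R := - (`|c| `^ a * c * reg_sin2 eps c `^ (- (b / 2))).

Definition zonal_weight' a b eps c : R :=
  - ((a + 1) * `|c| `^ a * reg_sin2 eps c `^ (- (b / 2)) +
     `|c| `^ a * c * (b * c * reg_sin2 eps c `^ (- (b / 2) - 1))).

Lemma sqr_itv c : -1 <= c <= 1 -> 0 <= 1 - c ^+ 2 <= 1.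
Proof. by move=> /andP[c1 c2]; apply/andP; split; nra. Qed.

Lemma reg_sin2_gt0 eps c : 0 < eps -> -1 <= c <= 1 -> 0 < reg_sin2 eps c.
Proof. by move=> e0 /sqr_itv/andP[c0 _]; rewrite /reg_sin2 ltr_wpDr. Qed.

Lemma is_derive_reg_sin2 eps b c : 0 < eps -> -1 <= c <= 1 ->
  is_derive c (1 : R) (fun r => reg_sin2 eps r `^ (- (b / 2)))
    (b * c * reg_sin2 eps c `^ (- (b / 2) - 1)).
Proof.
move=> e0 c1; have d0 := reg_sin2_gt0 e0 c1.
have d1 : is_derive c (1 : R) (reg_sin2 eps) (- (2 * c)).
  have -> : reg_sin2 eps = cst (eps + 1) - (@id R) * (@id R).
    by apply/funext => r; rewrite /reg_sin2 expr2 addrA.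
  have [dd ee] := is_deriveB (is_derive_cst (eps + 1) c 1)
    (is_deriveM (is_derive_id c 1) (is_derive_id c (1 : R))).
  by split=> //; rewrite ee /GRing.scale/=; ring.
have := @is_derive1_comp _ (fun r => r `^ (- (b / 2))) (reg_sin2 eps) c _ _
  (is_derive_powR (- (b / 2)) d0) d1.
by congr is_derive; field.
Qed.

Lemma is_derive_zonal_weight a b eps c : 0 <= a -> 0 < eps -> -1 <= c <= 1 ->
  is_derive c (1 : R) (zonal_weight a b eps) (zonal_weight' a b eps c).
Proof.
move=> a0 e0 c1; have d1 := is_derive_reg_sin2 b e0 c1.
have d2 := is_derive_norm_powRM c a0.
have -> : zonal_weight a b eps = - ((fun r => `|r| `^ a * r) * (fun r => reg_sin2 eps r `^ (- (b / 2)))) by [].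
apply: is_derive_eq; rewrite /zonal_weight' /GRing.scale /=.
by congr (- _); ring.
Qed.

Lemma continuous_reg_sin2 eps b c : 0 < eps -> -1 <= c <= 1 ->
  {for c, continuous (fun r => reg_sin2 eps r `^ b)}.
Proof.
move=> e0 c1; have := is_derive_reg_sin2 (- (2 * b)) e0 c1.
rewrite (_ : - (- (2 * b) / 2) = b); last by field.
by move=> d; apply/differentiable_continuous/derivable1_diffP; exact: ex_derive.
Qed.

Lemma continuous_zonal_weight' a b eps c : 0 <= a -> 0 < eps -> -1 <= c <= 1 ->
  {for c, continuous (zonal_weight' a b eps)}.
Proof.
move=> a0 e0 c1; have cid : {for c, continuous (@id R)} by [].
have ca := continuous_norm_powR a0 (x := c).
have cD r := @continuous_reg_sin2 eps r c e0 c1.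
apply: cvgN; apply: cvgD.
  by apply: cvgM; [apply: cvgM; [exact: cvg_cst|exact: ca]|exact: cD].
apply: cvgM; first by apply: cvgM; [exact: ca|exact: cid].
by apply: cvgM; [apply: cvgM; [exact: cvg_cst|exact: cid]|exact: cD].
Qed.

Lemma measurable_reg_sin2 eps b : measurable_fun setT (fun c : R => reg_sin2 eps c `^ b).
Proof.
apply: (measurableT_comp (measurable_powR _)); apply: measurable_funD => //.
by apply: measurable_funB => //; exact: measurable_funX.
Qed.

Lemma measurable_norm_powR a : measurable_fun setT (fun c : R => `|c| `^ a).
Proof. by apply: (measurableT_comp (measurable_powR _)); exact: normr_measurable. Qed.

Lemma measurable_zonal_weight a b eps : measurable_fun setT (zonal_weight a b eps).
Proof.
apply: measurableT_comp => //; apply: measurable_funM; last exact: measurable_reg_sin2.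
by apply: measurable_funM => //; exact: measurable_norm_powR.
Qed.

Lemma measurable_zonal_weight' a b eps : measurable_fun setT (zonal_weight' a b eps).
Proof.
apply: measurableT_comp => //; apply: measurable_funD.
  apply: measurable_funM; last exact: measurable_reg_sin2.
  by apply: measurable_funM => //; exact: measurable_norm_powR.
apply: measurable_funM; first by apply: measurable_funM => //; exact: measurable_norm_powR.
by apply: measurable_funM; [exact: measurable_funM|exact: measurable_reg_sin2].
Qed.

(** For N = n - 1 and eps -> 0 the bracket tends to (n - 1 - b) c^2 - (a + 1) sin^2 d away from the
    poles. Before the limit the last quotient is at most 1, which is the right direction for a lower
    bound when b > 0. *)
Lemma zonal_weight_div a b eps c N : 0 < eps -> -1 <= c <= 1 ->
  zonal_weight' a b eps c * (1 - c ^+ 2) - N * c * zonal_weight a b eps c =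
  reg_sin2 eps c `^ (- (b / 2)) * `|c| `^ a *
    (N * c ^+ 2 - (a + 1) * (1 - c ^+ 2) - b * c ^+ 2 * ((1 - c ^+ 2) / reg_sin2 eps c)).
Proof.
move=> e0 c1; have d0 := reg_sin2_gt0 e0 c1.
have E : reg_sin2 eps c `^ (- (b / 2) - 1) = reg_sin2 eps c `^ (- (b / 2)) / reg_sin2 eps c.
  have := @powRB _ (reg_sin2 eps c) (- (b / 2)) 1.
  by rewrite (gt_eqF d0) implybT powRr1 ?(ltW d0)// => ->.
by rewrite /zonal_weight /zonal_weight' E; ring.
Qed.

End weights.

(** The function f is replaced by min(f, g), equal to it almost everywhere and below g
    everywhere. *)
Lemma le_Rintegral_ae d (T : measurableType d) (R : realType) (mu : {measure set T -> \bar R})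
    (f g : T -> R) : mu.-integrable setT (EFin \o f) -> mu.-integrable setT (EFin \o g) ->
  {ae mu, forall x, f x <= g x} -> \int[mu]_x f x <= \int[mu]_x g x.
Proof.
move=> fi gi fg; have mf := integrable_Rmeasurable fi; have mg := integrable_Rmeasurable gi.
have mm : measurable_fun setT (fun x => Num.min (f x) (g x)) by exact: measurable_minr.
have E : {ae mu, forall x, f x = Num.min (f x) (g x)}.
  by apply: filterS fg => x fgx; rewrite min_l.
rewrite (ae_eq_Rintegral mf mm E); apply: le_Rintegral => //.
  exact: (ae_eq_integrable mm E fi).
by move=> x _; rewrite ge_min lexx orbT.
Qed.

Lemma powR_le1 {R : realType} (x r : R) : 0 <= x <= 1 -> 0 <= r -> x `^ r <= 1.
Proof.
move=> /andP[x0 x1] r0; have := ge0_ler_powR r0 (y := 1) (x := x).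
by rewrite powR1; apply; rewrite ?nnegrE.
Qed.

Section regularized_hardy.
Context {R : realType} {n : nat}.
Implicit Types (x : 'rV[R]_n).
Local Notation sigma := (@surface_measure R n).
Variable Phi : 'rV[R]_n.
Hypothesis SPhi : usphere Phi.
Local Notation "'c_ x" := (dotv Phi x) (at level 8, x at level 2).

Lemma integrable_zonal (Z : 'rV[R]_n -> R) (f : R -> R) (M : R) :
  sigma.-integrable setT (EFin \o Z) -> measurable_fun setT f ->
  (forall c : R, -1 <= c <= 1 -> `|f c| <= M) ->
  sigma.-integrable setT (EFin \o (fun x => Z x * f 'c_x)).
Proof.
move=> iZ mf fM; apply: (@integrableM_bounded _ _ _ (f \o dotv Phi) M iZ).
  apply: (measurableT_comp mf).
  by apply: continuous_measurable_rV; exact: continuous_dotv.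
by move=> x Sx; apply: fM; exact: dotv_itv.
Qed.

Variables (p : R) (u : 'rV[R]_n -> R) (Psi : 'rV[R]_n -> 'rV[R]_n).
Hypotheses (p1 : 1 < p) (iu : sigma.-integrable setT (EFin \o u)).
Hypotheses (iup : sigma.-integrable setT (EFin \o (fun x => `|u x| `^ p)))
           (uPsi : is_surface_grad u Psi)
           (iPsip : sigma.-integrable setT (EFin \o (fun x => enorm (Psi x) `^ p))).
Variable al : R.
Hypotheses (al0 : 0 < al) (alE : p * al = n%:R - 1 - p).

(** The power |c|^(a + 1) of the cross term is split as m^(p - 1) l before Young's inequality: m
    goes with U, l with the gradient. Taking m = 1, l = |c| leads to S and G, and m = |c|, l = 1 to
    T and F. *)
Lemma regularized_hardy_pointwise (a eps c U V G m l : R) : 0 <= a -> 0 < eps -> -1 <= c <= 1 ->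
  0 <= m -> 0 <= l -> m `^ (p - 1) * l = `|c| `^ (a + 1) -> 0 <= V ->
  `|G| <= V * Num.sqrt (1 - c ^+ 2) ->
  `|U| `^ p * (reg_sin2 eps c `^ (- (p / 2)) * (`|c| `^ a * (p * al * c ^+ 2 - (a + 1) * (1 - c ^+ 2))
     - (p - 1) * al * m `^ p)) - al `^ (1 - p) * (V `^ p * l `^ p) <=
  p * (`|U| `^ (p - 2) * U) * (zonal_weight a p eps c * G) +
  `|U| `^ p * (zonal_weight' a p eps c * (1 - c ^+ 2) - (n%:R - 1) * c * zonal_weight a p eps c).
Proof.
move=> a0 e0 c1 m0 l0 ml V0 GV; have p0 : 0 < p by rewrite (lt_trans ltr01).
have d0 := reg_sin2_gt0 e0 c1; have /andP[w0 w1] := sqr_itv c1.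
rewrite zonal_weight_div//; set D := reg_sin2 eps c in d0 *.
set w := 1 - c ^+ 2 in w0 w1 GV *.
have wD : w / D <= 1 by rewrite ler_pdivrMr// mul1r /D /reg_sin2 -/w lerDr ltW.
have Da0 : 0 <= D `^ (- (p / 2)) * `|c| `^ a by rewrite mulr_ge0 ?powR_ge0.
(* Its p-th power carries D^(-p/2). Its power p - 1 carries D^(-p/2 + 1/2), and the additional 1/2
   is what the bound sqrt(1 - c^2) <= D^(1/2) on the zonal field supplies. *)
pose Xx := `|U| * m * D `^ (- 2^-1).
have Xx0 : 0 <= Xx by rewrite !mulr_ge0 ?powR_ge0.
have Y1 := Young_powR p1 al0 Xx0 (mulr_ge0 V0 l0).
have XE : Xx `^ p = `|U| `^ p * m `^ p * D `^ (- (p / 2)).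
  rewrite /Xx !powRM ?mulr_ge0 ?powR_ge0// -powRrM; congr (_ * _ `^ _).
  by field.
have lb : - (p * (Xx `^ (p - 1) * (V * l))) <= p * (`|U| `^ (p - 2) * U) * (zonal_weight a p eps c * G).
  apply: (le_trans (y := - `|p * (`|U| `^ (p - 2) * U) * (zonal_weight a p eps c * G)|)); last first.
    by rewrite lerNl -[leRHS]normrN ler_norm.
  rewrite lerN2 -mulrA normrM gtr0_norm// ler_wpM2l ?(ltW p0)// normrM norm_powRM//.
  have -> : Xx `^ (p - 1) * (V * l) = `|U| `^ (p - 1) *
      (`|c| `^ (a + 1) * D `^ (- (p - 1) / 2) * V).
    rewrite -ml /Xx !powRM ?mulr_ge0 ?powR_ge0// -powRrM.
    have -> : - 2^-1 * (p - 1) = - (p - 1) / 2 by field.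
    by ring.
  rewrite ler_wpM2l ?powR_ge0// normrM /zonal_weight normrN normrM normrM.
  rewrite !(ger0_norm (powR_ge0 _ _)) -/D.
  have -> : `|c| `^ a * `|c| = `|c| `^ (a + 1).
    have [->|c0] := eqVneq `|c| 0; first by rewrite mulr0 powR0// gt_eqF// ltr_wpDl.
    by rewrite powRD ?c0 ?implybT// powRr1.
  rewrite -!mulrA ler_wpM2l ?powR_ge0//.
  apply: (le_trans (y := D `^ (- (p / 2)) * (V * D `^ 2^-1))).
    rewrite ler_wpM2l ?powR_ge0//; apply: (le_trans GV); rewrite ler_wpM2l//.
    by rewrite powR12_sqrt ?ler_sqrt ?(ltW d0)// /D /reg_sin2 -/w lerDr ltW.
  rewrite mulrCA [leRHS]mulrC ler_wpM2l// -powRD ?(gt_eqF d0) ?implybT//.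
  by rewrite le_eqVlt; apply/orP; left; apply/eqP; congr powR; field.
(* Since w / D <= 1, the coefficient n - 1 - p w / D is at least n - 1 - p = p al. *)
have lb2 : `|U| `^ p * (D `^ (- (p / 2)) * (`|c| `^ a * (p * al * c ^+ 2 - (a + 1) * w))) <=
    `|U| `^ p * (D `^ (- (p / 2)) * `|c| `^ a *
      ((n%:R - 1) * c ^+ 2 - (a + 1) * w - p * c ^+ 2 * (w / D))).
  rewrite ler_wpM2l ?powR_ge0// mulrA ler_wpM2l// alE.
  have c20 : 0 <= p * c ^+ 2 by rewrite mulr_ge0 ?sqr_ge0// ltW.
  have := ler_wpM2l c20 wD; rewrite mulr1; lra.
rewrite XE (powRM _ V0 l0) in Y1.
apply: (le_trans _ (lerD lb lb2)).
rewrite mulrBr mulrBr; lra.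
Qed.

(** Integration of the pointwise bound against the vanishing integral of [zonal_parts_powR]. The
    weight f is given up to an equation, so that each application can state it already
    simplified. *)
Lemma regularized_hardy (a eps : R) (m l : R -> R) : 0 <= a -> 0 < eps ->
  measurable_fun setT m -> measurable_fun setT l ->
  (forall c : R, -1 <= c <= 1 ->
     [/\ 0 <= m c <= 1, 0 <= l c <= 1 & m c `^ (p - 1) * l c = `|c| `^ (a + 1)]) ->
  forall f : R -> R, (forall c, f c = reg_sin2 eps c `^ (- (p / 2)) *
     (`|c| `^ a * (p * al * c ^+ 2 - (a + 1) * (1 - c ^+ 2)) - (p - 1) * al * m c `^ p)) ->
  \int[sigma]_x (`|u x| `^ p * f 'c_x) <=
  al `^ (1 - p) * \int[sigma]_x (enorm (Psi x) `^ p * l 'c_x `^ p).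
Proof.
move=> a0 e0 mm ml Hml f fE; have p0 : 0 < p by rewrite (lt_trans ltr01).
have [iI I0] := zonal_parts_powR SPhi p1 iu iup uPsi iPsip (measurable_zonal_weight a p eps)
  (measurable_zonal_weight' a p eps) (fun c => @is_derive_zonal_weight R a p eps c a0 e0)
  (fun c => @continuous_zonal_weight' R a p eps c a0 e0).
have mpow (k : R -> R) r : measurable_fun setT k -> measurable_fun setT (fun c => k c `^ r).
  by move=> mk; exact: (measurableT_comp (measurable_powR _)).
have mf : measurable_fun setT f.
  rewrite (funext fE); apply: measurable_funM; first exact: measurable_reg_sin2.
  apply: measurable_funB; last by apply: measurable_funM => //; exact: mpow.
  apply: measurable_funM; first exact: measurable_norm_powR.
  have m2 : measurable_fun setT (fun c : R => c ^+ 2) by exact: measurable_funX.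
  apply: measurable_funB; first exact: measurable_funM.
  by apply: measurable_funM => //; exact: measurable_funB.
have [M M0 hM] := bounded_itv (fun c => @continuous_reg_sin2 R eps (- (p / 2)) c e0).
have i1 : sigma.-integrable setT (EFin \o (fun x => `|u x| `^ p * f 'c_x)).
  apply: (@integrable_zonal _ f (M * (p * al + (a + 1) + (p - 1) * al)) iup mf) => c c1.
  have [/andP[m0 m1] _ _] := Hml c c1; have /andP[w0 w1] := sqr_itv c1.
  have c0 : 0 <= c ^+ 2 by exact: sqr_ge0.
  have ca0 : 0 <= `|c| `^ a by exact: powR_ge0.
  have ca1 : `|c| `^ a <= 1.
    by apply: powR_le1 => //; rewrite normr_ge0 ler_norml.
  have mp0 : 0 <= m c `^ p by exact: powR_ge0.
  have mp1 : m c `^ p <= 1 by apply: powR_le1; rewrite ?m0// ltW.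
  rewrite fE normrM ler_pM// ?hM// (le_trans (ler_normB _ _))// lerD//.
    rewrite normrM ger0_norm// -[leRHS]mul1r ler_pM// (le_trans (ler_normB _ _))//.
    have pa : 0 <= p * al by rewrite mulr_ge0// ltW.
    have a10 : 0 <= a + 1 by rewrite addr_ge0.
    rewrite (ger0_norm (mulr_ge0 pa c0)) (ger0_norm (mulr_ge0 a10 w0)).
    by rewrite lerD// -[leRHS]mulr1 ler_wpM2l//; lra.
  have q0 : 0 <= (p - 1) * al by rewrite mulr_ge0 ?subr_ge0// ltW.
  by rewrite (ger0_norm (mulr_ge0 q0 mp0)) -[leRHS]mulr1 ler_wpM2l.
have i2 : sigma.-integrable setT (EFin \o (fun x => enorm (Psi x) `^ p * l 'c_x `^ p)).
  apply: (@integrable_zonal _ (fun c => l c `^ p) 1 iPsip) => [|c c1]; first exact: mpow.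
  have [_ /andP[l0 l1] _] := Hml c c1.
  by rewrite ger0_norm ?powR_ge0//; apply: powR_le1; rewrite ?l0// ltW.
rewrite -subr_le0 -(RintegralZl _ measurableT i2) -RintegralB//; last exact: RintegrableZ.
rewrite -I0; apply: le_Rintegral_ae => //.
  by apply: RintegrableB => //; exact: RintegrableZ.
apply: filterS ae_usphere => x Sx.
have c1 := dotv_itv SPhi Sx; have [/andP[m0 _] /andP[l0 _] mlE] := Hml _ c1; rewrite fE.
apply: (regularized_hardy_pointwise _ a0 e0 c1 m0 l0 mlE) => //; first exact: enorm_ge0.
by rewrite -enorm_zonal_field//; exact: normr_dotv_le.
Qed.

End regularized_hardy.

(** * Weak gradients: zonal functions, uniqueness, integrability *)

Section zonal_gradient.
Context {R : realType} {n : nat}.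
Implicit Types (x v : 'rV[R]_n) (u f : 'rV[R]_n -> R) (V Psi : 'rV[R]_n -> 'rV[R]_n).
Local Notation sigma := (@surface_measure R n).

Lemma integrable_bounded f (M : R) : measurable_fun setT f ->
  (forall x, usphere x -> `|f x| <= M) -> sigma.-integrable setT (EFin \o f).
Proof.
move=> mf fM; have i1 : sigma.-integrable setT (EFin \o cst (1 : R)).
  exact: finite_measure_integrable_cst.
have := integrableM_bounded i1 mf fM.
by apply: eq_integrable => // x _ /=; rewrite mul1r.
Qed.

Lemma is_surface_grad0 : is_surface_grad (cst 0) (cst 0 : 'rV[R]_n -> 'rV[R]_n).
Proof.
have d0 v : dotv 0 v = 0 by rewrite /dotv big1// => k _; rewrite mxE mul0r.
split=> [i||V _].
- apply/Lfun1_integrable; apply: (@integrable_bounded _ 0).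
    have -> : (fun x => (cst 0 x : 'rV[R]_n) 0 i) = cst (0 : R).
      by apply/funext => x; rewrite /cst mxE.
    exact: measurable_cst.
  by move=> x _; rewrite /cst mxE normr0.
- by apply: aeW => x; rewrite /cst d0.
- rewrite !integral0_eq ?oppe0// => x _; first by rewrite /cst mul0r.
  by rewrite /cst d0.
Qed.

Variables (Phi : 'rV[R]_n) (h h' : R -> R).
Hypotheses (SPhi : usphere Phi) (mh : measurable_fun setT h) (mh' : measurable_fun setT h').
Hypothesis dh : forall c : R, -1 <= c <= 1 -> is_derive c (1 : R) h (h' c).
Hypothesis ch' : forall c : R, -1 <= c <= 1 -> {for c, continuous h'}.

Let mdotv : measurable_fun setT (dotv Phi : 'rV[R]_n -> R).
Proof. by apply: continuous_measurable_rV; exact: continuous_dotv. Qed.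

Let mhd := measurableT_comp mh mdotv.
Let mhd' := measurableT_comp mh' mdotv.

(** [zonal_parts] with u = 0 and beta = 1: what remains is the divergence theorem for the field h
    V. *)
Lemma zonal_divergence V : smooth_tangent V ->
  \int[sigma]_x (h' (dotv Phi x) * dotv Phi (V x) + h (dotv Phi x) * surface_div V x) = 0.
Proof.
move=> tV; have i0 : sigma.-integrable setT (EFin \o cst (0 : R)).
  exact: finite_measure_integrable_cst.
have i1 : sigma.-integrable setT (EFin \o cst (1 : R)).
  exact: finite_measure_integrable_cst.
have := @zonal_parts R n Phi h h' V SPhi mh mh' dh ch' tV (cst 0) (cst 0) (cst 1) (cst 0)
  i0 is_surface_grad0 (fun t => is_derive_cst (1 : R) t 1) (@cst_continuous _ _ 0) i1.
move=> <-.
  by apply: eq_Rintegral => x _; rewrite /cst mul0r add0r mul1r.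
move=> k; rewrite (_ : (fun x => _) = cst (0 : R))//.
by apply/funext => x; rewrite /cst mul0r.
Qed.

Let bh : exists2 M, 0 <= M & forall c, -1 <= c <= 1 -> `|h c| <= M.
Proof.
apply: bounded_itv => c /dh dhc.
by apply/differentiable_continuous/derivable1_diffP; exact: ex_derive.
Qed.

(** The classical gradient of a C^1 function of cos d is its weak gradient. The test identity is
    [zonal_divergence], because V . Phi = V . [zonal_field] for tangent V. *)
Lemma zonal_surface_grad :
  is_surface_grad (fun x => h (dotv Phi x)) (fun x => h' (dotv Phi x) *: zonal_field Phi x).
Proof.
have tY := zonal_field_tangent Phi; have [sY Yx] := tY.
have mY k : measurable_fun setT (fun x => zonal_field Phi x 0 k) by exact: smooth_measurable.
have [M M0 hM] := bounded_itv ch'.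
have iG k : sigma.-integrable setT (EFin \o (fun x => (h' (dotv Phi x) *: zonal_field Phi x) 0 k)).
  have [M2 h2] := smooth_bounded k sY.
  rewrite (_ : (fun x => _) = fun x => h' (dotv Phi x) * zonal_field Phi x 0 k); last first.
    by apply/funext => x; rewrite mxE.
  apply: (@integrable_bounded _ (M * M2)); first exact: measurable_funM.
  by move=> x Sx; rewrite normrM ler_pM// ?h2// hM//; exact: dotv_itv.
split=> [k||V tV].
- exact/Lfun1_integrable.
- by apply: filterS ae_usphere => x Sx; rewrite dotvZl Yx// mulr0.
have [sV Vx] := tV; have [M1 M10 hM1] := bh.
have mV k : measurable_fun setT (fun x => V x 0 k) by exact: smooth_measurable.
have cdV := continuous_surface_div sV.
have [M3 _ hM3] := continuous_usphere_bounded cdV.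
have i1 : sigma.-integrable setT (EFin \o (fun x => dotv (h' (dotv Phi x) *: zonal_field Phi x) (V x))).
  by apply: integrable_dotv => // k; exact: smooth_bounded.
have mdV : measurable_fun setT (surface_div V) by exact: continuous_measurable_rV.
have i2 : sigma.-integrable setT (EFin \o (fun x => h (dotv Phi x) * surface_div V x)).
  apply: (@integrable_bounded _ (M1 * M3)); first exact: measurable_funM.
  by move=> x Sx; rewrite normrM ler_pM// ?hM3// hM1//; exact: dotv_itv.
rewrite !integral_usphere; last 2 first.
- exact: measurable_int _ i2.
- exact: measurable_int _ i1.
have := zonal_divergence tV.
rewrite (@ae_eq_Rintegral _ _ _ _ _ (fun x => dotv (h' (dotv Phi x) *: zonal_field Phi x) (V x) +
  h (dotv Phi x) * surface_div V x)).
- rewrite RintegralD// => /eqP; rewrite addr_eq0 => /eqP.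
  rewrite /Rintegral -fineN => e; move: (congr1 EFin e).
  have f1 := integrable_fin_num measurableT i1; have f2 := integrable_fin_num measurableT i2.
  by rewrite !fineK// fin_numN.
- apply: measurable_funD; apply: measurable_funM => //.
  by apply: measurable_sum => k; exact: measurable_funM.
- by apply: measurable_funD; [exact: integrable_Rmeasurable i1|exact: integrable_Rmeasurable i2].
- apply: filterS ae_usphere => x Sx; congr (_ + _).
  rewrite dotvZl [dotv (zonal_field _ _) _]dotvC dotv_zonal_field Vx// mulr0 subr0.
  by rewrite [dotv (V x) _]dotvC.
Qed.

End zonal_gradient.

Section gradient_uniqueness.
Context {R : realType} {n : nat}.
Implicit Types (x v : 'rV[R]_n) (u f : 'rV[R]_n -> R) (V Psi : 'rV[R]_n -> 'rV[R]_n).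
Local Notation sigma := (@surface_measure R n).

(** The test fields are polynomials times tangential projections of basis vectors. Both gradients
    are tangent, so pairing with such a field gives back a coordinate, and polynomials separate
    integrable functions. *)
Lemma is_surface_grad_unique u Psi1 Psi2 : is_surface_grad u Psi1 -> is_surface_grad u Psi2 ->
  {ae sigma, forall x, Psi1 x = Psi2 x}.
Proof.
move=> g1 g2; have i1 k := is_surface_grad_integrable k g1.
have i2 k := is_surface_grad_integrable k g2.
suff H k : {ae sigma, forall x, Psi1 x 0 k - Psi2 x 0 k = 0}.
  have : \forall x \ae sigma, forall k, Psi1 x 0 k - Psi2 x 0 k = 0 by exact: filter_forall.
  by apply: filterS => x e; apply/rowP => k; apply/eqP; rewrite -subr_eq0 e.
apply: polyfun_ae_eq0; first exact: RintegrableB.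
move=> f pf; pose V x : 'rV[R]_n := \row_j (f x * ((delta_mx 0 k : 'rV[R]_n) 0 j - x 0 k * x 0 j)).
have pV j : polyfun (fun x => f x * ((delta_mx 0 k : 'rV[R]_n) 0 j - x 0 k * x 0 j)).
  apply: polyfunM => //; apply: polyfunB; first exact: polyfun_cst.
  by apply: polyfunM; exact: polyfun_coord.
have VE x : V x = f x *: (delta_mx 0 k - x 0 k *: x) by apply/rowP => j; rewrite !mxE.
have sV : smooth V by exact: smooth_row_polyfun.
have tV : smooth_tangent V.
  split=> // x /uspherevv x1; rewrite VE dotvZl dotvBl dotvZl x1 dotv_deltal mulr1 subrr.
  by rewrite mulr0.
have [M hM] := polyfun_bounded pf; have mf := polyfun_measurable pf.
have iV Psi : (forall k, sigma.-integrable setT (EFin \o (fun x => Psi x 0 k))) ->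
    sigma.-integrable setT (EFin \o (fun x => dotv (Psi x) (V x))).
  by move=> iP; apply: integrable_dotv => // j; [exact: smooth_measurable|exact: smooth_bounded].
have E : \int[sigma]_x dotv (Psi1 x) (V x) = \int[sigma]_x dotv (Psi2 x) (V x).
  case: g1 => _ _ /(_ V tV) e1; case: g2 => _ _ /(_ V tV) e2.
  have m1 := measurable_int _ (iV _ i1); have m2 := measurable_int _ (iV _ i2).
  move: e1; rewrite -e2 (integral_usphere m1) (integral_usphere m2) => e.
  by rewrite /Rintegral e.
transitivity (\int[sigma]_x (dotv (Psi1 x) (V x) - dotv (Psi2 x) (V x))); last first.
  by rewrite RintegralB ?E ?subrr//; exact: iV.
apply: ae_eq_Rintegral.
- by apply: measurable_funM => //; apply: measurable_funB; [exact: integrable_Rmeasurable (i1 k)|exact: integrable_Rmeasurable (i2 k)].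
- by apply: measurable_funB; [exact: integrable_Rmeasurable (iV _ i1)|exact: integrable_Rmeasurable (iV _ i2)].
case: g1 => _ t1 _; case: g2 => _ t2 _; apply: filterS2 t1 t2 => x t1 t2.
by rewrite !VE !dotvZr !dotvBr !dotvZr t1 t2 !mulr0 !subr0 !dotv_deltar; ring.
Qed.

Lemma Lfun_powR_integrable (p : R) f : 1 <= p -> measurable_fun setT f ->
  sigma.-integrable setT (EFin \o (fun x => `|f x| `^ p)) -> f \in Lfun sigma p%:E.
Proof.
move=> p1 mf ifp; rewrite inE; apply/andP; split; first by rewrite inE.
rewrite !inE/= /finite_norm unlock /Lnorm; apply: poweR_lty.
have /integrableP[_] := ifp; apply: le_lt_trans; rewrite le_eqVlt; apply/orP; left; apply/eqP.
by apply: eq_integral => x _; rewrite [RHS]gee0_abs ?lee_fin ?powR_ge0.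
Qed.

Lemma measurable_fun_enorm Psi : (forall k, measurable_fun setT (fun x => Psi x 0 k)) ->
  measurable_fun setT (fun x => enorm (Psi x)).
Proof.
by move=> mP; apply: (measurableT_comp measurable_enorm); exact: measurable_fun_coordP.
Qed.

(** [surface_grad] is a choice among the weak gradients. Exhibiting one of them makes the choice
    meaningful, and uniqueness identifies it almost everywhere. *)
Lemma sobolev_surface_grad (p : R) u Psi : 1 <= p -> u \in Lfun sigma p%:E ->
  is_surface_grad u Psi ->
  sigma.-integrable setT (EFin \o (fun x => enorm (Psi x) `^ p)) ->
  sobolev p u /\ {ae sigma, forall x, surface_grad u x = Psi x}.
Proof.
move=> p1 uL uPsi iP.
have gu : is_surface_grad u (surface_grad u).
  by rewrite /surface_grad; case: xgetP => [Q -> //|/(_ Psi)].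
have E := is_surface_grad_unique gu uPsi; split=> //; split=> //.
have mg : measurable_fun setT (fun x => enorm (surface_grad u x)).
  apply: measurable_fun_enorm => k.
  exact: integrable_Rmeasurable (is_surface_grad_integrable k gu).
apply: Lfun_powR_integrable => //; apply: (ae_eq_integrable _ _ iP).
  apply: (measurableT_comp (measurable_powR _)).
  exact: (measurableT_comp (@normr_measurable R setT)).
by apply: filterS E => x ->; rewrite ger0_norm ?enorm_ge0.
Qed.

Lemma sobolev_integrable (p : R) u : 1 <= p -> sobolev p u ->
  [/\ sigma.-integrable setT (EFin \o u),
      sigma.-integrable setT (EFin \o (fun x => `|u x| `^ p)),
      is_surface_grad u (surface_grad u) &
      sigma.-integrable setT (EFin \o (fun x => enorm (surface_grad u x) `^ p))].
Proof.
move=> p1 [uL gu gL].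
have mu : measurable_fun setT u by move: uL; rewrite inE => /andP[/[!inE]].
have iup : sigma.-integrable setT (EFin \o (fun x => `|u x| `^ p)) := Lfun_integrable p1 uL.
split=> //.
  have i1 : sigma.-integrable setT (EFin \o cst (1 : R)).
    exact: finite_measure_integrable_cst.
  (* The surface measure is finite, so |u| <= 1 + |u|^p puts u in L^1. *)
  apply: (le_integrable_ae mu (RintegrableD i1 iup)); apply: aeW => x.
  have [u1|u1] := leP `|u x| 1; first by rewrite (le_trans u1)// lerDl powR_ge0.
  rewrite (le_trans (y := `|u x| `^ p)) ?lerDr// le1r_powR// ltW//.
have : sigma.-integrable setT (EFin \o (fun x => `|enorm (surface_grad u x)| `^ p)).
  exact: Lfun_integrable p1 gL.
by apply: eq_integrable => // x _ /=; rewrite ger0_norm ?enorm_ge0.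
Qed.

End gradient_uniqueness.

Lemma fatou_integrable d (T : measurableType d) (R : realType) (mu : {measure set T -> \bar R})
    (f_ : nat -> T -> R) (f : T -> R) (C : R) :
  (forall k, mu.-integrable setT (EFin \o f_ k)) -> measurable_fun setT f ->
  (forall k x, 0 <= f_ k x) -> {ae mu, forall x, f_ k x @[k --> \oo] --> f x} ->
  (forall k, \int[mu]_x f_ k x <= C) -> mu.-integrable setT (EFin \o f).
Proof.
move=> fi mf f0 cvgf fC; apply/integrableP; split; first exact/measurable_EFinP.
have mf_ k : measurable_fun setT (EFin \o f_ k) by exact: measurable_int _ (fi k).
have -> : (\int[mu]_x `|(EFin \o f) x| = \int[mu]_x limn_einf (fun k => (EFin \o f_ k) x))%E.
  apply: ae_eq_integral => //.
  - by apply: measurableT_comp => //; exact/measurable_EFinP.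
  - apply: measurableT_comp => //.
    by apply: measurable_fun_limn_esup => k; exact: measurableT_comp.
  - apply: filterS cvgf => x cvgfx _.
    have fx0 : 0 <= f x.
      rewrite -(cvg_lim (@Rhausdorff R) cvgfx); apply: limr_ge; first exact: cvgP cvgfx.
      exact: nearW.
    rewrite /= ger0_norm//; apply/esym.
    have cvgE : (EFin \o f_ k) x @[k --> \oo] --> (f x)%:E.
      by apply: cvg_EFin; [exact: nearW|exact: cvgfx].
    by have [] := cvg_limn_einf_sup cvgE.
apply: le_lt_trans (fatou _ _ _ _) _ => //; first by move=> k x _; rewrite lee_fin.
apply: (@le_lt_trans _ _ C%:E); last exact: ltry.
rewrite limn_einf_lim; apply: lime_le; first exact: is_cvg_einfs.
apply: nearW => k; apply: (@le_trans _ _ (\int[mu]_x (f_ k x)%:E)%E).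
  by apply: ereal_inf_lbound; exists k => /=.
have := fC k; rewrite -lee_fin /Rintegral fineK//.
exact: (integrable_fin_num measurableT (fi k)).
Qed.

Section hardy.
Context {R : realType} {n : nat}.
Implicit Types (x : 'rV[R]_n).
Local Notation sigma := (@surface_measure R n).
Variable Phi : 'rV[R]_n.
Hypothesis SPhi : usphere Phi.
Local Notation "'c_ x" := (dotv Phi x) (at level 8, x at level 2).

Section fixed_function.
Variables (p : R) (u : 'rV[R]_n -> R) (Psi : 'rV[R]_n -> 'rV[R]_n).
Hypotheses (p1 : 1 < p) (iu : sigma.-integrable setT (EFin \o u)).
Hypotheses (iup : sigma.-integrable setT (EFin \o (fun x => `|u x| `^ p)))
           (uPsi : is_surface_grad u Psi)
           (iPsip : sigma.-integrable setT (EFin \o (fun x => enorm (Psi x) `^ p))).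
Variable al : R.
Hypotheses (al0 : 0 < al) (alE : p * al = n%:R - 1 - p).

(** The case a = 0, m = 1, l = |c|. The weight p al c^2 - sin^2 d - (p - 1) al equals al - (n - p)
    sin^2 d because n - p = p al + 1. *)
Lemma regularized_hardy_sin (eps : R) : 0 < eps ->
  \int[sigma]_x (`|u x| `^ p * (reg_sin2 eps 'c_x `^ (- (p / 2)) * (al - (n%:R - p) * (1 - 'c_x ^+ 2)))) <=
  al `^ (1 - p) * \int[sigma]_x (enorm (Psi x) `^ p * `|'c_x| `^ p).
Proof.
move=> e0; have := @regularized_hardy R n Phi SPhi p u Psi p1 iu iup uPsi iPsip al al0 alE
  0 eps (cst 1) (fun c => `|c|) (lexx 0) e0 => /(_ _ _ _
  (fun c => reg_sin2 eps c `^ (- (p / 2)) * (al - (n%:R - p) * (1 - c ^+ 2)))).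
apply => //.
- by move=> c c1; rewrite /cst ler01 lexx normr_ge0 ler_norml powR1 mul1r add0r powRr1.
- move=> c; congr (_ * _); rewrite powRr0 /cst powR1 (_ : n%:R = p * al + 1 + p); last by rewrite alE; ring.
  by ring.
Qed.

(** The case a = p - 2, m = |c|, l = 1: Young takes (p - 1) al |c|^p from p al |c|^p. The bound 2 <=
    p is a >= 0, which keeps the weight differentiable at the equator. *)
Lemma regularized_hardy_tan (eps : R) : 2 <= p -> 0 < eps ->
  \int[sigma]_x (`|u x| `^ p * (reg_sin2 eps 'c_x `^ (- (p / 2)) *
     (al * `|'c_x| `^ p - (p - 1) * (`|'c_x| `^ (p - 2) * (1 - 'c_x ^+ 2))))) <=
  al `^ (1 - p) * \int[sigma]_x (enorm (Psi x) `^ p).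
Proof.
move=> p2 e0; have := @regularized_hardy R n Phi SPhi p u Psi p1 iu iup uPsi iPsip al al0 alE
  (p - 2) eps (fun c => `|c|) (cst 1).
have := subr_ge0 2 p; rewrite p2 => p20 /(_ p20 e0).
have -> : \int[sigma]_x (enorm (Psi x) `^ p) = \int[sigma]_x (enorm (Psi x) `^ p * cst 1 'c_x `^ p).
  by apply: eq_Rintegral => x _; rewrite /cst powR1 mulr1.
move=> /(_ _ _ _ (fun c => reg_sin2 eps c `^ (- (p / 2)) *
  (al * `|c| `^ p - (p - 1) * (`|c| `^ (p - 2) * (1 - c ^+ 2))))).
apply => //.
- by move=> c c1; rewrite /cst ler01 lexx normr_ge0 ler_norml mulr1; split=> //; congr powR; ring.
- move=> c; congr (_ * _).
  have -> : `|c| `^ p = `|c| `^ (p - 2) * c ^+ 2.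
    have [->|c0] := eqVneq c 0.
      by rewrite expr0n mulr0 normr0 powR0// gt_eqF// (lt_trans ltr01).
    rewrite -[c ^+ 2]real_normK ?num_real// -powR_mulrn// -powRD ?normr_eq0 ?c0 ?implybT//.
    by congr powR; ring.
  by ring.
Qed.

Lemma integrable_regularized (eps r : R) : 0 < eps ->
  sigma.-integrable setT (EFin \o (fun x => `|u x| `^ p * reg_sin2 eps 'c_x `^ r)).
Proof.
move=> e0; have [M M0 hM] := bounded_itv (fun c => @continuous_reg_sin2 R eps r c e0).
apply: (integrable_zonal SPhi (f := fun c => reg_sin2 eps c `^ r) iup _ hM).
exact: measurable_reg_sin2.
Qed.

(** Near the poles the factor al - N sin^2 d is at least al / 2, so the regularized inequality
    controls the integral there; away from the poles the singular weight is bounded independently of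
    eps. *)
Lemma regularized_hardy_bounded : exists C, forall eps, 0 < eps ->
  \int[sigma]_x (`|u x| `^ p * reg_sin2 eps 'c_x `^ (- (p / 2))) <= C.
Proof.
have p0 : 0 < p by rewrite (lt_trans ltr01).
pose N : R := n%:R - p; have NE : N = p * al + 1 by rewrite alE /N; ring.
have N0 : 0 < N by rewrite NE addr_gt0// mulr_gt0.
(* The threshold for sin^2 d: N del = al / 2. Beyond it the weight is at most del^(-p/2), whence
   K. *)
pose del := al / (2 * N); have del0 : 0 < del by rewrite divr_gt0// mulr_gt0.
pose K := N * del `^ (- (p / 2)).
pose C1 := al `^ (1 - p) * \int[sigma]_x (enorm (Psi x) `^ p * `|'c_x| `^ p).
exists ((C1 + K * \int[sigma]_x (`|u x| `^ p)) * (2 / al)) => eps e0.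
have h1 := regularized_hardy_sin e0; rewrite -/C1 -/N in h1.
have i1 := integrable_regularized (- (p / 2)) e0.
have i3 : sigma.-integrable setT (EFin \o (fun x => `|u x| `^ p *
    (reg_sin2 eps 'c_x `^ (- (p / 2)) * (al - N * (1 - 'c_x ^+ 2))))).
  have [M M0 hM] := bounded_itv (fun c => @continuous_reg_sin2 R eps (- (p / 2)) c e0).
  apply: (integrable_zonal SPhi (f := fun c => reg_sin2 eps c `^ (- (p / 2)) * (al - N * (1 - c ^+ 2)))
    (M := M * (al + N)) iup).
    apply: measurable_funM; first exact: measurable_reg_sin2.
    apply: measurable_funB => //; apply: measurable_funM => //.
    by apply: measurable_funB => //; exact: measurable_funX.
  move=> c c1; have /andP[w0 w1] := sqr_itv c1.
  rewrite normrM ler_pM// ?hM// (le_trans (ler_normB _ _))// gtr0_norm// lerD2l.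
  by rewrite ger0_norm ?mulr_ge0 ?(ltW N0)// -[leRHS]mulr1 ler_wpM2l// ltW.
have h2 : \int[sigma]_x (al / 2 * (`|u x| `^ p * reg_sin2 eps 'c_x `^ (- (p / 2)))
    - K * `|u x| `^ p) <= C1.
  apply: le_trans h1; apply: le_Rintegral_ae => //.
    by apply: RintegrableB; exact: RintegrableZ.
  apply: filterS ae_usphere => x Sx; have c1 := dotv_itv SPhi Sx.
  have := reg_sin2_gt0 e0 c1; have /andP[] := sqr_itv c1.
  rewrite /reg_sin2; move: (dotv Phi x) => c; set w := 1 - c ^+ 2 => w0 w1 d0.
  set D := (eps + w) `^ _; have D0 : 0 <= D by exact: powR_ge0.
  have U0 : 0 <= `|u x| `^ p by exact: powR_ge0.
  suff : al / 2 * D - K <= D * (al - N * w).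
    by move=> H; have := ler_wpM2l U0 H; rewrite mulrBr; lra.
  have [wd|dw] := leP w del.
    have : N * w <= al / 2.
      have -> : al / 2 = N * del by rewrite /del; field; rewrite gt_eqF.
      by rewrite ler_wpM2l// ltW.
    move=> Nw; have : D * (al / 2) <= D * (al - N * w) by rewrite ler_wpM2l//; lra.
    have : 0 <= K by rewrite mulr_ge0 ?powR_ge0// ltW.
    lra.
  have DK : D <= del `^ (- (p / 2)).
    rewrite /D !powRN lef_pV2 ?posrE ?powR_gt0//.
    by rewrite ge0_ler_powR ?nnegrE ?(ltW del0) ?(ltW d0)//; lra.
  have : N * D <= K by rewrite ler_wpM2l// ltW.
  have : N * D * w <= N * D by rewrite ler_piMr// mulr_ge0// ltW.
  have : 0 <= al / 2 * D by rewrite mulr_ge0// divr_ge0// ltW.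
  lra.
rewrite RintegralB// in h2; [|exact: RintegrableZ|exact: RintegrableZ].
rewrite RintegralZl// RintegralZl// in h2.
rewrite -ler_pdivrMr ?divr_gt0// invf_div mulrC; lra.
Qed.

End fixed_function.
End hardy.

(** * Removing the regularization at the poles *)

Section poles.
Context {R : realType} {n : nat}.
Implicit Types (x : 'rV[R]_n).
Local Notation sigma := (@surface_measure R n).
Variable Phi : 'rV[R]_n.
Hypotheses (n4 : (4 <= n)%N) (SPhi : usphere Phi).
Local Notation "'c_ x" := (dotv Phi x) (at level 8, x at level 2).

Lemma measurable_dotvl : measurable_fun setT (dotv Phi : 'rV[R]_n -> R).
Proof. by apply: continuous_measurable_rV; exact: continuous_dotv. Qed.

Lemma measurable_sin2 : measurable_fun setT (fun x => 1 - 'c_x ^+ 2).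
Proof. by apply: measurable_funB => //; apply: measurable_funX; exact: measurable_dotvl. Qed.

Lemma is_surface_grad1 : is_surface_grad (cst 1) (cst 0 : 'rV[R]_n -> 'rV[R]_n).
Proof.
have -> : (cst 0 : 'rV[R]_n -> 'rV[R]_n) = (fun x => cst 0 'c_x *: zonal_field Phi x).
  by apply/funext => x; rewrite /cst scale0r.
apply: (@zonal_surface_grad R n Phi (cst 1) (cst 0) SPhi) => // c _; exact: cvg_cst.
Qed.

Lemma integrable_surface_cst (r : R) : sigma.-integrable setT (EFin \o cst r).
Proof. exact: finite_measure_integrable_cst. Qed.

(* For u = 1 the regularized inequality bounds the integrals of (eps + sin^2 d)^-1
   uniformly in eps. *)
Lemma ae_not_pole : {ae sigma, forall x, 0 < 1 - 'c_x ^+ 2}.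
Proof.
have n4R : 4 <= n%:R :> R by rewrite (ler_nat R 4 n).
(* The value of [alpha] for p = 2; it is positive because n >= 4. *)
pose al : R := (n%:R - 3) / 2; have al0 : 0 < al by rewrite divr_gt0// subr_gt0; lra.
have alE : 2 * al = n%:R - 1 - 2 by rewrite /al; field.
have i1 : sigma.-integrable setT (EFin \o (fun x : 'rV[R]_n => `|cst (1 : R) x| `^ 2)).
  by rewrite (_ : (fun _ => _) = cst (`|1 : R| `^ 2)); [exact: integrable_surface_cst|apply/funext].
have i0 : sigma.-integrable setT (EFin \o (fun x : 'rV[R]_n => enorm (cst (0 : 'rV[R]_n) x) `^ 2)).
  rewrite (_ : (fun _ => _) = cst (enorm (0 : 'rV[R]_n) `^ 2)); last by apply/funext.
  exact: integrable_surface_cst.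
have [C hC] := regularized_hardy_bounded SPhi (ltr1n R 2) (integrable_surface_cst 1) i1 is_surface_grad1 i0 al0 alE.
pose A := [set x : 'rV[R]_n | 1 - 'c_x ^+ 2 <= 0].
have mA : measurable A.
  have -> : A = setT `&` (fun x => 1 - 'c_x ^+ 2) @^-1` `]-oo, 0]%classic.
    by rewrite setTI; apply/seteqP; split => x; rewrite /A /= in_itv.
  by apply: measurable_sin2 => //; exact: measurable_itv.
have Afin : sigma A \is a fin_num by exact: fin_num_measure.
(* At a pole the regularized weight (eps + sin^2 d)^-1 equals 1 / eps, so its integral is at least
   sigma(A) / eps. *)
have key (eps : R) : 0 < eps -> fine (sigma A) <= C * eps.
  move=> e0; rewrite -ler_pdivrMr//; apply: le_trans (hC eps e0).
  have iA : sigma.-integrable setT (EFin \o (\1_A : 'rV[R]_n -> R)).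
    by apply: (@integrable_bounded _ _ _ 1) => [|x _]; [exact: measurable_indic|
      rewrite indicE; case: (_ \in _); rewrite ?normr1 ?normr0].
  have -> : fine (sigma A) / eps = \int[sigma]_x (eps^-1 * \1_A x).
    rewrite RintegralZl// mulrC; congr (_ * _).
    by rewrite /Rintegral integral_indic// setIT.
  apply: le_Rintegral_ae.
  - exact: RintegrableZ.
  - exact: (integrable_regularized SPhi i1 _ e0).
  apply: filterS ae_usphere => x Sx; have c1 := dotv_itv SPhi Sx.
  have /andP[w0 _] := sqr_itv c1; have d0 := reg_sin2_gt0 e0 c1.
  rewrite /cst normr1 powR1 mul1r (_ : - (2 / 2) = -1); last by field.
  rewrite indicE; have [/set_mem xA|_] := boolP (x \in A); last by rewrite mulr0 powR_ge0.
  have w00 : 1 - 'c_x ^+ 2 = 0 by apply/eqP; rewrite eq_le w0 andbT.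
  by rewrite mulr1 /reg_sin2 w00 addr0 powR_inv1// ltW.
exists A; split => //; last by move=> x /= /negP; rewrite -leNgt.
suff : fine (sigma A) <= 0.
  by move=> H; rewrite -(fineK Afin); congr EFin; apply/eqP; rewrite eq_le H fine_ge0.
rewrite leNgt; apply/negP => m0.
have C0 : 0 < C by have := key 1 ltr01; rewrite mulr1; exact: lt_le_trans.
(* This eps turns the bound into sigma(A) <= sigma(A) / 2. *)
have := key (fine (sigma A) / (2 * C)) _; rewrite divr_gt0 ?mulr_gt0// => /(_ isT).
have -> : C * (fine (sigma A) / (2 * C)) = fine (sigma A) / 2 by field; rewrite gt_eqF.
lra.
Qed.

Lemma cvg_reg_sin2 (w r : R) : 0 < w -> (k.+1%:R^-1 + w) `^ r @[k --> \oo] --> w `^ r.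
Proof.
move=> w0; have d := is_derive_powR r w0.
have cw : {for w, continuous (fun t : R => t `^ r)}.
  by apply/differentiable_continuous/derivable1_diffP; exact: ex_derive.
have c1 : k.+1%:R^-1 + w @[k --> \oo] --> w.
  rewrite -[X in _ --> X]add0r; apply: cvgD; last exact: cvg_cst.
  exact: cvg_harmonic.
exact: (@cvg_comp _ _ _ (fun k : nat => k.+1%:R^-1 + w) (fun t => t `^ r) _ _ _ c1 cw).
Qed.

Section hardy_limit.
Variables (p : R) (u : 'rV[R]_n -> R) (Psi : 'rV[R]_n -> 'rV[R]_n).
Hypotheses (p1 : 1 < p) (iu : sigma.-integrable setT (EFin \o u)).
Hypotheses (iup : sigma.-integrable setT (EFin \o (fun x => `|u x| `^ p)))
           (uPsi : is_surface_grad u Psi)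
           (iPsip : sigma.-integrable setT (EFin \o (fun x => enorm (Psi x) `^ p))).
Variable al : R.
Hypotheses (al0 : 0 < al) (alE : p * al = n%:R - 1 - p).

Let U x := `|u x| `^ p.

Let mU : measurable_fun setT U := integrable_Rmeasurable iup.

(** Fatou's lemma and the bound uniform in eps. This makes S finite on every Sobolev function and
    provides the dominating function for the limit eps -> 0. *)
Lemma hardy_integrable : sigma.-integrable setT
  (EFin \o (fun x => U x * (1 - 'c_x ^+ 2) `^ (- (p / 2)))).
Proof.
have [C hC] := regularized_hardy_bounded SPhi p1 iu iup uPsi iPsip al0 alE.
apply: (@fatou_integrable _ _ _ _ (fun k x => U x * reg_sin2 k.+1%:R^-1 'c_x `^ (- (p / 2))) _ C).
- by move=> k; exact: (integrable_regularized SPhi iup).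
- by apply: measurable_funM => //; apply: (measurableT_comp (measurable_powR _)); exact: measurable_sin2.
- by move=> k x; rewrite mulr_ge0 ?powR_ge0.
- apply: filterS ae_not_pole => x w0; apply: cvgM; first exact: cvg_cst.
  exact: cvg_reg_sin2.
- by move=> k; apply: hC.
Qed.

Lemma cvg_Rintegral_reg (f : R -> R) (M : R) : measurable_fun setT f ->
  (forall c : R, -1 <= c <= 1 -> `|f c| <= M) ->
  sigma.-integrable setT (EFin \o (fun x => U x * ((1 - 'c_x ^+ 2) `^ (- (p / 2)) * f 'c_x))) /\
  \int[sigma]_x (U x * (reg_sin2 k.+1%:R^-1 'c_x `^ (- (p / 2)) * f 'c_x)) @[k --> \oo] -->
  \int[sigma]_x (U x * ((1 - 'c_x ^+ 2) `^ (- (p / 2)) * f 'c_x)).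
Proof.
move=> mf fM; have mfc := measurableT_comp mf measurable_dotvl.
have p20 : 0 <= p / 2 by rewrite divr_ge0// ltW// (lt_trans ltr01).
have mw := measurableT_comp (measurable_powR (- (p / 2))) measurable_sin2.
have [|||||ii cv] := @Rdominated_convergence _ _ _ sigma
  (fun k x => U x * (reg_sin2 k.+1%:R^-1 'c_x `^ (- (p / 2)) * f 'c_x))
  (fun x => U x * ((1 - 'c_x ^+ 2) `^ (- (p / 2)) * f 'c_x))
  (fun x => M * (U x * (1 - 'c_x ^+ 2) `^ (- (p / 2)))).
- move=> k; apply: measurable_funM => //; apply: measurable_funM => //.
  exact: (measurableT_comp (measurable_reg_sin2 _ _) measurable_dotvl).
- by apply: measurable_funM => //; exact: measurable_funM.
- apply: filterS ae_not_pole => x w0; apply: cvgM; first exact: cvg_cst.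
  by apply: cvgM; [exact: cvg_reg_sin2|exact: cvg_cst].
- exact/RintegrableZ/hardy_integrable.
- apply: filterS2 ae_usphere ae_not_pole => x Sx w0 k; have c1 := dotv_itv SPhi Sx.
  have U0 : 0 <= U x by exact: powR_ge0.
  rewrite normrM ger0_norm// normrM (ger0_norm (powR_ge0 _ _)) mulrA mulrC.
  apply: ler_pM => //; [by rewrite mulr_ge0 ?powR_ge0|exact: fM|].
  rewrite ler_wpM2l// !powRN lef_pV2 ?posrE ?powR_gt0//; last first.
    by apply: reg_sin2_gt0 => //; rewrite invr_gt0.
  rewrite ge0_ler_powR ?nnegrE//; [exact: ltW| |].
    by rewrite ltW//; apply: reg_sin2_gt0 => //; rewrite invr_gt0.
  by rewrite /reg_sin2 lerDr invr_ge0.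
by split.
Qed.

(** The regularized inequality is stable under eps -> 0; finiteness of each limit then allows the
    integral to be split into the S and S~ terms. *)
Lemma hardy_sin :
  sigma.-integrable setT (EFin \o (fun x => U x * (1 - 'c_x ^+ 2) `^ (- ((p - 2) / 2)))) /\
  al * \int[sigma]_x (U x * (1 - 'c_x ^+ 2) `^ (- (p / 2))) <=
  (n%:R - p) * \int[sigma]_x (U x * (1 - 'c_x ^+ 2) `^ (- ((p - 2) / 2))) +
  al `^ (1 - p) * \int[sigma]_x (enorm (Psi x) `^ p * `|'c_x| `^ p).
Proof.
have mw : measurable_fun setT (fun c : R => 1 - c ^+ 2).
  by apply: measurable_funB => //; exact: measurable_funX.
have wE (w : R) : 0 < w -> w `^ (- (p / 2)) * w = w `^ (- ((p - 2) / 2)).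
  move=> w0; rewrite -[X in _ * X]powRr1 ?(ltW w0)// -powRD ?(gt_eqF w0) ?implybT//.
  by congr powR; field.
have [i1 _] := @cvg_Rintegral_reg (fun c => 1 - c ^+ 2) 1 mw (fun c c1 => ltac:(
  by have /andP[w0 w1] := sqr_itv c1; rewrite ger0_norm)).
(* At a pole the left side is 0, but for p = 2 the power on the right is 0^0 = 1; the law of
   exponents holds off the poles only. *)
have E : {ae sigma, forall x, U x * ((1 - 'c_x ^+ 2) `^ (- (p / 2)) * (1 - 'c_x ^+ 2)) =
    U x * (1 - 'c_x ^+ 2) `^ (- ((p - 2) / 2))}.
  by apply: filterS ae_not_pole => x w0; rewrite wE.
have m2 : measurable_fun setT (fun x => U x * (1 - 'c_x ^+ 2) `^ (- ((p - 2) / 2))).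
  by apply: measurable_funM => //; apply: (measurableT_comp (measurable_powR _)); exact: measurable_sin2.
split; first exact: (ae_eq_integrable m2 E i1).
have i0 := hardy_integrable.
have pal : 0 < p * al by rewrite mulr_gt0// (lt_trans ltr01).
have N0 : 0 <= n%:R - p by move: pal; rewrite alE; lra.
have [|c1|i3 cv] := @cvg_Rintegral_reg (fun c => al - (n%:R - p) * (1 - c ^+ 2)) (al + (n%:R - p)).
- by apply: measurable_funB => //; exact: measurable_funM.
- move=> c11; have /andP[w0 w1] := sqr_itv c11.
  rewrite (le_trans (ler_normB _ _))// gtr0_norm// lerD2l.
  by rewrite ger0_norm ?mulr_ge0// -[leRHS]mulr1 ler_wpM2l.
have : \int[sigma]_x (U x * ((1 - 'c_x ^+ 2) `^ (- (p / 2)) * (al - (n%:R - p) * (1 - 'c_x ^+ 2)))) <=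
    al `^ (1 - p) * \int[sigma]_x (enorm (Psi x) `^ p * `|'c_x| `^ p).
  rewrite -(cvg_lim (@Rhausdorff R) cv); apply: limr_le; first exact: cvgP cv.
  by apply: nearW => k; apply: (regularized_hardy_sin SPhi p1 iu iup uPsi iPsip al0 alE); rewrite invr_gt0.
have -> : \int[sigma]_x (U x * ((1 - 'c_x ^+ 2) `^ (- (p / 2)) * (al - (n%:R - p) * (1 - 'c_x ^+ 2)))) =
    al * \int[sigma]_x (U x * (1 - 'c_x ^+ 2) `^ (- (p / 2))) -
    (n%:R - p) * \int[sigma]_x (U x * ((1 - 'c_x ^+ 2) `^ (- (p / 2)) * (1 - 'c_x ^+ 2))).
  rewrite -!RintegralZl// -RintegralB//; [|exact: RintegrableZ|exact: RintegrableZ].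
  by apply: eq_Rintegral => x _; ring.
rewrite (ae_eq_Rintegral (integrable_Rmeasurable i1) m2 E).
by rewrite lerBlDl.
Qed.

Lemma hardy_tan : 2 <= p ->
  [/\ sigma.-integrable setT (EFin \o (fun x => U x * (`|'c_x| `^ p * (1 - 'c_x ^+ 2) `^ (- (p / 2))))),
   sigma.-integrable setT (EFin \o (fun x => U x * (`|'c_x| `^ (p - 2) * (1 - 'c_x ^+ 2) `^ (- ((p - 2) / 2))))) &
  al * \int[sigma]_x (U x * (`|'c_x| `^ p * (1 - 'c_x ^+ 2) `^ (- (p / 2)))) <=
  (p - 1) * \int[sigma]_x (U x * (`|'c_x| `^ (p - 2) * (1 - 'c_x ^+ 2) `^ (- ((p - 2) / 2)))) +
  al `^ (1 - p) * \int[sigma]_x (enorm (Psi x) `^ p)].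
Proof.
move=> p2; have p20 : 0 <= p - 2 by rewrite subr_ge0.
have p0 : 0 <= p by rewrite ltW// (lt_trans ltr01).
have mw : measurable_fun setT (fun c : R => 1 - c ^+ 2).
  by apply: measurable_funB => //; exact: measurable_funX.
have wE (w : R) : 0 < w -> w `^ (- (p / 2)) * w = w `^ (- ((p - 2) / 2)).
  move=> w0; rewrite -[X in _ * X]powRr1 ?(ltW w0)// -powRD ?(gt_eqF w0) ?implybT//.
  by congr powR; field.
have c_le1 (c r : R) : 0 <= r -> -1 <= c <= 1 -> 0 <= `|c| `^ r <= 1.
  by move=> r0 c1; rewrite powR_ge0 powR_le1// normr_ge0 ler_norml.
have f2le (c : R) : -1 <= c <= 1 -> 0 <= `|c| `^ (p - 2) * (1 - c ^+ 2) <= 1.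
  move=> c1; have /andP[w0 w1] := sqr_itv c1; have /andP[h0 h1] := c_le1 c _ p20 c1.
  by rewrite mulr_ge0//= -[leRHS]mulr1 ler_pM.
have mf2 : measurable_fun setT (fun c : R => `|c| `^ (p - 2) * (1 - c ^+ 2)).
  by apply: measurable_funM => //; exact: measurable_norm_powR.
have mfp := @measurable_norm_powR R p.
have [|i1 _] := @cvg_Rintegral_reg (fun c => `|c| `^ p) 1 mfp.
  by move=> c c1; have /andP[h0 h1] := c_le1 c _ p0 c1; rewrite ger0_norm.
have [|i2 _] := @cvg_Rintegral_reg (fun c => `|c| `^ (p - 2) * (1 - c ^+ 2)) 1 mf2.
  by move=> c c1; have /andP[h0 h1] := f2le c c1; rewrite ger0_norm.
have E1 x : U x * ((1 - 'c_x ^+ 2) `^ (- (p / 2)) * `|'c_x| `^ p) =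
    U x * (`|'c_x| `^ p * (1 - 'c_x ^+ 2) `^ (- (p / 2))) by rewrite [X in _ * X]mulrC.
have E2 : {ae sigma, forall x, U x * ((1 - 'c_x ^+ 2) `^ (- (p / 2)) * (`|'c_x| `^ (p - 2) * (1 - 'c_x ^+ 2))) =
    U x * (`|'c_x| `^ (p - 2) * (1 - 'c_x ^+ 2) `^ (- ((p - 2) / 2)))}.
  by apply: filterS ae_not_pole => x w0; rewrite -wE//; ring.
have mpw r : measurable_fun setT (fun x : 'rV[R]_n => (1 - 'c_x ^+ 2) `^ r).
  exact: (measurableT_comp (measurable_powR r) measurable_sin2).
have mpc r : measurable_fun setT (fun x : 'rV[R]_n => `|'c_x| `^ r).
  exact: (measurableT_comp (measurable_norm_powR r) measurable_dotvl).
have m2 : measurable_fun setT (fun x => U x * (`|'c_x| `^ (p - 2) * (1 - 'c_x ^+ 2) `^ (- ((p - 2) / 2)))).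
  by apply: measurable_funM => //; exact: measurable_funM.
have i1' : sigma.-integrable setT (EFin \o (fun x => U x * (`|'c_x| `^ p * (1 - 'c_x ^+ 2) `^ (- (p / 2))))).
  by rewrite -(funext E1).
split=> //; first exact: (ae_eq_integrable m2 E2 i2).
have q0 : 0 <= p - 1 by rewrite subr_ge0 ltW.
have [||i3 cv] := @cvg_Rintegral_reg
  (fun c => al * `|c| `^ p - (p - 1) * (`|c| `^ (p - 2) * (1 - c ^+ 2))) (al + (p - 1)).
- by apply: measurable_funB => //; exact: measurable_funM.
- move=> c c1; have /andP[h0 h1] := c_le1 c _ p0 c1; have /andP[h2 h3] := f2le c c1.
  rewrite (le_trans (ler_normB _ _))// lerD//.
    by rewrite ger0_norm ?mulr_ge0 ?(ltW al0)// -[leRHS]mulr1 ler_wpM2l// ltW.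
  by rewrite (ger0_norm (mulr_ge0 q0 h2)) -[leRHS]mulr1 ler_wpM2l.
have : \int[sigma]_x (U x * ((1 - 'c_x ^+ 2) `^ (- (p / 2)) *
      (al * `|'c_x| `^ p - (p - 1) * (`|'c_x| `^ (p - 2) * (1 - 'c_x ^+ 2))))) <=
    al `^ (1 - p) * \int[sigma]_x (enorm (Psi x) `^ p).
  rewrite -(cvg_lim (@Rhausdorff R) cv); apply: limr_le; first exact: cvgP cv.
  by apply: nearW => k; apply: (regularized_hardy_tan SPhi p1 iu iup uPsi iPsip al0 alE p2); rewrite invr_gt0.
have -> : \int[sigma]_x (U x * ((1 - 'c_x ^+ 2) `^ (- (p / 2)) *
      (al * `|'c_x| `^ p - (p - 1) * (`|'c_x| `^ (p - 2) * (1 - 'c_x ^+ 2))))) =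
    al * \int[sigma]_x (U x * (`|'c_x| `^ p * (1 - 'c_x ^+ 2) `^ (- (p / 2)))) -
    (p - 1) * \int[sigma]_x (U x * ((1 - 'c_x ^+ 2) `^ (- (p / 2)) * (`|'c_x| `^ (p - 2) * (1 - 'c_x ^+ 2)))).
  rewrite -!RintegralZl// -RintegralB//; [|exact: RintegrableZ|exact: RintegrableZ].
  by apply: eq_Rintegral => x _; ring.
rewrite (ae_eq_Rintegral (integrable_Rmeasurable i2) m2 E2).
by rewrite lerBlDl.
Qed.

End hardy_limit.
End poles.

(** * Test functions *)

Section power_weights.
Context {R : realType} {n : nat}.
Implicit Types (x : 'rV[R]_n).
Local Notation sigma := (@surface_measure R n).
Variable Phi : 'rV[R]_n.
Hypotheses (n4 : (4 <= n)%N) (SPhi : usphere Phi).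
Local Notation "'c_ x" := (dotv Phi x) (at level 8, x at level 2).
Variable b : R.
Hypotheses (b1 : 1 < b) (bn : b < n%:R - 1).

Let b0 : 0 < b. Proof. exact: lt_trans ltr01 b1. Qed.

Let i1 : sigma.-integrable setT (EFin \o (fun x : 'rV[R]_n => `|cst (1 : R) x| `^ b)).
Proof.
by rewrite (_ : (fun _ => _) = cst (`|1 : R| `^ b)); [exact: integrable_surface_cst|apply/funext].
Qed.

Let i0 : sigma.-integrable setT (EFin \o (fun x : 'rV[R]_n => enorm (cst (0 : 'rV[R]_n) x) `^ b)).
Proof.
rewrite (_ : (fun _ => _) = cst (enorm (0 : 'rV[R]_n) `^ b)); last by apply/funext.
exact: integrable_surface_cst.
Qed.

Let al : R := (n%:R - 1 - b) / b.

Let al0 : 0 < al. Proof. by rewrite divr_gt0// subr_gt0. Qed.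

Let alE : b * al = n%:R - 1 - b. Proof. by rewrite /al; field; rewrite gt_eqF. Qed.

(** The Hardy inequality for the constant function 1 with exponent b in the role of p; b < n - 1 is
    the positivity of the corresponding [al]. *)
Lemma integrable_sin_power : sigma.-integrable setT (EFin \o (fun x => (1 - 'c_x ^+ 2) `^ (- (b / 2)))).
Proof.
have := hardy_integrable n4 SPhi b1 (integrable_surface_cst 1) i1 (is_surface_grad1 SPhi) i0 al0 alE.
by apply: eq_integrable => // x _ /=; rewrite normr1 powR1 mul1r.
Qed.

Lemma cvg_Rintegral_zonal (f_ : nat -> R -> R) (f : R -> R) (C : R) :
  (forall k, measurable_fun setT (f_ k)) -> measurable_fun setT f ->
  (forall c : R, -1 <= c <= 1 -> 0 < 1 - c ^+ 2 -> f_ k c @[k --> \oo] --> f c) ->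
  (forall c : R, -1 <= c <= 1 -> 0 < 1 - c ^+ 2 ->
    forall k, `|f_ k c| <= C * (1 - c ^+ 2) `^ (- (b / 2))) ->
  sigma.-integrable setT (EFin \o (fun x => f 'c_x)) /\
  \int[sigma]_x f_ k 'c_x @[k --> \oo] --> \int[sigma]_x f 'c_x.
Proof.
move=> mf_ mf ff fC.
have [|||||ii cv] := @Rdominated_convergence _ _ _ sigma (fun k x => f_ k 'c_x)
  (fun x => f 'c_x) (fun x => C * (1 - 'c_x ^+ 2) `^ (- (b / 2))).
- by move=> k; exact: (measurableT_comp (mf_ k) (measurable_dotvl Phi)).
- exact: (measurableT_comp mf (measurable_dotvl Phi)).
- by apply: filterS2 ae_usphere (ae_not_pole n4 SPhi) => x Sx; apply: ff; exact: dotv_itv.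
- exact/RintegrableZ/integrable_sin_power.
- by apply: filterS2 ae_usphere (ae_not_pole n4 SPhi) => x Sx w0 k; apply: fC => //; exact: dotv_itv.
by split.
Qed.

Lemma integrable_zonal_power (f : R -> R) (C : R) : measurable_fun setT f ->
  (forall c : R, -1 <= c <= 1 -> 0 < 1 - c ^+ 2 -> `|f c| <= C * (1 - c ^+ 2) `^ (- (b / 2))) ->
  sigma.-integrable setT (EFin \o (fun x => f 'c_x)).
Proof.
move=> mf fC; have H1 (c : R) : -1 <= c <= 1 -> 0 < 1 - c ^+ 2 -> f c @[_ --> \oo] --> f c.
  by move=> _ _; exact: cvg_cst.
have H2 (c : R) : -1 <= c <= 1 -> 0 < 1 - c ^+ 2 ->
    forall k : nat, `|f c| <= C * (1 - c ^+ 2) `^ (- (b / 2)).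
  by move=> c1 w0 _; exact: fC.
by have [] := @cvg_Rintegral_zonal (fun=> f) f C (fun=> mf) mf H1 H2.
Qed.

(* The divergence theorem for the field |c|^a c sin^-b (Phi - c x). *)
Lemma zonal_power_identity (a : R) : 0 <= a ->
  \int[sigma]_x ((1 - 'c_x ^+ 2) `^ (- (b / 2)) * `|'c_x| `^ a *
     ((n%:R - 1 - b) * 'c_x ^+ 2 - (a + 1) * (1 - 'c_x ^+ 2))) = 0.
Proof.
move=> a0; pose N : R := n%:R - 1.
have N0 : 0 <= N by rewrite /N ltW// (lt_trans b0).
pose e (k : nat) : R := k.+1%:R^-1; have e0 k : 0 < e k by rewrite invr_gt0.
pose f_ k (c : R) := zonal_weight' a b (e k) c * (1 - c ^+ 2) - N * c * zonal_weight a b (e k) c.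
pose f (c : R) := (1 - c ^+ 2) `^ (- (b / 2)) * `|c| `^ a *
    (N * c ^+ 2 - (a + 1) * (1 - c ^+ 2) - b * c ^+ 2).
have m2 : measurable_fun setT (fun c : R => c ^+ 2) by exact: measurable_funX.
have mw : measurable_fun setT (fun c : R => 1 - c ^+ 2) by exact: measurable_funB.
have ma := @measurable_norm_powR R a.
have [||||_ cv] := @cvg_Rintegral_zonal f_ f (N + (a + 1) + b).
- move=> k; apply: measurable_funB; apply: measurable_funM => //.
    exact: measurable_zonal_weight'.
  exact: measurable_zonal_weight.
- apply: measurable_funM.
    by apply: measurable_funM => //; exact: (measurableT_comp (measurable_powR _)).
  apply: measurable_funB; last exact: measurable_funM.
  by apply: measurable_funB; exact: measurable_funM.
- move=> c c1 w0.
  have cD r := @cvg_reg_sin2 R (1 - c ^+ 2) r w0.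
  rewrite /f_; under eq_fun do rewrite zonal_weight_div//.
  apply: cvgM; first by apply: cvgM; [exact: cD|exact: cvg_cst].
  apply: cvgB; first exact: cvg_cst.
  rewrite -[X in _ --> X]mulr1; apply: cvgM; first exact: cvg_cst.
  rewrite -[X in _ --> X](@divff _ (1 - c ^+ 2)) ?gt_eqF//.
  apply: cvgM; first exact: cvg_cst.
  apply: cvgV; first by rewrite gt_eqF.
  have := cD 1; rewrite powRr1 ?(ltW w0)//; apply: cvg_trans.
  apply: near_eq_cvg; apply: nearW => k.
  by rewrite powRr1// addr_ge0 ?(ltW w0)// invr_ge0.
- move=> c c1 w0 k; have /andP[_ w1] := sqr_itv c1.
  have d0 := reg_sin2_gt0 (e0 k) c1.
  have h1 : reg_sin2 (e k) c `^ (- (b / 2)) <= (1 - c ^+ 2) `^ (- (b / 2)).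
    rewrite !powRN lef_pV2 ?posrE ?powR_gt0// ge0_ler_powR ?nnegrE ?(ltW w0) ?(ltW d0)//.
      by rewrite divr_ge0// ltW.
    by rewrite /reg_sin2 lerDr ltW.
  have h2 : `|c| `^ a <= 1 by apply: powR_le1 => //; rewrite normr_ge0 ler_norml.
  have wD : 0 <= (1 - c ^+ 2) / reg_sin2 (e k) c <= 1.
    rewrite divr_ge0 ?(ltW w0) ?(ltW d0)//= ler_pdivrMr// mul1r.
    by rewrite /reg_sin2 lerDr ltW.
  rewrite /f_ zonal_weight_div// normrM mulrC; apply: ler_pM => //; last first.
    rewrite ger0_norm ?mulr_ge0 ?powR_ge0// -[leRHS]mulr1.
    by apply: ler_pM => //; exact: powR_ge0.
  have c20 : 0 <= c ^+ 2 by exact: sqr_ge0.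
  have c21 : c ^+ 2 <= 1 by move: w0; rewrite subr_gt0 => /ltW.
  have a10 : 0 <= a + 1 by rewrite addr_ge0.
  case/andP: wD; set wd := _ / _ => wd0 wd1.
  rewrite (le_trans (ler_normB _ _))// lerD//.
    rewrite (le_trans (ler_normB _ _))// lerD//.
      by rewrite (ger0_norm (mulr_ge0 N0 c20)) ler_piMr.
    by rewrite (ger0_norm (mulr_ge0 a10 (ltW w0))) ler_piMr.
  have p01 : 0 <= c ^+ 2 * wd <= 1 by rewrite mulr_ge0//= mulr_ile1.
  case/andP: p01 => p0 p1; have bb := ltW b0.
  by rewrite -mulrA (ger0_norm (mulr_ge0 bb p0)) ler_piMr.
(* For u = 1 the gradient term of [zonal_parts_powR] vanishes and only the divergence is left. *)
have z k : \int[sigma]_x f_ k 'c_x = 0.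
  have [_ I0] := zonal_parts_powR SPhi b1 (integrable_surface_cst 1) i1 (is_surface_grad1 SPhi) i0
    (measurable_zonal_weight a b (e k)) (measurable_zonal_weight' a b (e k))
    (fun c => @is_derive_zonal_weight R a b (e k) c a0 (e0 k))
    (fun c => @continuous_zonal_weight' R a b (e k) c a0 (e0 k)).
  rewrite -[RHS]I0; apply: eq_Rintegral => x _.
  have d0 (v : 'rV[R]_n) : dotv (cst (0 : 'rV[R]_n) x) v = 0.
    by rewrite /dotv big1// => i _; rewrite mxE mul0r.
  by rewrite /f_ /N d0 /= !mulr0 add0r normr1 powR1 mul1r.
have -> : \int[sigma]_x ((1 - 'c_x ^+ 2) `^ (- (b / 2)) * `|'c_x| `^ a *
     ((n%:R - 1 - b) * 'c_x ^+ 2 - (a + 1) * (1 - 'c_x ^+ 2))) = \int[sigma]_x f 'c_x.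
  by apply: eq_Rintegral => x _; rewrite /f /N; ring.
have zE : (fun k => \int[sigma]_x f_ k 'c_x) = cst 0 by apply/funext.
by rewrite zE in cv; exact: (cvg_unique (@Rhausdorff R) cv (cvg_cst _)).
Qed.

(** If the integral were 0, then c = 0 almost everywhere, and [zonal_power_identity] with a = 0
    would read - sigma = 0 for the total mass. *)
Lemma zonal_power_gt0 (r : R) : 0 <= r ->
  0 < \int[sigma]_x (`|'c_x| `^ r * (1 - 'c_x ^+ 2) `^ (- (b / 2))).
Proof.
move=> r0; pose f (c : R) := `|c| `^ r * (1 - c ^+ 2) `^ (- (b / 2)).
have mw : measurable_fun setT (fun c : R => 1 - c ^+ 2).
  by apply: measurable_funB => //; exact: measurable_funX.
have mf : measurable_fun setT f.
  apply: measurable_funM; first exact: measurable_norm_powR.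
  exact: (measurableT_comp (measurable_powR _) mw).
have f0 c : 0 <= f c by rewrite mulr_ge0 ?powR_ge0.
have if_ : sigma.-integrable setT (EFin \o (fun x => f 'c_x)).
  apply: (@integrable_zonal_power f 1 mf) => c c1 w0.
  rewrite ger0_norm// ler_wpM2r ?powR_ge0//; apply: powR_le1 => //.
  by rewrite normr_ge0 ler_norml.
have I0 : 0 <= \int[sigma]_x f 'c_x by apply: Rintegral_ge0 => // x _; exact: f0.
rewrite lt_neqAle I0 andbT eq_sym; apply/negP => /eqP Iz.
have /ae_eq_integral_abs E : (\int[sigma]_x `|(f 'c_x)%:E| = 0)%E.
  rewrite -[RHS](congr1 EFin Iz) /Rintegral fineK; last exact: (integrable_fin_num measurableT if_).
  by apply: eq_integral => x _; rewrite gee0_abs// lee_fin.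
have {}E : {ae sigma, forall x, 'c_x = 0}.
  have := E measurableT (measurable_int _ if_).
  apply: filterS2 (ae_not_pole n4 SPhi) => x w0 /(_ I) [] /eqP.
  rewrite /f mulf_eq0 [X in _ || X]gt_eqF ?powR_gt0// orbF powR_eq0 normr_eq0.
  by move=> /andP[/eqP].
have := zonal_power_identity (lexx 0).
have mI : measurable_fun setT (fun x => (1 - 'c_x ^+ 2) `^ (- (b / 2)) * `|'c_x| `^ 0 *
     ((n%:R - 1 - b) * 'c_x ^+ 2 - (0 + 1) * (1 - 'c_x ^+ 2))).
  have mc := measurable_dotvl Phi; have ms := measurable_sin2 Phi.
  apply: measurable_funM.
    apply: measurable_funM; first exact: (measurableT_comp (measurable_powR _) ms).
    exact: (measurableT_comp (measurable_norm_powR 0) mc).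
  by apply: measurable_funB; apply: measurable_funM => //; exact: measurable_funX.
rewrite (@ae_eq_Rintegral _ _ _ sigma _ (cst (-1)) mI (measurable_cst _)); last first.
  by apply: filterS E => x ->; rewrite expr0n /= subr0 powR1 powRr0; ring.
rewrite Rintegral_cst// mulN1r => /eqP; rewrite oppr_eq0 => /eqP s0.
have : (0 < sigma setT)%E by apply: surface_measure_gt0; exact: leq_trans n4.
by rewrite -[X in (_ < X)%E]fineK ?fin_num_measure// [fine _]s0 ltxx.
Qed.

End power_weights.

(** * Regularized profiles and bounds uniform in eps *)

Section test_profiles.
Context {R : realType}.
Implicit Types (c eps bet gam : R).

(** The parameter eps is added to c^2 as well, because |c|^gam has no derivative at the equator when
    0 < gam <= 1. *)
Definition profile gam bet eps c : R :=
  (eps + c ^+ 2) `^ (gam / 2) * reg_sin2 eps c `^ (- (bet / 2)).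

Definition profile' gam bet eps c : R :=
  gam * c * (eps + c ^+ 2) `^ (gam / 2 - 1) * reg_sin2 eps c `^ (- (bet / 2)) +
  (eps + c ^+ 2) `^ (gam / 2) * (bet * c * reg_sin2 eps c `^ (- (bet / 2) - 1)).

Lemma powR_mulB1 (x r : R) : 0 < x -> x * x `^ (r - 1) = x `^ r.
Proof.
move=> x0; have := powRD (x := x) (r := 1) (s := r - 1).
rewrite (gt_eqF x0) implybT => /(_ isT); rewrite powRr1 ?(ltW x0)// => <-.
by congr powR; ring.
Qed.

Lemma reg_cos2_gt0 eps c : 0 < eps -> 0 < eps + c ^+ 2.
Proof. by move=> e0; rewrite ltr_wpDr// sqr_ge0. Qed.

Lemma is_derive_reg_cos2 eps a c : 0 < eps ->
  is_derive c (1 : R) (fun r => (eps + r ^+ 2) `^ (a / 2)) (a * c * (eps + c ^+ 2) `^ (a / 2 - 1)).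
Proof.
move=> e0; have d0 := reg_cos2_gt0 c e0.
have d1 : is_derive c (1 : R) (fun r => eps + r ^+ 2) (2 * c).
  have -> : (fun r => eps + r ^+ 2) = cst eps + (@id R) * (@id R).
    by apply/funext => r; rewrite expr2.
  have [dd ee] := is_deriveD (is_derive_cst eps c 1)
    (is_deriveM (is_derive_id c 1) (is_derive_id c (1 : R))).
  by split=> //; rewrite ee /GRing.scale/=; ring.
have := @is_derive1_comp _ (fun r => r `^ (a / 2)) (fun r => eps + r ^+ 2) c _ _
  (is_derive_powR (a / 2) d0) d1.
by congr is_derive; field.
Qed.

Lemma is_derive_profile gam bet eps c : 0 < eps -> -1 <= c <= 1 ->
  is_derive c (1 : R) (profile gam bet eps) (profile' gam bet eps c).
Proof.
move=> e0 c1; have d1 := is_derive_reg_cos2 gam c e0; have d2 := is_derive_reg_sin2 bet e0 c1.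
have [dd ee] := is_deriveM d1 d2.
by split=> //; rewrite ee /profile' /GRing.scale/=; ring.
Qed.

Lemma continuous_reg_cos2 eps a c : 0 < eps -> {for c, continuous (fun r : R => (eps + r ^+ 2) `^ a)}.
Proof.
move=> e0; have := is_derive_reg_cos2 (2 * a) c e0.
rewrite (_ : 2 * a / 2 = a); last by field.
by move=> d; apply/differentiable_continuous/derivable1_diffP; exact: ex_derive.
Qed.

Lemma continuous_profile' gam bet eps c : 0 < eps -> -1 <= c <= 1 ->
  {for c, continuous (profile' gam bet eps)}.
Proof.
move=> e0 c1; have cid : {for c, continuous (@id R)} by [].
have cC r := @continuous_reg_cos2 eps r c e0.
have cD r := @continuous_reg_sin2 R eps r c e0 c1.
have lin (a : R) : {for c, continuous (fun r => a * r)} by apply: cvgM; [exact: cvg_cst|exact: cid].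
apply: cvgD.
  by apply: cvgM; [apply: cvgM; [exact: lin|exact: cC]|exact: cD].
by apply: cvgM; [exact: cC|apply: cvgM; [exact: lin|exact: cD]].
Qed.

Lemma measurable_reg_cos2 eps a : measurable_fun setT (fun c : R => (eps + c ^+ 2) `^ a).
Proof.
apply: (measurableT_comp (measurable_powR _)).
by apply: measurable_funD => //; exact: measurable_funX.
Qed.

Lemma measurable_profile gam bet eps : measurable_fun setT (profile gam bet eps).
Proof. by apply: measurable_funM; [exact: measurable_reg_cos2|exact: measurable_reg_sin2]. Qed.

Lemma measurable_profile' gam bet eps : measurable_fun setT (profile' gam bet eps).
Proof.
have lin (a : R) : measurable_fun setT (fun c : R => a * c) by exact: measurable_funM.
apply: measurable_funD.
  apply: measurable_funM; last exact: measurable_reg_sin2.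
  by apply: measurable_funM => //; exact: measurable_reg_cos2.
apply: measurable_funM; first exact: measurable_reg_cos2.
by apply: measurable_funM => //; exact: measurable_reg_sin2.
Qed.

Lemma profile_gt0 gam bet eps c : 0 < eps -> -1 <= c <= 1 -> 0 < profile gam bet eps c.
Proof.
by move=> e0 c1; rewrite mulr_gt0 ?powR_gt0 ?reg_sin2_gt0 ?reg_cos2_gt0.
Qed.

Lemma powRN_anti (x y r : R) : 0 < x -> x <= y -> 0 <= r -> y `^ (- r) <= x `^ (- r).
Proof.
move=> x0 xy r0; have y0 := lt_le_trans x0 xy.
by rewrite !powRN lef_pV2 ?posrE ?powR_gt0// ge0_ler_powR ?nnegrE ?(ltW x0) ?(ltW y0).
Qed.

Lemma reg_sin2_powR_le eps c r : 0 < eps -> 0 < 1 - c ^+ 2 -> 0 <= r ->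
  reg_sin2 eps c `^ (- r) <= (1 - c ^+ 2) `^ (- r).
Proof. by move=> e0 w0 r0; apply: powRN_anti => //; rewrite /reg_sin2 lerDr ltW. Qed.

Lemma reg_cos2_powR_le eps c r : 0 < eps <= 1 -> -1 <= c <= 1 -> 0 <= r ->
  (eps + c ^+ 2) `^ r <= 2 `^ r.
Proof.
move=> /andP[e0 e1] c1 r0; have /andP[w0 w1] := sqr_itv c1.
rewrite ge0_ler_powR ?nnegrE ?(ltW (reg_cos2_gt0 c e0))//; lra.
Qed.

(** For gam < 2 the exponent gam/2 - 1 is negative, and the power is not bounded uniformly in eps
    near the equator; the factor c^2 absorbs it. *)
Lemma sqr_powR_cos2 eps c gam : 0 < eps ->
  c ^+ 2 * (eps + c ^+ 2) `^ (gam / 2 - 1) <= (eps + c ^+ 2) `^ (gam / 2).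
Proof.
move=> e0; have d0 := reg_cos2_gt0 c e0.
by rewrite -(powR_mulB1 (gam / 2) d0) ler_wpM2r ?powR_ge0// lerDr ltW.
Qed.

Lemma cvg_harmonicD c : k.+1%:R^-1 + c @[k --> \oo] --> c.
Proof.
rewrite -[X in _ --> X]add0r; apply: cvgD; last exact: cvg_cst.
exact: cvg_harmonic.
Qed.

Lemma cvg_reg_cos2 c gam : 0 <= gam ->
  (k.+1%:R^-1 + c ^+ 2) `^ (gam / 2) @[k --> \oo] --> `|c| `^ gam.
Proof.
move=> g0; have g20 : 0 <= gam / 2 by rewrite divr_ge0.
have -> : `|c| `^ gam = `|c ^+ 2| `^ (gam / 2).
  by rewrite normrX -powR_mulrn// -powRrM; congr powR; field.
have := @cvg_comp _ _ _ (fun k : nat => k.+1%:R^-1 + c ^+ 2) (fun t : R => `|t| `^ (gam / 2)) _ _ _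
  (@cvg_harmonicD (c ^+ 2)) (continuous_norm_powR g20 (x := c ^+ 2)).
apply: cvg_trans; apply: near_eq_cvg; apply: nearW => k /=.
by rewrite ger0_norm// ltW// reg_cos2_gt0// invr_gt0.
Qed.

Lemma cvg_profile gam bet c : 0 <= gam -> 0 < 1 - c ^+ 2 ->
  profile gam bet k.+1%:R^-1 c @[k --> \oo] --> `|c| `^ gam * (1 - c ^+ 2) `^ (- (bet / 2)).
Proof. by move=> g0 w0; apply: cvgM; [exact: cvg_reg_cos2|exact: cvg_reg_sin2]. Qed.

Lemma profile_le gam bet eps c : 0 <= gam -> 0 <= bet -> 0 < eps <= 1 -> -1 <= c <= 1 ->
  0 < 1 - c ^+ 2 ->
  `|profile gam bet eps c| <= 2 `^ (gam / 2) * (1 - c ^+ 2) `^ (- (bet / 2)).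
Proof.
move=> g0 b0 e01 c1 w0; have /andP[e0 e1] := e01.
rewrite gtr0_norm ?profile_gt0//; apply: ler_pM; rewrite ?powR_ge0//.
  by apply: reg_cos2_powR_le; rewrite ?divr_ge0.
by apply: reg_sin2_powR_le; rewrite ?divr_ge0.
Qed.

(** The factor c comes from |cos d|^p in G. For 0 < gam < 1 the derivative alone would not be
    bounded uniformly in eps near the equator. *)
Lemma cvg_profile'M gam bet c : 0 <= gam -> 0 < 1 - c ^+ 2 ->
  profile' gam bet k.+1%:R^-1 c * c @[k --> \oo] -->
  `|c| `^ gam * (gam * (1 - c ^+ 2) + bet * c ^+ 2) * (1 - c ^+ 2) `^ (- (bet / 2) - 1).
Proof.
move=> g0 w0; set w := 1 - c ^+ 2 in w0 *.
have E k : profile' gam bet k.+1%:R^-1 c * c =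
    gam * (c ^+ 2 * (k.+1%:R^-1 + c ^+ 2) `^ (gam / 2 - 1)) * (k.+1%:R^-1 + w) `^ (- (bet / 2)) +
    (k.+1%:R^-1 + c ^+ 2) `^ (gam / 2) * (bet * c ^+ 2 * (k.+1%:R^-1 + w) `^ (- (bet / 2) - 1)).
  by rewrite /profile' /reg_sin2 -/w; ring.
rewrite (funext E).
have -> : `|c| `^ gam * (gam * w + bet * c ^+ 2) * w `^ (- (bet / 2) - 1) =
    gam * `|c| `^ gam * w `^ (- (bet / 2)) + `|c| `^ gam * (bet * c ^+ 2 * w `^ (- (bet / 2) - 1)).
  by rewrite -(powR_mulB1 (- (bet / 2)) w0); ring.
apply: cvgD; last first.
  by apply: cvgM; [exact: cvg_reg_cos2|apply: cvgM; [exact: cvg_cst|exact: cvg_reg_sin2]].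
apply: cvgM; last exact: cvg_reg_sin2.
(* For gam = 0 and c = 0 the limit of c^2 (...) is 0 while |c|^gam is 0^0 = 1; the coefficient gam
   makes both sides vanish. *)
have [->|gn] := eqVneq gam 0.
  by rewrite (mul0r (`|c| `^ 0)); under eq_fun do rewrite mul0r; exact: cvg_cst.
apply: cvgM; first exact: cvg_cst.
have [->|c0] := eqVneq c 0.
  rewrite normr0 powR0//; under eq_fun do rewrite expr0n mul0r.
  exact: cvg_cst.
have c20 : 0 < c ^+ 2 by rewrite exprn_even_gt0.
have -> : `|c| `^ gam = c ^+ 2 * (c ^+ 2) `^ (gam / 2 - 1).
  rewrite powR_mulB1// -[in RHS](real_normK (num_real c)) -powR_mulrn// -powRrM.
  by congr powR; field.
by apply: cvgM; [exact: cvg_cst|exact: cvg_reg_sin2].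
Qed.

(** The p-th power of the bound is a multiple of sin^(-(bet p + p)) d, the integrable weight that
    dominates all functionals of the test functions. *)
Lemma norm_profile'M_le gam bet eps c : 0 <= gam -> 0 <= bet -> 0 < eps <= 1 -> -1 <= c <= 1 ->
  0 < 1 - c ^+ 2 ->
  `|profile' gam bet eps c * c| * Num.sqrt (1 - c ^+ 2) <=
  2 `^ (gam / 2) * (gam + bet) * (1 - c ^+ 2) `^ (- ((bet + 1) / 2)).
Proof.
move=> g0 b0 e01 c1 w0; have /andP[e0 e1] := e01; have /andP[_ w1] := sqr_itv c1.
set w := 1 - c ^+ 2 in w0 w1 *.
have d0 : 0 < reg_sin2 eps c by exact: reg_sin2_gt0.
have wD : w <= reg_sin2 eps c by rewrite /reg_sin2 -/w lerDr ltW.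
have b20 : 0 <= bet / 2 by rewrite divr_ge0.
have cle : (eps + c ^+ 2) `^ (gam / 2) <= 2 `^ (gam / 2).
  by apply: reg_cos2_powR_le; rewrite ?divr_ge0.
have sq : Num.sqrt w = w `^ 2^-1 by rewrite powR12_sqrt// ltW.
have s0 := powR_ge0 w 2^-1.
have h1 : reg_sin2 eps c `^ (- (bet / 2)) * w `^ 2^-1 <= w `^ (- ((bet + 1) / 2)).
  rewrite (le_trans (y := w `^ (- (bet / 2)) * 1))//.
    apply: ler_pM; rewrite ?powR_ge0//; first exact: reg_sin2_powR_le.
    by apply: powR_le1; rewrite ?(ltW w0) ?w1 ?invr_ge0.
  rewrite mulr1 !powRN lef_pV2 ?posrE ?powR_gt0//.
  by apply: ger_powR; rewrite ?w0 ?w1// ler_wpM2r ?invr_ge0// lerDl.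
have h2 : reg_sin2 eps c `^ (- (bet / 2) - 1) * w `^ 2^-1 <= w `^ (- ((bet + 1) / 2)).
  have -> : w `^ (- ((bet + 1) / 2)) = w `^ (- (bet / 2 + 1)) * w `^ 2^-1.
    rewrite -powRD ?(gt_eqF w0) ?implybT//; congr powR; by field.
  rewrite -opprD ler_wpM2r//; apply: powRN_anti => //.
  by rewrite addr_ge0.
have E : profile' gam bet eps c * c =
    gam * (c ^+ 2 * (eps + c ^+ 2) `^ (gam / 2 - 1)) * reg_sin2 eps c `^ (- (bet / 2)) +
    (eps + c ^+ 2) `^ (gam / 2) * (bet * c ^+ 2 * reg_sin2 eps c `^ (- (bet / 2) - 1)).
  by rewrite /profile'; ring.
have c2 : 0 <= c ^+ 2 <= 1 by rewrite sqr_ge0 /=; move: w0; rewrite subr_gt0 => /ltW.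
case/andP: c2 => c20 c21.
have pc r := powR_ge0 (eps + c ^+ 2) r; have pd r := powR_ge0 (reg_sin2 eps c) r.
have ->: `|profile' gam bet eps c * c| = profile' gam bet eps c * c.
  rewrite ger0_norm// E; apply: addr_ge0.
    exact: mulr_ge0 (mulr_ge0 g0 (mulr_ge0 c20 (pc _))) (pd _).
  exact: mulr_ge0 (pc _) (mulr_ge0 (mulr_ge0 b0 c20) (pd _)).
rewrite E sq mulrDl mulrDr mulrDl; apply: lerD.
  rewrite -(mulrA (gam * _)) [2 `^ _ * gam]mulrC; apply: ler_pM => //.
  - exact: mulr_ge0 g0 (mulr_ge0 c20 (pc _)).
  - exact: mulr_ge0 (pd _) s0.
  - by rewrite ler_wpM2l// (le_trans (sqr_powR_cos2 c gam e0)).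
rewrite -[leRHS]mulrA.
have -> (x y z : R) : x * (bet * c ^+ 2 * y) * z = x * (bet * (c ^+ 2 * (y * z))) by ring.
apply: ler_pM => //; first exact: mulr_ge0 b0 (mulr_ge0 c20 (mulr_ge0 (pd _) s0)).
rewrite ler_wpM2l//; apply: le_trans h2.
by rewrite ler_piMl// mulr_ge0 ?powR_ge0.
Qed.

Lemma norm_profile'0 bet eps c : profile' 0 bet eps c = bet * c * reg_sin2 eps c `^ (- (bet / 2) - 1).
Proof. by rewrite /profile' !mul0r add0r powRr0 mul1r. Qed.

Lemma norm_profile'0_le bet eps c : 0 <= bet -> 0 < eps -> -1 <= c <= 1 -> 0 < 1 - c ^+ 2 ->
  `|profile' 0 bet eps c| * Num.sqrt (1 - c ^+ 2) <= bet * (1 - c ^+ 2) `^ (- ((bet + 1) / 2)).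
Proof.
move=> b0 e0 c1 w0; rewrite norm_profile'0; set w := 1 - c ^+ 2 in w0 *.
have wD : w <= reg_sin2 eps c by rewrite /reg_sin2 -/w lerDr ltW.
rewrite !normrM (ger0_norm b0) (ger0_norm (powR_ge0 _ _)) -!mulrA ler_wpM2l//.
have -> : w `^ (- ((bet + 1) / 2)) = w `^ (- (bet / 2 + 1)) * w `^ 2^-1.
  by rewrite -powRD ?(gt_eqF w0) ?implybT//; congr powR; field.
rewrite -powR12_sqrt ?(ltW w0)//.
apply: (le_trans (y := reg_sin2 eps c `^ (- (bet / 2) - 1) * w `^ 2^-1)).
  by rewrite ler_piMl ?mulr_ge0 ?powR_ge0// ler_norml.
rewrite -opprD ler_wpM2r ?powR_ge0//; apply: powRN_anti => //.
by rewrite addr_ge0// divr_ge0.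
Qed.

End test_profiles.

Section test_functions.
Context {R : realType} {n : nat}.
Implicit Types (x : 'rV[R]_n) (u : 'rV[R]_n -> R).
Local Notation sigma := (@surface_measure R n).
Variable Phi : 'rV[R]_n.
Hypotheses (n4 : (4 <= n)%N) (SPhi : usphere Phi).
Local Notation "'c_ x" := (dotv Phi x) (at level 8, x at level 2).

(** This and the next five are real-valued forms of the functionals, with sin d written through c;
    [sin_functionalsE] and [tan_functionalsE] identify them with the originals on Sobolev
    functions. *)
Definition sinS p u : R := \int[sigma]_x (`|u x| `^ p * (1 - 'c_x ^+ 2) `^ (- (p / 2))).
Definition sinSt p u : R := \int[sigma]_x (`|u x| `^ p * (1 - 'c_x ^+ 2) `^ (- ((p - 2) / 2))).
Definition tanT p u : R :=
  \int[sigma]_x (`|u x| `^ p * (`|'c_x| `^ p * (1 - 'c_x ^+ 2) `^ (- (p / 2)))).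
Definition tanTt p u : R :=
  \int[sigma]_x (`|u x| `^ p * (`|'c_x| `^ (p - 2) * (1 - 'c_x ^+ 2) `^ (- ((p - 2) / 2)))).
Definition gradF p u : R := \int[sigma]_x (enorm (surface_grad u x) `^ p).
Definition gradG p u : R := \int[sigma]_x (enorm (surface_grad u x) `^ p * `|'c_x| `^ p).

Lemma zonal_sobolev (h h' : R -> R) (p : R) : 1 <= p ->
  measurable_fun setT h -> measurable_fun setT h' ->
  (forall c : R, -1 <= c <= 1 -> is_derive c (1 : R) h (h' c)) ->
  (forall c : R, -1 <= c <= 1 -> {for c, continuous h'}) ->
  sobolev p (fun x => h 'c_x) /\
  {ae sigma, forall x, enorm (surface_grad (fun x => h 'c_x) x) = `|h' 'c_x| * Num.sqrt (1 - 'c_x ^+ 2)}.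
Proof.
move=> p1 mh mh' dh ch'; have p0 : 0 <= p by rewrite (le_trans ler01).
have mc := measurable_dotvl Phi.
have ch (c : R) : -1 <= c <= 1 -> {for c, continuous h}.
  by move=> /dh dhc; apply/differentiable_continuous/derivable1_diffP; exact: ex_derive.
have [M M0 hM] := bounded_itv ch; have [M' M'0 hM'] := bounded_itv ch'.
have mhc := measurableT_comp mh mc; have mhc' := measurableT_comp mh' mc.
have uL : (fun x => h 'c_x) \in Lfun sigma p%:E.
  apply: Lfun_powR_integrable => //; apply: (@integrable_bounded _ _ _ (M `^ p)).
    by apply: (measurableT_comp (measurable_powR _)); exact: measurableT_comp.
  move=> x Sx; rewrite ger0_norm ?powR_ge0// ge0_ler_powR ?nnegrE// hM//.
  exact: dotv_itv.
have gP := zonal_surface_grad SPhi mh mh' dh ch'.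
have nP x : usphere x -> enorm (h' 'c_x *: zonal_field Phi x) = `|h' 'c_x| * Num.sqrt (1 - 'c_x ^+ 2).
  by move=> Sx; rewrite enormZ enorm_zonal_field.
have [|su E] := sobolev_surface_grad p1 uL gP.
  apply: (@integrable_bounded _ _ _ (M' `^ p)).
    apply: (measurableT_comp (measurable_powR _)); apply: measurable_fun_enorm => k.
    exact: integrable_Rmeasurable (is_surface_grad_integrable k gP).
  move=> x Sx; rewrite ger0_norm ?powR_ge0// ge0_ler_powR ?nnegrE ?enorm_ge0// nP//.
  have c1 := dotv_itv SPhi Sx; have /andP[w0 w1] := sqr_itv c1.
  rewrite -[leRHS]mulr1; apply: ler_pM; rewrite ?sqrtr_ge0 ?hM'//.
  by rewrite -[leRHS]sqrtr1 ler_wsqrtr.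
by split=> //; apply: filterS2 ae_usphere E => x Sx ->; exact: nP.
Qed.

Section family.
Variables (p bet : R).
Hypotheses (p1 : 1 < p) (bet0 : 0 < bet) (bn : bet * p + p < n%:R - 1).

Let p0 : 0 < p. Proof. exact: lt_trans ltr01 p1. Qed.

(** The exponent of 1 / sin d in |u|^p / sin^p d for the limit profile. The hypothesis b < n - 1 is
    bet < al. *)
Let b : R := bet * p + p.

Let b1 : 1 < b. Proof. by rewrite /b (lt_le_trans p1)// lerDr mulr_ge0// ltW. Qed.

Let e (k : nat) : R := k.+1%:R^-1.

Let e0 k : 0 < e k. Proof. by rewrite invr_gt0. Qed.

Let e01 k : 0 < e k <= 1. Proof. by rewrite e0 /e invf_le1// ler1n. Qed.

Let test (gam : R) (k : nat) x : R := profile gam bet (e k) 'c_x.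

Definition sin_moment (r : R) : R := \int[sigma]_x (`|'c_x| `^ r * (1 - 'c_x ^+ 2) `^ (- (b / 2))).

(** The prime marks the additional factor sin^2 d that S~ and T~ have over S and T; it is not a
    derivative. *)
Definition sin_moment' (r : R) : R :=
  \int[sigma]_x (`|'c_x| `^ r * (1 - 'c_x ^+ 2) `^ (- (b / 2)) * (1 - 'c_x ^+ 2)).

Lemma test_sobolev gam k : sobolev p (test gam k) /\
  {ae sigma, forall x, enorm (surface_grad (test gam k) x) =
    `|profile' gam bet (e k) 'c_x| * Num.sqrt (1 - 'c_x ^+ 2)}.
Proof.
apply: zonal_sobolev; rewrite ?(ltW p1)//.
- exact: measurable_profile.
- exact: measurable_profile'.
- by move=> c c1; exact: is_derive_profile.
- by move=> c c1; exact: continuous_profile'.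
Qed.

Lemma test_neq0 gam k : ~ {ae sigma, forall x, test gam k x = 0}.
Proof.
move=> t0; have [N [mN N0 HN]] : {ae sigma, forall x, False}.
  apply: filterS2 ae_usphere t0 => x Sx /eqP.
  by rewrite gt_eqF//; apply: profile_gt0 => //; exact: dotv_itv.
have : (0 < sigma setT)%E by apply: surface_measure_gt0; exact: leq_trans n4.
suff -> : [set: 'rV[R]_n] = N by rewrite [X in (_ < X)%E]N0 ltxx.
by apply/seteqP; split => // x _; apply: HN.
Qed.

(** The exponent b of the dominating weight is shared between the p-th power of [v_ k] and the
    factor g: (be, q) is (bet, p) for the functionals of u and (bet + 1, 0) for those of its
    gradient. *)
Lemma cvg_Rintegral_powR (v_ : nat -> R -> R) (v g f : R -> R) (C be q : R) :
  0 <= C -> b = be * p + q ->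
  (forall k, measurable_fun setT (v_ k)) -> measurable_fun setT g -> measurable_fun setT f ->
  (forall c : R, -1 <= c <= 1 -> 0 < 1 - c ^+ 2 ->
    [/\ v_ k c @[k --> \oo] --> v c,
        forall k, `|v_ k c| <= C * (1 - c ^+ 2) `^ (- (be / 2)),
        `|g c| <= (1 - c ^+ 2) `^ (- (q / 2)) & f c = `|v c| `^ p * g c]) ->
  \int[sigma]_x (`|v_ k 'c_x| `^ p * g 'c_x) @[k --> \oo] --> \int[sigma]_x f 'c_x.
Proof.
move=> C0 bE mv mg mf H.
apply: (proj2 (@cvg_Rintegral_zonal R n Phi n4 SPhi b b1 bn
  (fun k c => `|v_ k c| `^ p * g c) f (C `^ p) _ mf _ _)).
- move=> k; apply: measurable_funM => //; apply: (measurableT_comp (measurable_powR _)).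
  exact: measurableT_comp.
- move=> c c1 w0; have [cv _ _ ->] := H c c1 w0.
  apply: cvgM; last exact: cvg_cst.
  exact: (@cvg_comp _ _ _ (fun k => v_ k c) (fun t => `|t| `^ p) _ _ _ cv (continuous_norm_powR (ltW p0) (x := v c))).
- move=> c c1 w0 k; have [_ /(_ k) vC gC _] := H c c1 w0.
  rewrite normrM (ger0_norm (powR_ge0 _ _)).
  have -> : C `^ p * (1 - c ^+ 2) `^ (- (b / 2)) =
      (C * (1 - c ^+ 2) `^ (- (be / 2))) `^ p * (1 - c ^+ 2) `^ (- (q / 2)).
    rewrite powRM ?powR_ge0// -powRrM -mulrA -powRD ?(gt_eqF w0) ?implybT//.
    by congr (_ * _ `^ _); rewrite bE; field.
  apply: ler_pM; rewrite ?powR_ge0//.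
  by rewrite ge0_ler_powR ?nnegrE ?(ltW p0)// mulr_ge0 ?powR_ge0.
Qed.

Let mw : measurable_fun setT (fun c : R => 1 - c ^+ 2).
Proof. by apply: measurable_funB => //; exact: measurable_funX. Qed.

Let mwr r : measurable_fun setT (fun c : R => (1 - c ^+ 2) `^ r).
Proof. exact: (measurableT_comp (measurable_powR _) mw). Qed.

Let mr := @measurable_norm_powR R.

Let norm_powR1 (c r : R) : 0 <= r -> -1 <= c <= 1 -> `|c| `^ r <= 1.
Proof. by move=> r0 c1; apply: powR_le1 => //; rewrite normr_ge0 ler_norml. Qed.

Lemma cvg_test_weight gam (g f : R -> R) : 0 <= gam ->
  measurable_fun setT g -> measurable_fun setT f ->
  (forall c : R, -1 <= c <= 1 -> 0 < 1 - c ^+ 2 -> `|g c| <= (1 - c ^+ 2) `^ (- (p / 2)) /\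
     f c = (`|c| `^ (gam * p) * (1 - c ^+ 2) `^ (- (bet * p / 2))) * g c) ->
  \int[sigma]_x (`|test gam k x| `^ p * g 'c_x) @[k --> \oo] --> \int[sigma]_x f 'c_x.
Proof.
move=> g0 mg mf H.
apply: (@cvg_Rintegral_powR (fun k => profile gam bet (e k))
  (fun c => `|c| `^ gam * (1 - c ^+ 2) `^ (- (bet / 2))) g f (2 `^ (gam / 2)) bet p) => //.
- by move=> k; exact: measurable_profile.
move=> c c1 w0; have [gC ->] := H c c1 w0; split=> //.
- exact: cvg_profile.
- by move=> k; apply: profile_le => //; exact: ltW.
- have c0 := powR_ge0 `|c| gam; have w00 := powR_ge0 (1 - c ^+ 2) (- (bet / 2)).
  rewrite (ger0_norm (mulr_ge0 c0 w00)) (powRM _ c0 w00) -!powRrM.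
  by rewrite (_ : - (bet / 2) * p = - (bet * p / 2))//; field.
Qed.

Let wpD (w r s : R) : 0 < w -> w `^ r * w `^ s = w `^ (r + s).
Proof. by move=> w0; rewrite powRD// (gt_eqF w0) implybT. Qed.

Let wE (w : R) : 0 < w -> w `^ (- (p / 2)) * w = w `^ (- ((p - 2) / 2)).
Proof.
move=> w0; rewrite mulrC -(powR_mulB1 (- ((p - 2) / 2)) w0).
by rewrite (_ : - ((p - 2) / 2) - 1 = - (p / 2))//; field.
Qed.

Let wb (w : R) : 0 < w -> w `^ (- (bet * p / 2)) * w `^ (- (p / 2)) = w `^ (- (b / 2)).
Proof. by move=> w0; rewrite wpD//; congr powR; rewrite /b; field. Qed.

Let wb' (w : R) : 0 < w -> w `^ (- (bet * p / 2)) * w `^ (- ((p - 2) / 2)) = w `^ (- (b / 2)) * w.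
Proof. by move=> w0; rewrite -wE// mulrA wb. Qed.

Let wle (w : R) : 0 < w -> w <= 1 -> w `^ (- ((p - 2) / 2)) <= w `^ (- (p / 2)).
Proof. by move=> w0 w1; rewrite -wE// ler_piMr ?powR_ge0. Qed.

Lemma cvg_sinS gam : 0 <= gam -> sinS p (test gam k) @[k --> \oo] --> sin_moment (gam * p).
Proof.
move=> g0; apply: (@cvg_test_weight gam (fun c => (1 - c ^+ 2) `^ (- (p / 2)))
  (fun c => `|c| `^ (gam * p) * (1 - c ^+ 2) `^ (- (b / 2)))) => //.
  by apply: measurable_funM.
by move=> c c1 w0; split; rewrite ?(ger0_norm (powR_ge0 _ _))// -mulrA wb.
Qed.

Lemma cvg_sinSt gam : 0 <= gam -> sinSt p (test gam k) @[k --> \oo] --> sin_moment' (gam * p).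
Proof.
move=> g0; apply: (@cvg_test_weight gam (fun c => (1 - c ^+ 2) `^ (- ((p - 2) / 2)))
  (fun c => `|c| `^ (gam * p) * (1 - c ^+ 2) `^ (- (b / 2)) * (1 - c ^+ 2))) => //.
  by apply: measurable_funM => //; exact: measurable_funM.
move=> c c1 w0; have /andP[_ w1] := sqr_itv c1.
split; last by rewrite -[LHS]mulrA -[RHS]mulrA wb'.
by rewrite ger0_norm ?powR_ge0// wle.
Qed.

Lemma cvg_tanT : tanT p (test 0 k) @[k --> \oo] --> sin_moment p.
Proof.
apply: (@cvg_test_weight 0 (fun c => `|c| `^ p * (1 - c ^+ 2) `^ (- (p / 2)))
  (fun c => `|c| `^ p * (1 - c ^+ 2) `^ (- (b / 2)))) => //; try exact: measurable_funM.
move=> c c1 w0; split.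
  by rewrite ger0_norm ?mulr_ge0 ?powR_ge0// ler_piMl ?powR_ge0// norm_powR1// ltW.
by rewrite mul0r powRr0 mul1r -wb//; ring.
Qed.

Lemma cvg_tanTt : 2 <= p -> tanTt p (test 0 k) @[k --> \oo] --> sin_moment' (p - 2).
Proof.
move=> p2; apply: (@cvg_test_weight 0 (fun c => `|c| `^ (p - 2) * (1 - c ^+ 2) `^ (- ((p - 2) / 2)))
  (fun c => `|c| `^ (p - 2) * (1 - c ^+ 2) `^ (- (b / 2)) * (1 - c ^+ 2))) => //.
- exact: measurable_funM.
- by apply: measurable_funM => //; exact: measurable_funM.
move=> c c1 w0; have /andP[_ w1] := sqr_itv c1; split.
  rewrite ger0_norm ?mulr_ge0 ?powR_ge0// (le_trans _ (wle w0 w1))//.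
  by rewrite ler_piMl ?powR_ge0// norm_powR1// subr_ge0.
by rewrite mul0r powRr0 mul1r -mulrA -wb'//; ring.
Qed.

Let sqrt_powR (w : R) : 0 < w -> Num.sqrt w = w `^ 2^-1.
Proof. by move=> w0; rewrite powR12_sqrt// ltW. Qed.

Let mgrad gam k : measurable_fun setT
  (fun x : 'rV[R]_n => enorm (surface_grad (test gam k) x) `^ p).
Proof.
have [[_ gu _] _] := test_sobolev gam k.
apply: (measurableT_comp (measurable_powR _)); apply: measurable_fun_enorm => i.
exact: integrable_Rmeasurable (is_surface_grad_integrable i gu).
Qed.

Let msq : measurable_fun setT (fun c : R => Num.sqrt (1 - c ^+ 2)).
Proof.
apply: (measurableT_comp _ mw).
by apply: continuous_measurable_fun; exact: sqrt_continuous.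
Qed.

Let mc := measurable_dotvl Phi.

(** The gradient of sin^(-bet) d has length bet |c| sin^(-bet - 1) d; its p-th power produces the
    factor |c|^p of T. *)
Lemma cvg_gradF : gradF p (test 0 k) @[k --> \oo] --> bet `^ p * sin_moment p.
Proof.
pose v_ k c := profile' 0 bet (e k) c * Num.sqrt (1 - c ^+ 2).
have mv k : measurable_fun setT (v_ k).
  by apply: measurable_funM => //; exact: measurable_profile'.
have -> : (fun k => gradF p (test 0 k)) = fun k => \int[sigma]_x (`|v_ k 'c_x| `^ p * cst 1 'c_x).
  apply/funext => k; apply: ae_eq_Rintegral => //.
    apply: measurable_funM => //; apply: (measurableT_comp (measurable_powR _)).
    by apply: measurableT_comp => //; exact: (measurableT_comp (mv k) mc).
  have [_] := test_sobolev 0 k; apply: filterS => x ->.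
  by rewrite mulr1 normrM (ger0_norm (sqrtr_ge0 _)).
pose f (c : R) := bet `^ p * (`|c| `^ p * (1 - c ^+ 2) `^ (- (b / 2))).
have mf : measurable_fun setT f by apply: measurable_funM => //; exact: measurable_funM.
have fb (c : R) : -1 <= c <= 1 -> 0 < 1 - c ^+ 2 ->
    `| `|c| `^ p * (1 - c ^+ 2) `^ (- (b / 2))| <= 1 * (1 - c ^+ 2) `^ (- (b / 2)).
  move=> c1 w0; rewrite ger0_norm ?mulr_ge0 ?powR_ge0// ler_wpM2r ?powR_ge0//.
  by rewrite norm_powR1// ltW.
have <- : \int[sigma]_x f 'c_x = bet `^ p * sin_moment p.
  rewrite /f /sin_moment RintegralZl//.
  by apply: (@integrable_zonal_power R n Phi n4 SPhi b b1 bn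
    (fun c => `|c| `^ p * (1 - c ^+ 2) `^ (- (b / 2))) 1 _ fb); exact: measurable_funM.
apply: (@cvg_Rintegral_powR v_ (fun c => bet * c * (1 - c ^+ 2) `^ (- (bet / 2) - 1) *
  Num.sqrt (1 - c ^+ 2)) (cst 1) f bet (bet + 1) 0) => //; first exact: ltW.
  by rewrite /b; ring.
move=> c c1 w0; split.
- apply: cvgM; last exact: cvg_cst.
  under eq_fun do rewrite norm_profile'0.
  by apply: cvgM; [exact: cvg_cst|exact: cvg_reg_sin2].
- move=> k; rewrite normrM (ger0_norm (sqrtr_ge0 _)).
  by apply: norm_profile'0_le => //; exact: ltW.
- by rewrite normr1 mul0r oppr0 powRr0.
- rewrite mulr1 /f sqrt_powR// -mulrA wpD// normrM (ger0_norm (powR_ge0 _ _)) normrM gtr0_norm//.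
  rewrite (powRM _ (mulr_ge0 (ltW bet0) (normr_ge0 c)) (powR_ge0 _ _)).
  rewrite (powRM _ (ltW bet0) (normr_ge0 c)) -[RHS]mulrA; congr (_ * (_ * _)).
  by rewrite -powRrM; congr powR; rewrite /b; field.
Qed.

Lemma cvg_gradG gam (f : R -> R) : 0 <= gam -> measurable_fun setT f ->
  (forall c : R, -1 <= c <= 1 -> 0 < 1 - c ^+ 2 ->
    f c = (`|c| `^ gam * (gam * (1 - c ^+ 2) + bet * c ^+ 2)) `^ p * (1 - c ^+ 2) `^ (- (b / 2))) ->
  gradG p (test gam k) @[k --> \oo] --> \int[sigma]_x f 'c_x.
Proof.
move=> g0 mf fE; pose v_ k c := profile' gam bet (e k) c * c * Num.sqrt (1 - c ^+ 2).
have mv k : measurable_fun setT (v_ k).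
  by apply: measurable_funM => //; apply: measurable_funM => //; exact: measurable_profile'.
have -> : (fun k => gradG p (test gam k)) = fun k => \int[sigma]_x (`|v_ k 'c_x| `^ p * cst 1 'c_x).
  apply/funext => k; apply: ae_eq_Rintegral => //.
  - by apply: measurable_funM => //; exact: (measurableT_comp (mr p) mc).
  - apply: measurable_funM => //; apply: (measurableT_comp (measurable_powR _)).
    by apply: measurableT_comp => //; exact: (measurableT_comp (mv k) mc).
  have [_] := test_sobolev gam k; apply: filterS => x ->.
  rewrite mulr1 -powRM ?mulr_ge0 ?sqrtr_ge0//; congr powR.
  by rewrite !normrM (ger0_norm (sqrtr_ge0 _)); ring.
apply: (@cvg_Rintegral_powR v_ (fun c => `|c| `^ gam * (gam * (1 - c ^+ 2) + bet * c ^+ 2) *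
  (1 - c ^+ 2) `^ (- (bet / 2) - 1) * Num.sqrt (1 - c ^+ 2)) (cst 1) f
  (2 `^ (gam / 2) * (gam + bet)) (bet + 1) 0) => //.
- by rewrite mulr_ge0// addr_ge0// ltW.
- by rewrite /b; ring.
move=> c c1 w0; split.
- by apply: cvgM; [exact: cvg_profile'M|exact: cvg_cst].
- move=> k; rewrite normrM (ger0_norm (sqrtr_ge0 _)).
  by apply: norm_profile'M_le => //; exact: ltW.
- by rewrite normr1 mul0r oppr0 powRr0.
- have h0 : 0 <= `|c| `^ gam * (gam * (1 - c ^+ 2) + bet * c ^+ 2).
    by rewrite mulr_ge0 ?powR_ge0// addr_ge0// mulr_ge0 ?sqr_ge0// ltW.
  rewrite mulr1 fE// sqrt_powR// -(mulrA (_ * (gam * _ + _))) wpD//.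
  rewrite (ger0_norm (mulr_ge0 h0 (powR_ge0 _ _))) (powRM _ h0 (powR_ge0 _ _)) -powRrM.
  congr (_ * _); congr powR; by rewrite /b; field.
Qed.

Lemma sin_moment_gt0 r : 0 <= r -> 0 < sin_moment r.
Proof. by move=> r0; exact: zonal_power_gt0. Qed.

Lemma integrable_moment (r : R) : 0 <= r ->
  sigma.-integrable setT (EFin \o (fun x => `|'c_x| `^ r * (1 - 'c_x ^+ 2) `^ (- (b / 2)))).
Proof.
move=> r0; apply: (@integrable_zonal_power R n Phi n4 SPhi b b1 bn
  (fun c => `|c| `^ r * (1 - c ^+ 2) `^ (- (b / 2))) 1); first exact: measurable_funM.
move=> c c1 w0; rewrite ger0_norm ?mulr_ge0 ?powR_ge0// ler_wpM2r ?powR_ge0//.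
exact: norm_powR1.
Qed.

(** [zonal_power_identity] with a = r, where c^2 = 1 - sin^2 d turns the c^2 term into a difference
    of moments. *)
Lemma sin_moment_identity r : 0 <= r ->
  (n%:R - 1 - b) * (sin_moment r - sin_moment' r) = (r + 1) * sin_moment' r.
Proof.
move=> r0; have i1 := integrable_moment r0.
have i2 : sigma.-integrable setT (EFin \o (fun x =>
    `|'c_x| `^ r * (1 - 'c_x ^+ 2) `^ (- (b / 2)) * (1 - 'c_x ^+ 2))).
  apply: (@integrableM_bounded _ _ _ _ 1 i1); first exact: measurable_sin2.
  by move=> x Sx; have /andP[w0 w1] := sqr_itv (dotv_itv SPhi Sx); rewrite ger0_norm.
apply/eqP; rewrite -subr_eq0 -RintegralB// -!RintegralZl//; last exact: RintegrableB.
rewrite -RintegralB//; [|exact/RintegrableZ/RintegrableB|exact: RintegrableZ].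
rewrite -[X in _ == X](@zonal_power_identity R n Phi n4 SPhi b b1 bn r r0); apply/eqP.
by apply: eq_Rintegral => x _; ring.
Qed.

Lemma sin_moment_identity2 r : 0 <= r ->
  (n%:R - 1 - b) * sin_moment (r + 2) = (r + 1) * sin_moment' r.
Proof.
move=> r0; rewrite -sin_moment_identity//; congr (_ * _).
have i1 := integrable_moment r0.
have i2 : sigma.-integrable setT (EFin \o (fun x =>
    `|'c_x| `^ r * (1 - 'c_x ^+ 2) `^ (- (b / 2)) * (1 - 'c_x ^+ 2))).
  apply: (@integrableM_bounded _ _ _ _ 1 i1); first exact: measurable_sin2.
  by move=> x Sx; have /andP[w0 w1] := sqr_itv (dotv_itv SPhi Sx); rewrite ger0_norm.
rewrite -RintegralB//; apply: eq_Rintegral => x _.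
have -> : `|'c_x| `^ (r + 2) = `|'c_x| `^ r * 'c_x ^+ 2.
  have [->|c0] := eqVneq 'c_x 0.
    by rewrite normr0 expr0n mulr0 powR0// gt_eqF// ltr_wpDl.
  rewrite powRD ?normr_eq0 ?c0 ?implybT// powR_mulrn//.
  by rewrite real_normK ?num_real.
ring.
Qed.

End family.
End test_functions.

(** * Sharp constants *)

Section sharp_quotients.
Context {R : realType} {n : nat}.
Implicit Types u : 'rV[R]_n -> R.
Local Notation sigma := (@surface_measure R n).

(** Reduces a supremum of quotients to linear inequalities without division: B is admissible, and
    every admissible M >= 0 is at least B. *)
Lemma sup_quotE (p : R) (num den : ('rV[R]_n -> R) -> \bar R)
    (N D : ('rV[R]_n -> R) -> R) (B : R) : 0 < B ->
  (forall u, sobolev p u -> [/\ num u = (N u)%:E, den u = (D u)%:E, 0 <= D u & N u <= B * D u]) ->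
  (forall M : R, 0 <= M -> (forall u, sobolev p u -> ~ {ae sigma, forall x, u x = 0} ->
     N u <= M * D u) -> B <= M) ->
  sup_quot p num den = B%:E.
Proof.
move=> B0 ub lb; set s := sup_quot p num den.
have quotE u : sobolev p u -> quot (num u) (den u) = (N u / D u)%:E.
  by move=> /ub[-> -> _ _].
have sB : (s <= B%:E)%E.
  apply: ge_ereal_sup => _ [u [pu u0 du] <-]; rewrite quotE// lee_fin.
  have [_ dE D0 ND] := ub u pu; move: du; rewrite dE eqe => Dn0.
  by rewrite ler_pdivrMr// lt_neqAle eq_sym Dn0.
apply/eqP; rewrite eq_le sB /= leNgt; apply/negP => sltB.
(* Under s < B the supremum is real or -oo; the maximum with 0 gives an admissible M in both cases,
   and it is still below B. *)
have := lb (Num.max 0 (fine s)); rewrite le_max lexx => /(_ isT) BM.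
have {BM} : B <= Num.max 0 (fine s).
  apply: BM => u pu u0; have [nE dE D0 ND] := ub u pu.
  (* Functions with zero denominator are outside the supremum; for them the upper bound itself gives
     N u <= 0. *)
  have [Du0|Dn0] := eqVneq (D u) 0; first by move: ND; rewrite Du0 !mulr0.
  have Dp : 0 < D u by rewrite lt_neqAle eq_sym Dn0.
  rewrite -ler_pdivrMr//; have : ((N u / D u)%:E <= s)%E.
    by rewrite -quotE//; apply: ereal_sup_ubound; exists u => //; split; rewrite ?dE ?eqe.
  move: sltB; case: (s) => [r| |] //=.
  by move=> _; rewrite lee_fin le_max => ->; rewrite orbT.
rewrite leNgt => /negP; apply; rewrite gt_max B0/=.
by move: sltB; case: (s) => [r| |] //=; rewrite lte_fin.
Qed.

(** Test sequences exist for bet < al only, so the sharp constants are reached from the left. *)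
Lemma le_left_limit (f : R -> R) (a : R) : 0 < a -> {for a, continuous f} ->
  (forall t, 0 < t < a -> f t <= 0) -> f a <= 0.
Proof.
move=> a0 cf H; have cv : f x @[x --> a^'-] --> f a by apply: cvg_at_left_filter.
rewrite -(cvg_lim _ cv)//; apply: limr_le; first by apply/cvg_ex; exists (f a).
near=> t; apply: H; apply/andP; split; near: t.
- exact: nbhs_left_gt.
- exact: nbhs_left_lt.
Unshelve. all: by end_near. Qed.

Section triple.
(** To be read as X, Y, Z = S, S~, G with kap = n - p, or T, T~, F with kap = p - 1. *)
Variables (p al kap : R) (X Y Z : ('rV[R]_n -> R) -> R).
Hypotheses (p1 : 1 < p) (al0 : 0 < al) (kap0 : 0 < kap).
Hypothesis hardy : forall u, sobolev p u -> [/\ 0 <= X u, 0 <= Y u, 0 <= Z u &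
  al * X u <= kap * Y u + al `^ (1 - p) * Z u].
Hypothesis sharp : forall bet : R, 0 < bet < al -> exists (u_ : nat -> 'rV[R]_n -> R) (x y : R),
  [/\ forall k, sobolev p (u_ k) /\ ~ {ae sigma, forall t, u_ k t = 0},
      0 < x, kap * y = p * (al - bet) * x &
      [/\ X (u_ k) @[k --> \oo] --> x, Y (u_ k) @[k --> \oo] --> y &
          Z (u_ k) @[k --> \oo] --> bet `^ p * x]].

Let A : R := al `^ (p - 1).

Let A0 : 0 < A. Proof. exact: powR_gt0. Qed.

Let alpE : al `^ p = al * A.
Proof.
by rewrite /A powR_mulB1.
Qed.

Let alNE : al `^ (1 - p) = A^-1.
Proof. by rewrite /A -powRN; congr powR; ring. Qed.

(* The test sequences turn a linear inequality between the three functionals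
   into one between its coefficients. *)
Lemma sharp_coef (a c d : R) :
  (forall u, sobolev p u -> ~ {ae sigma, forall t, u t = 0} ->
     a * X u + c * (kap * Y u) + d * Z u <= 0) ->
  forall bet : R, 0 < bet < al -> a + c * (p * (al - bet)) + d * bet `^ p <= 0.
Proof.
move=> H bet bal; have [u_ [x [y [su x0 yE [cX cY cZ]]]]] := sharp bal.
rewrite -(pmulr_lle0 _ x0).
have cv : a * X (u_ k) + c * (kap * Y (u_ k)) + d * Z (u_ k) @[k --> \oo] -->
    a * x + c * (kap * y) + d * (bet `^ p * x).
  apply: cvgD; first apply: cvgD.
  - exact: cvgM (cvg_cst _) cX.
  - exact: cvgM (cvg_cst _) (cvgM (cvg_cst _) cY).
  - exact: cvgM (cvg_cst _) cZ.
have -> : (a + c * (p * (al - bet)) + d * bet `^ p) * x =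
    a * x + c * (kap * y) + d * (bet `^ p * x) by rewrite yE; ring.
rewrite -(cvg_lim _ cv)//; apply: limr_le; first by apply/cvg_ex; eexists; exact: cv.
by apply: nearW => k; have [h1 h2] := su k; exact: H.
Qed.

Let pow_cont (r : R) : 0 <= r -> {for al, continuous (fun t : R => `|t| `^ r)}.
Proof. by move=> r0; exact: (continuous_norm_powR r0 (x := al)). Qed.

Let p0 : 0 <= p. Proof. exact: ltW (lt_trans ltr01 p1). Qed.

Variables (sX sY sZ : ('rV[R]_n -> R) -> \bar R).
Hypothesis sE : forall u, sobolev p u -> [/\ sX u = (X u)%:E, sY u = (Y u)%:E & sZ u = (Z u)%:E].

Lemma sup_quot_sum : sup_quot p (fun u => (al `^ p)%:E * sX u)%E
  (fun u => sZ u + (kap * al `^ (p - 1))%:E * sY u)%E = 1%E.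
Proof.
apply: (@sup_quotE p _ _ (fun u => al `^ p * X u) (fun u => Z u + kap * al `^ (p - 1) * Y u)) => //.
  move=> u su; have [-> -> ->] := sE su; have [X0 Y0 Z0 H] := hardy su.
  rewrite -!EFinM -EFinD; split=> //.
    by rewrite addr_ge0// mulr_ge0// mulr_ge0 ?powR_ge0// ltW.
  rewrite mul1r alpE -/A; have := ler_wpM2l (ltW A0) H.
  rewrite alNE mulrDr mulrA (mulrC A al) => /le_trans; apply.
  by rewrite (mulrA A A^-1) mulfV ?gt_eqF// mul1r mulrCA mulrA addrC.
move=> M M0 H; rewrite -(ler_pM2r (powR_gt0 p al0)) mul1r -subr_le0.
(* The coefficient inequality of [sharp_coef] at bet = t; at t = al the middle term drops out and (1
   - M) al^p <= 0 remains. *)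
pose f (t : R) := al `^ p - M * al `^ (p - 1) * (p * (al - t)) - M * `|t| `^ p.
have -> : al `^ p - M * al `^ p = f al.
  by rewrite /f subrr !mulr0 subr0 gtr0_norm.
apply: le_left_limit => //.
  apply: continuousB; last by apply: continuousM; [exact: cst_continuous|exact: pow_cont].
  apply: continuousB; first exact: cst_continuous.
  apply: continuousM; first exact: cst_continuous.
  apply: continuousM; first exact: cst_continuous.
  by apply: continuousB => //; exact: cst_continuous.
move=> t /andP[t0 ta]; rewrite /f (gtr0_norm t0) -mulNr -(mulNr M (t `^ p)).
apply: sharp_coef; rewrite ?t0// => u su u0.
have := H u su u0; rewrite -subr_le0; congr (_ <= 0); ring.
Qed.

Lemma sup_quot_diff : sup_quot p (fun u => al%:E * sX u - kap%:E * sY u)%E sZ =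
  (al `^ (1 - p))%:E.
Proof.
apply: (@sup_quotE p _ _ (fun u => al * X u - kap * Y u) Z); first exact: powR_gt0.
  move=> u su; have [-> -> ->] := sE su; have [X0 Y0 Z0 H] := hardy su.
  by rewrite -!EFinM -EFinB; split=> //; rewrite lerBlDl.
move=> M M0 H; rewrite alNE -(ler_pM2r (mulr_gt0 al0 A0)) -alpE -subr_le0 alpE mulrCA mulVf ?gt_eqF// mulr1.
pose f (t : R) := al - 1 * (p * (al - t)) - M * `|t| `^ p.
have -> : al - M * (al * A) = f al.
  by rewrite /f subrr !mulr0 subr0 gtr0_norm// alpE.
apply: le_left_limit => //.
  apply: continuousB; last by apply: continuousM; [exact: cst_continuous|exact: pow_cont].
  apply: continuousB; first exact: cst_continuous.
  apply: continuousM; first exact: cst_continuous.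
  apply: continuousM; first exact: cst_continuous.
  by apply: continuousB => //; exact: cst_continuous.
move=> t /andP[t0 ta]; rewrite /f (gtr0_norm t0) -(mulNr 1) -(mulNr M (t `^ p)).
apply: sharp_coef; rewrite ?t0// => u su u0.
have := H u su u0; rewrite -subr_le0; congr (_ <= 0); ring.
Qed.

(** Here numerator and denominator both vanish to first order as bet -> al, like al^p - bet^p and p
    (al - bet). The coefficient inequality has to be divided by p (al - bet) before the limit. *)
Lemma sup_quot_remainder : sup_quot p (fun u => (al `^ p)%:E * sX u - sZ u)%E sY =
  (kap * al `^ (p - 1))%:E.
Proof.
apply: (@sup_quotE p _ _ (fun u => al `^ p * X u - Z u) Y).
- by rewrite mulr_gt0 ?powR_gt0.
- move=> u su; have [-> -> ->] := sE su; have [X0 Y0 Z0 H] := hardy su.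
  rewrite -!EFinM -EFinB; split=> //; rewrite lerBlDl alpE -/A.
  have := ler_wpM2l (ltW A0) H.
  rewrite alNE mulrDr mulrA (mulrC A al) => /le_trans; apply.
  by rewrite (mulrA A A^-1) mulfV ?gt_eqF// mul1r mulrCA mulrA addrC.
move=> M M0 H; rewrite -subr_le0.
pose f (t : R) := kap * `|t| `^ (p - 1) - M.
have -> : kap * al `^ (p - 1) - M = f al by rewrite /f gtr0_norm.
apply: le_left_limit => //.
  apply: continuousB; last exact: cst_continuous.
  by apply: continuousM; [exact: cst_continuous|apply: pow_cont; rewrite subr_ge0 ltW].
move=> t /andP[t0 ta]; rewrite /f (gtr0_norm t0).
have : al `^ p + (- (M / kap)) * (p * (al - t)) + -1 * t `^ p <= 0.
  apply: sharp_coef; rewrite ?t0// => u su u0.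
  have := H u su u0; rewrite -subr_le0; congr (_ <= 0); field.
  by rewrite gt_eqF.
have tpE : t `^ p = t * t `^ (p - 1).
  by rewrite powR_mulB1.
(* The tangent line inequality for the convex function s -> s^p at t, which is Young's inequality
   with weight 1; it bounds the difference quotient from below. *)
have Y' : p * t `^ (p - 1) * (al - t) <= al `^ p - t `^ p.
  have := Young_powR p1 ltr01 (ltW t0) (ltW al0); rewrite powR1 mul1r mulr1.
  by rewrite tpE; lra.
move=> h; have h2 : p * (al - t) * (kap * t `^ (p - 1) - M) <= 0.
  have : kap * (p * t `^ (p - 1) * (al - t)) <= kap * (M / kap * (p * (al - t))).
    rewrite ler_pM2l//; lra.
  by rewrite -subr_le0; congr (_ <= 0); field; rewrite gt_eqF.
have pt : 0 < p * (al - t) by rewrite mulr_gt0 ?subr_gt0// (lt_trans ltr01).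
by rewrite -(pmulr_rle0 _ pt).
Qed.

End triple.
End sharp_quotients.

(** * The functionals on the sphere as instances of the triple *)

Section functionals_sharp.
Context {R : realType} {n : nat}.
Implicit Types (u : 'rV[R]_n -> R) (x : 'rV[R]_n).
Local Notation sigma := (@surface_measure R n).
Variable Phi : 'rV[R]_n.
Hypotheses (n4 : (4 <= n)%N) (SPhi : usphere Phi).
Local Notation "'c_ x" := (dotv Phi x) (at level 8, x at level 2).

Lemma alphaE (p : R) : 1 < p -> p * alpha n p = n%:R - 1 - p.
Proof. by move=> p1; rewrite /alpha; field; rewrite gt_eqF// (lt_trans ltr01). Qed.

Lemma alpha_gt0 (p : R) : 1 < p -> p < n%:R - 1 -> 0 < alpha n p.
Proof.
move=> p1 pn; rewrite /alpha divr_gt0 ?(lt_trans ltr01 p1)//; lra.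
Qed.

Lemma integral_usphereE (f g : 'rV[R]_n -> R) : sigma.-integrable setT (EFin \o g) ->
  (forall x, usphere x -> f x = g x) ->
  (\int[sigma]_(x in usphere) (f x)%:E)%E = (\int[sigma]_x g x)%:E.
Proof.
move=> ig fg; rewrite (eq_integral (EFin \o g)); last first.
  by move=> x; rewrite inE => Sx; rewrite fg.
rewrite integral_usphere; last exact: measurable_int ig.
by rewrite fineK//; exact: integrable_fin_num ig.
Qed.

Lemma sin_geodist x : usphere x -> sin (geodist Phi x) = (1 - 'c_x ^+ 2) `^ 2^-1.
Proof.
move=> Sx; have c1 := dotv_itv SPhi Sx; have /andP[w0 _] := sqr_itv c1.
by rewrite /geodist dotvC sin_acos// powR12_sqrt.
Qed.

Lemma cos_geodist x : usphere x -> cos (geodist Phi x) = 'c_x.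
Proof. by move=> Sx; rewrite /geodist dotvC acosK// in_itv/= dotv_itv. Qed.

Lemma sin_geodist_powR x r : usphere x ->
  (sin (geodist Phi x) `^ r)^-1 = (1 - 'c_x ^+ 2) `^ (- (r / 2)).
Proof. by move=> Sx; rewrite sin_geodist// -powRrM -powRN; congr powR; ring. Qed.

Lemma cot_geodist_powR x r : usphere x ->
  (`|cos (geodist Phi x)| / sin (geodist Phi x)) `^ r = `|'c_x| `^ r * (1 - 'c_x ^+ 2) `^ (- (r / 2)).
Proof.
move=> Sx; have s0 : 0 <= sin (geodist Phi x) by rewrite sin_geodist// powR_ge0.
rewrite cos_geodist// powRM ?invr_ge0// -(powR_inv1 s0) -powRrM mulN1r.
by rewrite (powRN (sin _)) sin_geodist_powR.
Qed.

Variable p : R.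
Hypotheses (p1 : 1 < p) (pn : p < n%:R - 1).
Let al : R := alpha n p.
Let al0 : 0 < al. Proof. exact: alpha_gt0. Qed.
Let alE : p * al = n%:R - 1 - p. Proof. exact: alphaE. Qed.
Let p0 : 0 < p. Proof. exact: lt_trans ltr01 p1. Qed.

(** All three are finite on every Sobolev function by the Hardy inequality, so the +oo convention of
    [quot] is never reached. *)
Lemma sin_functionalsE u : sobolev p u ->
  [/\ Sp Phi p u = (sinS Phi p u)%:E, Sp_tilde Phi p u = (sinSt Phi p u)%:E &
      Gp Phi p u = (gradG Phi p u)%:E].
Proof.
move=> /(sobolev_integrable (ltW p1))[iu iup gu iG].
have iS := hardy_integrable n4 SPhi p1 iu iup gu iG al0 alE.
have [iSt _] := hardy_sin n4 SPhi p1 iu iup gu iG al0 alE.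
split; apply: integral_usphereE => //.
- by move=> x Sx; rewrite sin_geodist_powR.
- by move=> x Sx; rewrite sin_geodist_powR.
- apply: (@integrableM_bounded _ _ _ _ 1 iG).
    exact: (measurableT_comp (@measurable_norm_powR R p) (measurable_dotvl Phi)).
  move=> x Sx; rewrite ger0_norm ?powR_ge0// powR_le1 ?(ltW p0)//.
  by rewrite normr_ge0 ler_norml dotv_itv.
- by move=> x Sx; rewrite cos_geodist.
Qed.

Lemma tan_functionalsE u : 2 <= p -> sobolev p u ->
  [/\ Tp Phi p u = (tanT Phi p u)%:E, Tp_tilde Phi p u = (tanTt Phi p u)%:E &
      Fp p u = (gradF p u)%:E].
Proof.
move=> p2 /(sobolev_integrable (ltW p1))[iu iup gu iG].
have [iT iTt _] := hardy_tan n4 SPhi p1 iu iup gu iG al0 alE p2.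
by split; apply: integral_usphereE => // x Sx; rewrite cot_geodist_powR.
Qed.

Lemma sin_hardy u : sobolev p u ->
  [/\ 0 <= sinS Phi p u, 0 <= sinSt Phi p u, 0 <= gradG Phi p u &
  al * sinS Phi p u <= (n%:R - p) * sinSt Phi p u + al `^ (1 - p) * gradG Phi p u].
Proof.
move=> /(sobolev_integrable (ltW p1))[iu iup gu iG].
have [_ H] := hardy_sin n4 SPhi p1 iu iup gu iG al0 alE.
by split => //; apply: Rintegral_ge0 => x _; rewrite mulr_ge0 ?powR_ge0.
Qed.

Lemma tan_hardy u : 2 <= p -> sobolev p u ->
  [/\ 0 <= tanT Phi p u, 0 <= tanTt Phi p u, 0 <= gradF p u &
  al * tanT Phi p u <= (p - 1) * tanTt Phi p u + al `^ (1 - p) * gradF p u].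
Proof.
move=> p2 /(sobolev_integrable (ltW p1))[iu iup gu iG].
have [_ _ H] := hardy_tan n4 SPhi p1 iu iup gu iG al0 alE p2.
by split => //; apply: Rintegral_ge0 => x _; rewrite ?mulr_ge0 ?powR_ge0// mulr_ge0 ?powR_ge0.
Qed.

Let admissible bet : 0 < bet < al -> bet * p + p < n%:R - 1.
Proof. by move=> /andP[_ ba]; rewrite -ltrBrDr -alE mulrC ltr_pM2l. Qed.

(* With gam = bet the gradient of the limit profile has |cos d|^p |grad u|^p equal
   to bet^p |u|^p / sin^p d, because bet sin^2 d + bet cos^2 d = bet. *)
Lemma sin_sharp (bet : R) : 0 < bet < al -> exists (u_ : nat -> 'rV[R]_n -> R) (s t : R),
  [/\ forall k, sobolev p (u_ k) /\ ~ {ae sigma, forall x, u_ k x = 0},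
      0 < s, (n%:R - p) * t = p * (al - bet) * s &
      [/\ sinS Phi p (u_ k) @[k --> \oo] --> s, sinSt Phi p (u_ k) @[k --> \oo] --> t &
          gradG Phi p (u_ k) @[k --> \oo] --> bet `^ p * s]].
Proof.
move=> bal; have bn := admissible bal; have /andP[b0 _] := bal; have bp0 := ltW (mulr_gt0 b0 p0).
pose f (c : R) := bet `^ p * (`|c| `^ (bet * p) * (1 - c ^+ 2) `^ (- ((bet * p + p) / 2))).
have mf : measurable_fun setT f.
  apply: measurable_funM => //; apply: measurable_funM; first exact: measurable_norm_powR.
  apply: (measurableT_comp (measurable_powR _)).
  by apply: measurable_funB => //; exact: measurable_funX.
have fE : \int[sigma]_x f 'c_x = bet `^ p * sin_moment Phi p bet (bet * p).
  by rewrite /f /sin_moment RintegralZl//; exact: integrable_moment.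
exists (fun k x => profile bet bet k.+1%:R^-1 'c_x).
exists (sin_moment Phi p bet (bet * p)), (sin_moment' Phi p bet (bet * p)); split.
- by move=> k; split; [exact: (@test_sobolev R n Phi SPhi p bet p1 bet k).1|exact: test_neq0].
- exact: sin_moment_gt0.
- have := sin_moment_identity n4 SPhi p1 b0 bn bp0; rewrite mulrBr => /eqP.
  rewrite subr_eq -mulrDl => /eqP H.
  have -> : p * (al - bet) = n%:R - 1 - (bet * p + p) by rewrite mulrBr alE; ring.
  by rewrite H; congr (_ * _); ring.
split; [exact: cvg_sinS (ltW b0)|exact: cvg_sinSt (ltW b0)|].
rewrite -fE; apply: cvg_gradG => //; first exact: ltW.
move=> c c1 w0; rewrite -mulrDr subrK mulr1 powRM ?powR_ge0 ?(ltW b0)// -powRrM /f.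
by rewrite mulrA (mulrC (bet `^ p)).
Qed.

(** With gam = 0 the weights of T and T~ are themselves the powers |c|^p and |c|^(p - 2), which
    [sin_moment_identity2] relates at r = p - 2; there r + 1 = p - 1. *)
Lemma tan_sharp (bet : R) : 2 <= p -> 0 < bet < al -> exists (u_ : nat -> 'rV[R]_n -> R) (s t : R),
  [/\ forall k, sobolev p (u_ k) /\ ~ {ae sigma, forall x, u_ k x = 0},
      0 < s, (p - 1) * t = p * (al - bet) * s &
      [/\ tanT Phi p (u_ k) @[k --> \oo] --> s, tanTt Phi p (u_ k) @[k --> \oo] --> t &
          gradF p (u_ k) @[k --> \oo] --> bet `^ p * s]].
Proof.
move=> p2 bal; have bn := admissible bal; have /andP[b0 _] := bal.
exists (fun k x => profile 0 bet k.+1%:R^-1 'c_x).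
exists (sin_moment Phi p bet p), (sin_moment' Phi p bet (p - 2)); split.
- by move=> k; split; [exact: (@test_sobolev R n Phi SPhi p bet p1 0 k).1|exact: test_neq0].
- exact: sin_moment_gt0 (ltW p0).
- have p20 : 0 <= p - 2 by rewrite subr_ge0.
  have := sin_moment_identity2 n4 SPhi p1 b0 bn p20; rewrite subrK => H.
  have -> : p * (al - bet) = n%:R - 1 - (bet * p + p) by rewrite mulrBr alE; ring.
  by rewrite H; congr (_ * _); ring.
by split; [exact: cvg_tanT|exact: cvg_tanTt|exact: cvg_gradF].
Qed.

End functionals_sharp.

Theorem theorem6 (R : realType) (n : nat) (hn : (4 <= n)%N)
    (Phi : 'rV[R]_n) (hPhi : usphere Phi) :
  [/\ forall p : R, 1 < p -> p < n%:R - 1 ->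
        sup_quot p
          (fun u => (alpha n p `^ p)%:E * Sp Phi p u)%E
          (fun u => Gp Phi p u
                    + ((n%:R - p) * alpha n p `^ (p - 1))%:E * Sp_tilde Phi p u)%E
          = 1%E
        /\
        sup_quot p
          (fun u => (alpha n p)%:E * Sp Phi p u - (n%:R - p)%:E * Sp_tilde Phi p u)%E
          (fun u => Gp Phi p u)
          = (alpha n p `^ (1 - p))%:E,
      forall p : R, 1 < p -> p < n%:R / 2 ->
        sup_quot p
          (fun u => (alpha n p `^ p)%:E * Sp Phi p u - Gp Phi p u)%E
          (fun u => Sp_tilde Phi p u)
          = ((n%:R - p) * alpha n p `^ (p - 1))%:E
    & forall p : R, 2 <= p -> p < n%:R - 1 ->
        [/\ sup_quot p
              (fun u => (alpha n p `^ p)%:E * Tp Phi p u)%E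
              (fun u => Fp p u
                        + ((p - 1) * alpha n p `^ (p - 1))%:E * Tp_tilde Phi p u)%E
              = 1%E,
            sup_quot p
              (fun u => (alpha n p)%:E * Tp Phi p u - (p - 1)%:E * Tp_tilde Phi p u)%E
              (fun u => Fp p u)
              = (alpha n p `^ (1 - p))%:E
          & sup_quot p
              (fun u => (alpha n p `^ p)%:E * Tp Phi p u - Fp p u)%E
              (fun u => Tp_tilde Phi p u)
              = ((p - 1) * alpha n p `^ (p - 1))%:E]].
Proof.
have kapS (p : R) : p < n%:R - 1 -> 0 < n%:R - p by lra.
split=> [p p1 pn|p p1 pn|p p2 pn].
- have al0 := alpha_gt0 p1 pn; have k0 := kapS p pn.
  split.
    exact: (sup_quot_sum p1 al0 k0 (sin_hardy hn hPhi p1 pn) (sin_sharp hn hPhi p1)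
      (sin_functionalsE hn hPhi p1 pn)).
  exact: (sup_quot_diff p1 al0 (sin_hardy hn hPhi p1 pn) (sin_sharp hn hPhi p1)
    (sin_functionalsE hn hPhi p1 pn)).
- have {}pn : p < n%:R - 1.
    have : (4 : R) <= n%:R by rewrite (ler_nat R 4 n).
    lra.
  exact: (sup_quot_remainder p1 (alpha_gt0 p1 pn) (kapS p pn) (sin_hardy hn hPhi p1 pn)
    (sin_sharp hn hPhi p1) (sin_functionalsE hn hPhi p1 pn)).
- have p1 : 1 < p by lra.
  have al0 := alpha_gt0 p1 pn; have k0 : 0 < p - 1 by rewrite subr_gt0.
  have hH u := tan_hardy (u := u) hn hPhi p1 pn p2.
  have hS bet := tan_sharp (bet := bet) hn hPhi p1 p2.
  have hE u := tan_functionalsE (u := u) hn hPhi p1 pn p2.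
  split; [exact: (sup_quot_sum p1 al0 k0 hH hS hE)|exact: (sup_quot_diff p1 al0 hH hS hE)|
    exact: (sup_quot_remainder p1 al0 k0 hH hS hE)].
Qed.
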